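(* Let $T\in(0,+\infty)$, let $u_0\in L^2(\mathbb{R}^d;\mathbb{R}^d)$ be such that $\operatorname{div}u_0=0$, and let $u,U$ be two admissible weak solutions on $\mathbb{R}^d\times(0,T)$ of the incompressible Euler equations with initial datum $u_0$. If $$\nabla^sU\in L^1([0,T];L^\infty(\mathbb{R}^d;\mathbb{R}^{d\times d})),$$ then $u=U$.
   Context: The incompressible Euler equations on $\mathbb{R}^d\times(0,T)$ are $\partial_tu+\operatorname{div}(u\otimes u)+\nabla p=0$, $\operatorname{div}u=0$, $u(\cdot,0)=u_0$. Weak solution: given $u_0\in L^2(\mathbb{R}^d;\mathbb{R}^d)$ with $\operatorname{div}u_0=0$ (in the sense of distributions), a function $u\in L^\infty([0,T];L^2(\mathbb{R}^d;\mathbb{R}^d))$ is a weak solution of the Euler equations with initial datum $u_0$ if for a.e. $\tau\in(0,T)$ $$\int_0^\tau\int_{\mathbb{R}^d}(u\cdot\partial_t\varphi+u\otimes u:\nabla\varphi)\,dx\,dt=\int_{\mathbb{R}^d}u(x,\tau)\cdot\varphi(x,\tau)\,dx-\int_{\mathbb{R}^d}u_0(x)\cdot\varphi(x,0)\,dx,\qquad \int_{\mathbb{R}^d}u(x,\tau)\cdot\nabla q(x)\,dx=0,$$ for all $\varphi\in\mathrm{Lip}(\mathbb{R}^d\times(0,T);\mathbb{R}^d)\cap\mathrm{Lip}((0,T);L^2(\mathbb{R}^d;\mathbb{R}^d)\cap W^{1,\infty}(\mathbb{R}^d;\mathbb{R}^d))$ with $\operatorname{div}\varphi=0$ and all $q\in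 W^{1,2}(\mathbb{R}^d)$. Any weak solution is always identified with its representative in $C([0,T];w\text{-}L^2(\mathbb{R}^d;\mathbb{R}^d))$ (continuous in time for the weak topology of $L^2$). Admissible: a weak solution $u$ with initial datum $u_0$ is admissible if $\int_{\mathbb{R}^d}|u(x,t)|^2dx\le\int_{\mathbb{R}^d}|u_0(x)|^2dx$ for a.e. $t\in(0,T)$. $\nabla^sU=\frac12(\nabla U+(\nabla U)^{T})$ is the symmetric part of the distributional spatial gradient. *)

(* Defs.v *)
From HB Require Import structures.
From mathcomp Require Import all_boot all_order all_algebra.
From mathcomp Require Import all_classical all_reals all_analysis.

Set Implicit Arguments.
Unset Strict Implicit.
Unset Printing Implicit Defensive.

Import Order.TTheory GRing.Theory Num.Theory.
Import numFieldNormedType.Exports.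

Local Open Scope classical_set_scope.
Local Open Scope ring_scope.

Definition measure_rV_display : measure_display.
Proof. exact. Qed.

Section measurable_rV.
Context (R : realType) (n : nat).

Let coord (i : 'I_n) (x : 'rV[R]_n) : measurableTypeR R := x 0 i.

Let rV_set0 : g_sigma_preimage coord set0.
Proof. exact: sigma_algebra0. Qed.

Let rV_setC A : g_sigma_preimage coord A -> g_sigma_preimage coord (~` A).
Proof. exact: sigma_algebraC. Qed.

Let rV_bigcup (F : (set 'rV[R]_n)^nat) :
  (forall i, g_sigma_preimage coord (F i)) ->
  g_sigma_preimage coord (\bigcup_i (F i)).
Proof. exact: sigma_algebra_bigcup. Qed.

(* The sigma-algebra generated by the coordinates, i.e. the Borel one. *)
HB.instance Definition _ := @isMeasurable.Build measure_rV_display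
  'rV[R]_n (g_sigma_preimage coord) rV_set0 rV_setC rV_bigcup.

Lemma measurable_coord (i : 'I_n) :
  measurable_fun [set: 'rV[R]_n] (fun x : 'rV[R]_n => x 0 i).
Proof.
move=> _ Y mY; rewrite setTI; apply: sub_sigma_algebra => /=.
rewrite -bigcup_seq/=; exists i => /=; first by rewrite mem_index_enum.
by exists Y => //; rewrite setTI.
Qed.

Lemma measurable_fun_rVP d (T : measurableType d) (f : T -> 'rV[R]_n) :
  (forall i, measurable_fun [set: T] (fun t => f t 0 i)) ->
  measurable_fun [set: T] f.
Proof.
move=> mf.
have : g_sigma_preimage (fun i => coord i \o f) `<=` measurable.
  apply: smallest_sub; first exact: sigma_algebra_measurable.
  rewrite -bigcup_seq; apply: bigcup_sub => i _.
  by move=> A [B mB <-]; exact: mf.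
rewrite g_sigma_preimage_comp => prefS.
by move=> _ A mA; apply: prefS; exists A.
Qed.

End measurable_rV.

Section lebesgue_rV.
Context (R : realType).

Definition consrV n (p : measurableTypeR R * 'rV[R]_n) : 'rV[R]_n.+1 :=
  row_mx (p.1)%:M p.2.

Lemma measurable_consrV n : measurable_fun setT (@consrV n).
Proof.
apply: measurable_fun_rVP => i.
rewrite [X in measurable_fun _ X](_ : _ = fun p : measurableTypeR R * 'rV[R]_n =>
  match fintype.split (i : 'I_(1 + n)) with inl _ => p.1 | inr j => p.2 0 j end).
  case: (fintype.split _) => j; first exact: measurable_fst.
  by apply: (measurableT_comp (measurable_coord j)); exact: measurable_snd.
apply/funext => p; rewrite /consrV mxE; case: fintype.split => j //.
by rewrite !ord1 mxE.
Qed.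

Definition unconsrV n (v : 'rV[R]_n.+1) : measurableTypeR R * 'rV[R]_n :=
  ((v : 'rV_(1 + n)) 0 0, rsubmx (v : 'rV_(1 + n))).

Lemma consrVK n : cancel (@consrV n) (@unconsrV n).
Proof.
case=> x v; rewrite /unconsrV /consrV /= row_mxKr; congr pair.
by rewrite mxE; case: fintype.splitP => j //= _; rewrite !ord1 mxE.
Qed.

Lemma measurable_unconsrV n : measurable_fun setT (@unconsrV n).
Proof.
apply/measurable_fun_pairP; split.
  exact: (@measurable_coord R n.+1 ord0).
apply: measurable_fun_rVP => i.
rewrite [X in measurable_fun _ X](_ : _ = fun v : 'rV[R]_n.+1 =>
  v 0 (rshift 1 i)); first exact: (@measurable_coord R n.+1).
by apply/funext => v; rewrite mxE.
Qed.

Section step.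
Context n (mu : {sigma_finite_measure set 'rV[R]_n -> \bar R}).

Definition lebesgue_step : set 'rV[R]_n.+1 -> \bar R :=
  pushforward (@lebesgue_measure R \x mu)%E (@consrV n).

Let step0 : lebesgue_step set0 = 0%E.
Proof. by rewrite /lebesgue_step /pushforward preimage_set0 measure0. Qed.

Let step_ge0 A : (0 <= lebesgue_step A)%E.
Proof. exact: (measure_ge0 (@lebesgue_measure R \x mu)%E). Qed.

Let step_sigma_additive : semi_sigma_additive lebesgue_step.
Proof.
move=> F mF tF mUF; rewrite /lebesgue_step /pushforward preimage_bigcup.
apply: measure_semi_sigma_additive.
- by move=> k; rewrite -[X in measurable X]setTI; exact: measurable_consrV.
- apply/trivIsetP => /= i j _ _ ij; rewrite -preimage_setI.
  by move/trivIsetP : tF => /(_ _ _ _ _ ij) ->//; rewrite preimage_set0.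
- by rewrite -preimage_bigcup -[X in measurable X]setTI;
    exact: measurable_consrV.
Qed.

HB.instance Definition _ := isMeasure.Build _ _ _ lebesgue_step
  step0 step_ge0 step_sigma_additive.

Let step_sigma_finite : sigma_finite setT lebesgue_step.
Proof.
have /sigma_finiteP[F [TF ndF Foo]] := sigma_finiteT (@lebesgue_measure R).
have /sigma_finiteP[G [TG ndG Goo]] := sigma_finiteT mu.
exists (fun k => (@unconsrV n) @^-1` (F k `*` G k)).
  rewrite -preimage_bigcup -[LHS](preimage_setT (@unconsrV n)); congr preimage.
  rewrite -setXTT TF TG predeqE => -[x y]; split.
    move=> [/= [i _ Fix] [k _ Gky]]; exists (maxn i k) => //; split.
    - by move: x Fix; exact/subsetPset/ndF/leq_maxl.
    - by move: y Gky; exact/subsetPset/ndG/leq_maxr.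
  by move=> [i _ []/= ? ?]; split; exists i.
move=> k; have [mF Fkoo] := Foo k; have [mG Gkoo] := Goo k; split.
  rewrite -[X in measurable X]setTI; apply: measurable_unconsrV => //.
  exact: measurableX.
rewrite /lebesgue_step /pushforward -comp_preimage.
rewrite (_ : _ \o _ = id) ?preimage_id; last first.
  by apply/funext => p /=; rewrite consrVK.
by rewrite product_measure1E// lte_mul_pinfty// ge0_fin_numE.
Qed.

HB.instance Definition _ := Measure_isSigmaFinite.Build _ _ _ lebesgue_step
  step_sigma_finite.

End step.

Fixpoint lebesgue_rV n : {sigma_finite_measure set 'rV[R]_n -> \bar R} :=
  if n is n'.+1 then lebesgue_step (lebesgue_rV n')
  else \d_(0 : 'rV[R]_0).

End lebesgue_rV.

Section fields.
Context (R : realType) (d : nat).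

Local Notation E := 'rV[R]_d.
Local Notation lebE := (@lebesgue_rV R d).
Local Notation lebT := (@lebesgue_measure R).

(* Frobenius product and norm; on row vectors these are the Euclidean ones
   (the library norm on matrices is the sup norm). *)
Definition mxdot m n (A B : 'M[R]_(m, n)) : R :=
  \sum_i \sum_j A i j * B i j.

Definition mxnorm2 m n (A : 'M[R]_(m, n)) : R := Num.sqrt (mxdot A A).

Definition Lpnorm m n (p : \bar R) (v : E -> 'M[R]_(m, n)) : \bar R :=
  'N[lebE]_p [EFin \o (fun x => mxnorm2 (v x))].

Definition in_Lp m n (p : \bar R) (v : E -> 'M[R]_(m, n)) : Prop :=
  (forall i j, measurable_fun setT (fun x => v x i j)) /\
  (Lpnorm p v < +oo)%E.

Definition pderiv (j : 'I_d) (f : E -> R) : E -> R :=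
  fun x => 'D_(delta_mx 0 j) f x.

Fixpoint Ck (k : nat) (f : E -> R) : Prop :=
  if k is k'.+1 then
    continuous f /\
    forall j, (forall x, derivable f x (delta_mx 0 j)) /\ Ck k' (pderiv j f)
  else continuous f.

Definition test_function (psi : E -> R) : Prop :=
  (forall k, Ck k psi) /\
  exists K : set E, compact K /\ forall x, ~ K x -> psi x = 0.

(* The distributional gradient, (nabla v)_ij = d_j v_i. *)
Definition dist_grad m (v : E -> 'rV[R]_m) (psi : E -> R) : 'M[R]_(m, d) :=
  \matrix_(i, j) - \int[lebE]_x (v x 0 i * pderiv j psi x).

Definition dist_symgrad (v : E -> E) (psi : E -> R) : 'M[R]_d :=
  2^-1 *: (dist_grad v psi + (dist_grad v psi)^T).

Definition dist_of m n (G : E -> 'M[R]_(m, n)) (psi : E -> R) : 'M[R]_(m, n) :=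
  \matrix_(i, j) \int[lebE]_x (G x i j * psi x).

Definition is_weak_grad m (v : E -> 'rV[R]_m) (G : E -> 'M[R]_(m, d)) : Prop :=
  forall psi, test_function psi -> dist_grad v psi = dist_of G psi.

Definition div_free (v : E -> E) : Prop :=
  forall psi, test_function psi -> \tr (dist_grad v psi) = 0.

(* v belongs to W^{1,p} and G is its weak gradient. *)
Definition in_W1p m (p : \bar R) (v : E -> 'rV[R]_m)
    (G : E -> 'M[R]_(m, d)) : Prop :=
  [/\ in_Lp p v, in_Lp p G & is_weak_grad v G].

Definition simple_L2 (s : R -> E -> E) : Prop :=
  exists (k : nat) (A : 'I_k -> set (measurableTypeR R)) (w : 'I_k -> E -> E),
    [/\ forall i, measurable (A i), forall i, in_Lp 2 (w i) &
        forall t x, s t x = \sum_i \1_(A i) t *: w i x].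

(* L^oo([0,T]; L^2), with Bochner (strong) measurability in time. *)
Definition in_LooL2 (T : R) (u : R -> E -> E) : Prop :=
  [/\ \forall t \ae lebT, t \in `]0, T[ -> in_Lp 2 (u t),
      exists2 s : nat -> R -> E -> E, (forall n, simple_L2 (s n)) &
        \forall t \ae lebT, t \in `]0, T[ ->
          Lpnorm 2 (fun x => s n t x - u t x) @[n --> \oo] --> 0%E &
      exists C : R, \forall t \ae lebT, t \in `]0, T[ ->
        (Lpnorm 2 (u t) <= C%:E)%E].

Definition in_CwL2 (T : R) (u : R -> E -> E) : Prop :=
  (forall t : R, t \in `[0, T] -> in_Lp 2 (u t)) /\
  forall w : E -> E, in_Lp 2 w ->
    {within `[0, T], continuous (fun t => \int[lebE]_x mxdot (u t x) (w x))}.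

(* phi belongs to Lip(R^d x (0,T)) and to Lip((0,T); L^2 cap W^{1,oo}), div
   phi = 0, and G is the spatial gradient of phi.  Such a phi extends uniquely
   by continuity to t = 0, where the weak formulation evaluates it; phi stands
   for the extended field, so all conditions are imposed on [0,T). *)
Definition test_field (T : R) (phi : R -> E -> E) (G : R -> E -> 'M[R]_d) :
    Prop :=
  [/\ exists K : R, forall (s t : R) x y, s \in `[0, T[ -> t \in `[0, T[ ->
        mxnorm2 (phi t x - phi s y) <= K * (`|t - s| + mxnorm2 (x - y)),
      forall t : R, t \in `[0, T[ ->
        in_Lp 2 (phi t) /\ in_W1p +oo (phi t) (G t),
      exists K : R, forall s t : R, s \in `[0, T[ -> t \in `[0, T[ ->
        [/\ (Lpnorm 2 (fun x => phi t x - phi s x)%R <= (K * `|t - s|)%:E)%E,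
            (Lpnorm +oo (fun x => phi t x - phi s x)%R <= (K * `|t - s|)%:E)%E &
            (Lpnorm +oo (fun x => G t x - G s x)%R <= (K * `|t - s|)%:E)%E] &
      forall t : R, t \in `[0, T[ -> div_free (phi t)].

(* The time derivative is the classical one, which exists at almost every
   (t, x) as phi is Lipschitz. *)
Definition momentum_eq (u0 : E -> E) (u : R -> E -> E) (tau : R)
    (phi : R -> E -> E) (G : R -> E -> 'M[R]_d) : Prop :=
  \int[lebT]_(t in `]0, tau[) \int[lebE]_x
    (mxdot (u t x) (derive1 (fun s => phi s x) t) +
     mxdot ((u t x)^T *m u t x) (G t x))
  = \int[lebE]_x mxdot (u tau x) (phi tau x)
    - \int[lebE]_x mxdot (u0 x) (phi 0 x).

(* The last clause fixes the representative of u in C([0,T]; w-L^2). *)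
Definition weak_solution (T : R) (u0 : E -> E) (u : R -> E -> E) : Prop :=
  [/\ in_LooL2 T u,
      \forall tau \ae lebT, tau \in `]0, T[ ->
        (forall phi G, test_field T phi G -> momentum_eq u0 u tau phi G) /\
        (forall (q : E -> 'rV[R]_1) (g : E -> E), in_W1p 2 q g ->
          \int[lebE]_x mxdot (u tau x) (g x) = 0) &
      in_CwL2 T u].

Definition admissible (T : R) (u0 : E -> E) (u : R -> E -> E) : Prop :=
  \forall t \ae lebT, t \in `]0, T[ ->
    (\int[lebE]_x (mxnorm2 (u t x) ^+ 2)%:E <=
     \int[lebE]_x (mxnorm2 (u0 x) ^+ 2)%:E)%E.

(* L^oo is not separable: membership in L^1([0,T]; L^oo) is expressed by a
   jointly measurable representative with integrable L^oo norm, which is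
   weaker than Bochner measurability. *)
Definition in_L1Loo m n (T : R) (D : R -> E -> 'M[R]_(m, n)) : Prop :=
  (forall i j, measurable_fun (`]0%R, T[ `*` setT)
     (fun p : measurableTypeR R * E => D p.1 p.2 i j)) /\
  (\int[lebT]_(t in `]0%R, T[) Lpnorm +oo (D t) < +oo)%E.

Definition symgrad_in_L1Loo (T : R) (U : R -> E -> E) : Prop :=
  exists2 D : R -> E -> 'M[R]_d, in_L1Loo T D &
    \forall t \ae lebT, t \in `]0, T[ ->
      forall psi, test_function psi -> dist_symgrad (U t) psi = dist_of (D t) psi.

End fields.

(* Main.v *)
(* Only fields constant in time are used as test fields: [rho * w], with [rho] a smooth even
   compactly supported kernel and [w] a divergence-free [L^2] field.  Testing with them shows
   that [rho * u] and [rho * U] are Lipschitz in time with values in [L^2], so that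
   [<u(t), rho * rho * U(t)>] has time derivative [T(u,u,rho*rho*U) + T(U,U,rho*rho*u)], where
   [T(a,b,w) = int a_i b_j d_j w_i].  With [S] the symmetric gradient of [U], the product rule
   gives [T(U,U,v) = - 2 int S_ij U_j v_i] for mollified divergence-free [v], and
   [T(u,u,rho*rho*U) = int (rho*rho*S)_ij u_i u_j] by symmetry; as [rho] shrinks, the sum tends to
   [int S_ij (u - U)_i (u - U)_j], since [int S_ij U_i U_j = 0].  The energy inequalities then give
   [|u - U|^2(t) <= 2 |u0|^2 - 2 <u, U>(t) <= 2 d int_0^t |S|_oo |u - U|^2], and Gronwall's lemma
   concludes. *)
Require Import Defs.
From HB Require Import structures.
From mathcomp Require Import all_boot all_order all_algebra.
From mathcomp Require Import all_classical all_reals all_analysis.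
From mathcomp Require Import measurable_realfun ess_sup_inf.
From mathcomp Require Import ring lra.
Import Order.TTheory GRing.Theory Num.Theory.
Import numFieldNormedType.Exports.
Set Implicit Arguments.
Unset Strict Implicit.
Unset Printing Implicit Defensive.
Local Open Scope classical_set_scope.
Local Open Scope ring_scope.

(** * Square-integrable functions *)

(** The obstacle is that no bound on $\nabla U$ is available, only on its symmetric part, so
    derivatives of $U$ may enter the estimates only after symmetrisation. One kernel is needed
    because a test field must be Lipschitz, whereas $U$ is merely $L^2$ in space; the second kernel
    turns the pairing into $\langle\rho*u,\rho*U\rangle$, which treats both solutions alike. The
    time derivative of this pairing is never taken: the pairing minus the integral of its expected
    derivative has increments of order $(t-s)^2$, and such a function is constant. The delicate
    limit in $\rho$ is that of $\rho*S$ against $u_iu_j$: $S$ is only bounded and $u_iu_j$ only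
    integrable, so the kernel is moved onto the product, reduced to squares by polarisation, and the
    error is measured by the $L^2$ errors of the factors. The limit is found separately at almost
    every time; no measurability in time of that limit is established, and the passage under the
    time integral uses a one-sided bound by a measurable function instead. *)

Lemma sqr_le_norm {R : realDomainType} (a b : R) : `|a| <= b -> a ^+ 2 <= b ^+ 2.
Proof. by rewrite ler_norml => /andP[h1 h2]; nra. Qed.

Section square_integrable.
Context {d : measure_display} {X : measurableType d} {R : realType}.
Variable mu : {measure set X -> \bar R}.
Implicit Types (f g h : X -> R).

Definition ig f := mu.-integrable setT (EFin \o f).

Definition sqi f := measurable_fun setT f /\ ig (fun x => f x ^+ 2).

(** The squared $L^2$ norm. Real integrals go through [fine], so the value is 0 when the integral is
    infinite; this is why the estimates below carry [sqi]. *)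
Definition n2 f := \int[mu]_x (f x ^+ 2).

Lemma igM f : ig f -> measurable_fun setT f.
Proof. by move=> /measurable_int/measurable_EFinP. Qed.

Lemma eq_ig f g : f =1 g -> ig f -> ig g.
Proof. by move=> /funext ->. Qed.

Lemma eq_sqi f g : f =1 g -> sqi f -> sqi g.
Proof. by move=> /funext ->. Qed.

Lemma eq_int f g : f =1 g -> \int[mu]_x f x = \int[mu]_x g x.
Proof. by move=> /funext ->. Qed.

Lemma ig_le f g : measurable_fun setT f -> ig g -> (forall x, `|f x| <= g x) ->
  ig f.
Proof.
move=> mf ig_g fg; apply: le_integrable ig_g => //; first exact/measurable_EFinP.
by move=> x _ /=; rewrite lee_fin (le_trans (fg x))// ler_norm.
Qed.

Lemma igD f g : ig f -> ig g -> ig (fun x => f x + g x).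
Proof. by move=> hf hg; apply: eq_integrable (integrableD _ hf hg). Qed.

Lemma igN f : ig f -> ig (fun x => - f x).
Proof. by move=> hf; apply: eq_integrable (integrableN hf). Qed.

Lemma igB f g : ig f -> ig g -> ig (fun x => f x - g x).
Proof. by move=> hf hg; apply: igD => //; exact: igN. Qed.

Lemma igZ c f : ig f -> ig (fun x => c * f x).
Proof. by move=> hf; apply: eq_integrable (integrableZl _ c hf). Qed.

Lemma ig_norm f : ig f -> ig (fun x => `|f x|).
Proof. exact: integrable_norm. Qed.

Lemma ig0 : ig (fun=> 0).
Proof. exact: integrable0. Qed.

Lemma ig_sum I (s : seq I) (F : I -> X -> R) : (forall i, ig (F i)) ->
  ig (fun x => \sum_(i <- s) F i x).
Proof.
move=> hF; elim: s => [|i s IH].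
  by apply: eq_ig ig0 => x; rewrite big_nil.
by apply: eq_ig (igD (hF i) IH) => x; rewrite big_cons.
Qed.

Lemma intD f g : ig f -> ig g ->
  \int[mu]_x (f x + g x) = \int[mu]_x f x + \int[mu]_x g x.
Proof. exact: RintegralD. Qed.

Lemma intB f g : ig f -> ig g ->
  \int[mu]_x (f x - g x) = \int[mu]_x f x - \int[mu]_x g x.
Proof. exact: RintegralB. Qed.

Lemma intZ c f : ig f -> \int[mu]_x (c * f x) = c * \int[mu]_x f x.
Proof. exact: RintegralZl. Qed.

Lemma int0 : \int[mu]_(x in setT) (0 : R) = 0.
Proof. by rewrite /Rintegral integral0. Qed.

Lemma intN f : ig f -> \int[mu]_x (- f x) = - \int[mu]_x f x.
Proof.
move=> hf; rewrite -mulN1r -intZ//; apply: eq_int => x; by rewrite mulN1r.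
Qed.

Lemma int_sum I (s : seq I) (F : I -> X -> R) : (forall i, ig (F i)) ->
  \int[mu]_x (\sum_(i <- s) F i x) = \sum_(i <- s) \int[mu]_x F i x.
Proof.
move=> hF; elim: s => [|i s IH].
  by rewrite big_nil -[RHS]int0; apply: eq_int => x; rewrite big_nil.
rewrite big_cons -IH -intD//; last exact: ig_sum.
by apply: eq_int => x; rewrite big_cons.
Qed.

Lemma le_int f g : ig f -> ig g -> (forall x, f x <= g x) ->
  \int[mu]_x f x <= \int[mu]_x g x.
Proof. by move=> hf hg fg; apply: le_Rintegral. Qed.

Lemma int_ge0 f : (forall x, 0 <= f x) -> 0 <= \int[mu]_x f x.
Proof. by move=> f0; apply: Rintegral_ge0. Qed.

Lemma norm_int f : ig f -> `|\int[mu]_x f x| <= \int[mu]_x `|f x|.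
Proof. exact: le_normr_Rintegral. Qed.

Lemma n2_ge0 f : 0 <= n2 f.
Proof. by apply: int_ge0 => x; exact: sqr_ge0. Qed.

Lemma sqi_sq f : sqi f -> ig (fun x => f x ^+ 2).
Proof. by case. Qed.

Lemma sqi_mul f g : sqi f -> sqi g -> ig (fun x => f x * g x).
Proof.
move=> [mf hf] [mg hg]; apply: (@ig_le _ (fun x => f x ^+ 2 + g x ^+ 2)).
- exact: measurable_funM.
- exact: igD.
- move=> x; rewrite ler_norml; apply/andP; split; nra.
Qed.

Lemma sqiZ c f : sqi f -> sqi (fun x => c * f x).
Proof.
move=> [mf hf]; split; first exact: measurable_funM.
by apply: eq_ig (igZ (c ^+ 2) hf) => x; rewrite exprMn.
Qed.

Lemma sqiD f g : sqi f -> sqi g -> sqi (fun x => f x + g x).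
Proof.
move=> hf hg; split.
  by apply: measurable_funD; [exact: hf.1|exact: hg.1].
apply: eq_ig (igD (igD (sqi_sq hf) (sqi_sq hg)) (igZ 2 (sqi_mul hf hg))) => x.
by rewrite sqrrD; ring.
Qed.

Lemma sqiB f g : sqi f -> sqi g -> sqi (fun x => f x - g x).
Proof.
move=> hf hg; apply: eq_sqi (sqiD hf (sqiZ (-1) hg)) => x.
by rewrite mulN1r.
Qed.

Lemma sqiN f : sqi f -> sqi (fun x => - f x).
Proof. by move=> hf; apply: eq_sqi (sqiZ (-1) hf) => x; rewrite mulN1r. Qed.

Lemma sqi0 : sqi (fun=> 0).
Proof. by split => //; apply: eq_ig ig0 => x; rewrite expr0n. Qed.

Lemma sqi_le f g : measurable_fun setT f -> sqi g ->
  (forall x, `|f x| <= `|g x|) -> sqi f.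
Proof.
move=> mf [mg hg] fg; split=> //; apply: ig_le hg _.
  exact: measurable_funX.
move=> x; rewrite normrX -[leRHS]real_normK ?num_real//.
by rewrite lerXn2r// nnegrE.
Qed.

Lemma ig_bdd C f g : measurable_fun setT g -> (forall x, `|g x| <= C) ->
  ig f -> ig (fun x => g x * f x).
Proof.
move=> mg gC hf; apply: (ig_le _ (igZ C (ig_norm hf))).
  by apply: measurable_funM => //; exact: igM.
by move=> x; rewrite normrM ler_wpM2r.
Qed.

Lemma n2Z c f : sqi f -> n2 (fun x => c * f x) = c ^+ 2 * n2 f.
Proof.
move=> [mf hf]; rewrite /n2 -intZ//; apply: eq_int => x; by rewrite exprMn.
Qed.

Lemma n2D f g : sqi f -> sqi g ->
  n2 (fun x => f x + g x) = n2 f + 2 * \int[mu]_x (f x * g x) + n2 g.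
Proof.
move=> hf hg; rewrite /n2 -intZ; last exact: sqi_mul.
rewrite -intD ?hf.2//; last exact/igZ/sqi_mul.
rewrite -intD ?hg.2//; last by apply: igD; [exact: hf.2|exact/igZ/sqi_mul].
by apply: eq_int => x; ring.
Qed.

Lemma n2B f g : sqi f -> sqi g ->
  n2 (fun x => f x - g x) = n2 f - 2 * \int[mu]_x (f x * g x) + n2 g.
Proof.
move=> hf hg; rewrite /n2 -intZ; last exact: sqi_mul.
rewrite -intB ?hf.2//; last exact/igZ/sqi_mul.
rewrite -intD ?hg.2//; last by apply: igB; [exact: hf.2|exact/igZ/sqi_mul].
by apply: eq_int => x; ring.
Qed.

Lemma n2D_le f g : sqi f -> sqi g ->
  n2 (fun x => f x + g x) <= 2 * n2 f + 2 * n2 g.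
Proof.
move=> hf hg; have := n2_ge0 (fun x => f x - g x).
by rewrite n2B// n2D//; lra.
Qed.

Lemma quadratic_discr (a b c : R) : (forall t, 0 <= a + 2 * t * c + t ^+ 2 * b) ->
  0 <= a -> 0 <= b -> c ^+ 2 <= a * b.
Proof.
move=> H a0 b0.
have [b00|bn0] := eqVneq b 0.
  rewrite b00 in H *; rewrite mulr0.
  have [->|cn0] := eqVneq c 0; first by rewrite expr0n.
  (* With $b=0$ the form is affine in $t$, and this $t$ gives it the value $-1$. *)
  have := H (- (a + 1) / (2 * c)).
  rewrite mulr0 addr0 (_ : 2 * _ * c = - (a + 1)); last by field.
  lra.
have bp : 0 < b by rewrite lt_neqAle eq_sym bn0.
have := H (- c / b).
rewrite (_ : _ + _ + _ = (a * b - c ^+ 2) / b); last by field.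
by rewrite pmulr_lge0 ?invr_gt0// subr_ge0.
Qed.

Lemma cauchy_schwarz f g : sqi f -> sqi g ->
  (\int[mu]_x (f x * g x)) ^+ 2 <= n2 f * n2 g.
Proof.
move=> hf hg; apply: quadratic_discr; [|exact: n2_ge0..] => t.
have := n2_ge0 (fun x => f x + t * g x).
rewrite n2D//; last exact: sqiZ.
rewrite n2Z// (_ : \int[mu]_x (f x * (t * g x)) = t * \int[mu]_x (f x * g x)).
  by rewrite mulrA.
by rewrite -intZ; [apply: eq_int => x; ring|exact: sqi_mul].
Qed.

(** Cauchy-Schwarz for the measure $w\,d\mu$, read off the discriminant of $t\mapsto\int w(f+t)^2$.
    With $w=|k(x-\cdot)|$ it yields the $L^2$ bound of a convolution. *)
Lemma weighted_cs w f : (forall x, 0 <= w x) -> ig w ->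
  ig (fun x => w x * f x) -> ig (fun x => w x * f x ^+ 2) ->
  (\int[mu]_x (w x * f x)) ^+ 2 <=
  (\int[mu]_x w x) * \int[mu]_x (w x * f x ^+ 2).
Proof.
move=> w0 hw hwf hwf2; rewrite mulrC; apply: quadratic_discr.
- move=> t.
  have : 0 <= \int[mu]_x (w x * (f x + t) ^+ 2).
    by apply: int_ge0 => x; rewrite mulr_ge0// sqr_ge0.
  rewrite (_ : (fun x => _) = fun x => (w x * f x ^+ 2 + (2 * t) * (w x * f x)) +
      t ^+ 2 * w x); last by apply/funext => x; ring.
  rewrite intD ?intD ?intZ//; [exact: igZ|apply: igD => //; exact: igZ|exact: igZ].
- by apply: int_ge0 => x; rewrite mulr_ge0// sqr_ge0.
- exact: int_ge0.
Qed.

Lemma cs_sqrt f g : sqi f -> sqi g ->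
  `|\int[mu]_x (f x * g x)| <= Num.sqrt (n2 f) * Num.sqrt (n2 g).
Proof.
move=> hf hg; rewrite -sqrtrM ?n2_ge0// -sqrtr_sqr ler_sqrt ?mulr_ge0 ?n2_ge0//.
exact: cauchy_schwarz.
Qed.

Lemma cs_abs f g : sqi f -> sqi g ->
  \int[mu]_x (`|f x| * `|g x|) <= Num.sqrt (n2 f) * Num.sqrt (n2 g).
Proof.
move=> hf hg.
have H h : sqi h -> sqi (fun x => `|h x|).
  move=> hh; apply: (sqi_le _ hh); last by move=> x; rewrite normr_id.
  by apply: measurableT_comp => //; exact: hh.1.
have E h : n2 (fun x => `|h x|) = n2 h.
  by apply: eq_int => x; rewrite real_normK// num_real.
rewrite -[n2 f]E -[n2 g]E (le_trans (ler_norm _))//.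
by apply: cs_sqrt; exact: H.
Qed.

Lemma ig_indic (A : set X) : measurable A -> (mu A < +oo)%E -> ig \1_A.
Proof.
move=> mA Aoo; apply/integrableP; split.
  by apply/measurable_EFinP; exact: measurable_indic.
rewrite (eq_integral (fun x => (\1_A x)%:E)) ?integral_indic ?setIT//.
by move=> x _; rewrite gee0_abs// lee_fin.
Qed.

Lemma int_indic (A : set X) : measurable A -> \int[mu]_x \1_A x = fine (mu A).
Proof. by move=> mA; rewrite /Rintegral integral_indic// setIT. Qed.

Lemma dct (F : nat -> X -> R) f g : (forall n, measurable_fun setT (F n)) ->
  measurable_fun setT f -> ig g ->
  (forall x, F n x @[n --> \oo] --> f x) ->
  (forall n x, `|F n x| <= g x) ->
  \int[mu]_x F n x @[n --> \oo] --> \int[mu]_x f x.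
Proof.
move=> mF mf hg Ff Fg.
have hfg : ig f.
  apply: (ig_le mf hg) => x.
  by apply: (cvgr_to_le (cvg_norm (Ff x))); exact: nearW.
apply: fine_cvg; rewrite fineK; last exact: integrable_fin_num.
apply: (@dominated_cvg _ _ _ mu setT measurableT
  (fun n x => (F n x)%:E) (EFin \o f) (EFin \o g)) => //.
- by move=> n; apply/measurable_EFinP.
- by move=> x _; apply: cvg_EFin; [exact: nearW|exact: Ff].
- by move=> n x _; rewrite lee_fin.
Qed.

End square_integrable.

(** * Lebesgue measure on row vectors *)

Section rV_norm.
Context {R : realType} {n : nat}.
Implicit Types x y : 'rV[R]_n.

Lemma coord_le_norm x i : `|x 0 i| <= `|x|.
Proof.
rewrite [leRHS]/Num.norm/= mx_normrE.
by apply: (le_bigmax _ (fun ij => `|x ij.1 ij.2|) (0, i)).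
Qed.

Lemma rV_norm_le x c : 0 <= c -> (forall i, `|x 0 i| <= c) -> `|x| <= c.
Proof.
move=> c0 xc; rewrite [leLHS]/Num.norm/= mx_normrE.
by apply/bigmax_leP; split => // -[i j] _ /=; rewrite ord1.
Qed.

Lemma rV_norm_lt x c : 0 < c -> (forall i, `|x 0 i| < c) -> `|x| < c.
Proof.
move=> c0 xc; rewrite [ltLHS]/Num.norm/= mx_normrE.
by apply/bigmax_ltP; split => // -[i j] _ /=; rewrite ord1.
Qed.

Lemma continuous_coord (i : 'I_n) : continuous (fun x : 'rV[R]_n => x 0 i).
Proof. by move=> x; exact: coord_continuous. Qed.

End rV_norm.

Section rV_measurable.
Context {R : realType}.

Lemma measurable_rV_ball n (x : 'rV[R]_n) (e : R) :
  measurable [set y | `|x - y| < e].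
Proof.
have [e0|e0] := leP e 0.
  rewrite [X in measurable X](_ : _ = set0)//; apply/seteqP; split => y //=.
  by rewrite ltNge (le_trans e0).
rewrite [X in measurable X](_ : _ = \bigcap_(i in [set: 'I_n])
   ((fun y : 'rV[R]_n => y 0 i) @^-1` [set s | `|x 0 i - s| < e])).
  apply: fin_bigcap_measurable => // i _.
  rewrite -[X in measurable X]setTI; apply: (@measurable_coord R n i) => //.
  rewrite [X in measurable X](_ : _ = ball (x 0 i) e)//.
  exact: measurable_ball.
apply/seteqP; split => y /=.
  move=> H i _ /=; rewrite (le_lt_trans _ H)// (le_trans _ (coord_le_norm _ i))//.
  by rewrite !mxE.
by move=> H; apply: rV_norm_lt => // i; have := H i I; rewrite /= !mxE.
Qed.

(** The sigma-algebra is generated by coordinates, so openness must be converted into a countable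
    union: the balls of rational centre and radius $1/(m+1)$ contained in the set. A point with a
    ball of radius $e$ inside the set is covered as soon as $1/(m+1)<e/2$. *)
Lemma open_measurable_rV n (A : set 'rV[R]_n) : open A -> measurable A.
Proof.
move=> oA.
pose F (q : 'rV[rat]_n * nat) : set 'rV[R]_n :=
  let B := [set y | `|map_mx ratr q.1 - y| < q.2.+1%:R^-1] in
  if `[< B `<=` A >] then B else set0.
rewrite [X in measurable X](_ : _ = \bigcup_q F q).
  apply: countable_bigcupT_measurable => [|q]; first exact: countableP.
  rewrite /F; case: ifPn => // _.
  exact: measurable_rV_ball.
apply/seteqP; split => [x Ax|x [q _]]; last first.
  by rewrite /F; case: ifPn => // /asboolP; apply.
have /nbhs_ballP[e /= e0 xe] := open_nbhs_nbhs (conj oA Ax).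
have [m me] : exists m : nat, m.+1%:R^-1 < e / 2.
  have e20 : 0 < e / 2 by rewrite divr_gt0.
  exists (Num.truncn (e / 2)^-1).
  by rewrite invf_plt ?posrE//; apply: truncnS_gt.
have /choice[q xq] : forall i : 'I_n, exists q : rat, `|x 0 i - ratr q| < m.+1%:R^-1.
  move=> i; have : (0 : R) < m.+1%:R^-1 by rewrite invr_gt0.
  move: (m.+1%:R^-1) => r r0.
  have [q] : exists q : rat, ratr q \in `]x 0 i - r, x 0 i + r[.
    by apply: rat_in_itvoo; lra.
  rewrite in_itv/= => /andP[h1 h2]; exists q.
  by rewrite ltr_norml; apply/andP; split; lra.
exists ((\row_i q i), m) => //.
have sub : [set y | `|map_mx ratr (\row_i q i) - y| < m.+1%:R^-1] `<=` A.
  move=> y /= qy; apply: xe; rewrite -ball_normE /ball_/=.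
  rewrite (_ : x - y = (x - map_mx ratr (\row_i q i)) +
    (map_mx ratr (\row_i q i) - y)); last by rewrite addrA subrK.
  apply: le_lt_trans (ler_normD _ _) _.
  rewrite (_ : e = e / 2 + e / 2); last by field.
  apply: ltrD; apply: lt_trans me => //.
  by apply: rV_norm_lt => // i; rewrite !mxE.
rewrite /F/= asboolT//=.
apply: rV_norm_lt => // i; rewrite !mxE distrC.
exact: xq.
Qed.

Lemma continuous_measurable_rV n (f : 'rV[R]_n -> R) : continuous f ->
  measurable_fun setT f.
Proof.
move=> /continuousP cf; apply: (measurability _ (RGenOpens.measurableE R)).
move=> _ [_ [a [b ->] <-]]; rewrite setTI; apply: open_measurable_rV.
by apply: cf; exact: interval_open.
Qed.

Lemma measurable_rVP d (T : measurableType d) n (f : T -> 'rV[R]_n) :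
  measurable_fun setT f <-> forall i, measurable_fun setT (fun t => f t 0 i).
Proof.
split=> [mf i|]; last exact: measurable_fun_rVP.
exact: (measurableT_comp (@measurable_coord R n i) mf).
Qed.

Lemma measurable_rV_lincomb d (T : measurableType d) n (f g : T -> 'rV[R]_n)
    (a b : T -> R) :
  measurable_fun setT f -> measurable_fun setT g ->
  measurable_fun setT a -> measurable_fun setT b ->
  measurable_fun setT (fun t => a t *: f t + b t *: g t).
Proof.
move=> /measurable_rVP mf /measurable_rVP mg ma mb; apply/measurable_rVP => i.
under eq_fun do rewrite !mxE.
by apply: measurable_funD; apply: measurable_funM.
Qed.

Lemma measurable_rV_add d (T : measurableType d) n (f g : T -> 'rV[R]_n) :
  measurable_fun setT f -> measurable_fun setT g ->
  measurable_fun setT (fun t => f t + g t).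
Proof.
move=> mf mg; under eq_fun => t do rewrite -[f t]scale1r -[g t]scale1r.
exact: measurable_rV_lincomb.
Qed.

Lemma measurable_rV_sub d (T : measurableType d) n (f g : T -> 'rV[R]_n) :
  measurable_fun setT f -> measurable_fun setT g ->
  measurable_fun setT (fun t => f t - g t).
Proof.
move=> mf mg.
under eq_fun => t do rewrite -[f t]scale1r -[g t]scale1r -scaleNr.
exact: measurable_rV_lincomb.
Qed.

End rV_measurable.

(** * Translation invariance of Lebesgue measure, and the measure of boxes *)

Section translation.
Context {R : realType}.

Lemma lebesgue_measure_translation (a : R) (A : set R) :
  measurable A ->
  lebesgue_measure ((fun x => x + a) @^-1` A) = lebesgue_measure A.
Proof.
move=> mA.
suff : pushforward (@lebesgue_measure R)
  ((fun x => x + a) : _ -> measurableTypeR R) A = lebesgue_measure A by [].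
have mt : measurable_fun setT ((fun x : R => x + a) : _ -> measurableTypeR R).
  exact: measurable_funD.
apply/esym/lebesgue_measure_unique => //= _ [[u v]] _ <-; rewrite /pushforward.
rewrite (_ : _ @^-1` _ = `]u - a, v - a]%classic); last first.
  apply/seteqP; split => x /=; rewrite !in_itv/= => /andP[h1 h2];
  apply/andP; split; lra.
rewrite (_ : [set` _] = `]u, v]%classic); last first.
  by apply/seteqP; split => x /=; rewrite in_itv.
rewrite !lebesgue_measure_itv/= !lte_fin ltrD2r.
by case: ifP => // _; rewrite -!EFinB; congr EFin; ring.
Qed.

(** Induction on the dimension: [consrV] carries a translation to the product of a translation of
    the line and one in lower dimension, and a product measure is determined by its values on
    rectangles. *)
Lemma lebesgue_rV_translation n (y : 'rV[R]_n) (A : set 'rV[R]_n) :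
  measurable A ->
  lebesgue_rV R n ((fun x => x + y) @^-1` A) = lebesgue_rV R n A.
Proof.
elim: n y A => [|n IH] y A mA.
  rewrite (_ : (fun x => x + y) @^-1` A = A)//; apply/seteqP.
  by split=> x /=; rewrite (_ : x + y = x)//; apply/rowP; case.
rewrite /= /lebesgue_step /pushforward.
pose y1 := (unconsrV y).1; pose y2 := (unconsrV y).2.
pose tau (p : measurableTypeR R * 'rV[R]_n) : measurableTypeR R * 'rV[R]_n :=
  (p.1 + y1, p.2 + y2).
have mtau : measurable_fun setT tau.
  apply: measurable_fun_pair.
    apply: measurable_funD => //; exact: measurable_fst.
  by apply: measurable_rV_add => //; exact: measurable_snd.
have E p : consrV p + y = consrV (tau p).
  apply/rowP => i; rewrite /consrV !mxE; case: fintype.splitP => j ij.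
    rewrite !ord1 !mxE eqxx !mulr1n/=; congr (_ + y _ _).
    by apply/val_inj; rewrite /= ij ord1.
  by rewrite !mxE; congr (_ + y _ _); apply/val_inj.
have -> : @consrV R n @^-1` ((fun x => x + y) @^-1` A) =
          tau @^-1` (@consrV R n @^-1` A).
  by apply/seteqP; split => p /=; rewrite E.
have mA' : measurable (@consrV R n @^-1` A).
  by rewrite -[X in measurable X]setTI; exact: measurable_consrV.
apply/esym; suff H : forall B C, measurable B -> measurable C ->
    pushforward (@lebesgue_measure R \x lebesgue_rV R n)%E tau (B `*` C) =
    (lebesgue_measure B * lebesgue_rV R n C)%E.
  exact: (@product_measure_unique _ _ _ _ _ _ _ _ H).
move=> B C mB mC; rewrite /pushforward.
rewrite (_ : tau @^-1` _ = ((fun x => x + y1) @^-1` B) `*`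
   ((fun x => x + y2) @^-1` C))//.
rewrite product_measure1E//.
- congr (_ * _)%E; [exact: lebesgue_measure_translation|exact: IH].
- by rewrite -[X in measurable X]setTI; apply: measurable_funD.
- rewrite -[X in measurable X]setTI; apply: measurable_rV_add => //.
Qed.

Lemma lebesgue_rV_boxS n (c : R) : 0 <= c ->
  lebesgue_rV R n.+1 [set x | (`|x| <= c)%R] =
  (lebesgue_measure (`[(- c)%R, c]%classic : set R) * lebesgue_rV R n [set x | (`|x| <= c)%R])%E.
Proof.
move=> c0.
have boxE m : [set x : 'rV[R]_m | `|x| <= c] = [set x | forall i, `|x 0 i| <= c].
  apply/seteqP; split => x /= H; last exact: rV_norm_le.
  by move=> i; exact: le_trans (coord_le_norm _ _) H.
rewrite !boxE /= /lebesgue_step /pushforward.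
rewrite (_ : _ @^-1` _ = `[-c, c]%classic `*`
   [set x : 'rV[R]_n | forall i, `|x 0 i| <= c]).
  rewrite product_measure1E//.
  rewrite (_ : [set x | _] = \bigcap_(i in [set: 'I_n])
    ((fun y : 'rV[R]_n => y 0 i) @^-1` [set s | `|s| <= c])).
    apply: fin_bigcap_measurable => // i _.
    rewrite -[X in measurable X]setTI; apply: (@measurable_coord R n i) => //.
    rewrite (_ : [set s | _] = `[-c, c]%classic)//.
    by apply/seteqP; split => s /=; rewrite in_itv/= ler_norml.
  by apply/seteqP; split => x /= H i; [move=> _; exact: H|exact: (H i I)].
apply/seteqP; split => -[x1 x2] /=.
  move=> H; split.
    by have := H ord0; rewrite /consrV !mxE; case: fintype.splitP => // j _;
      rewrite !ord1 !mxE eqxx mulr1n in_itv/= ler_norml.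
  move=> i; have := H (lift ord0 i).
  rewrite /consrV mxE; case: fintype.splitP => j /= E; first by case: j E => -[].
  by rewrite (_ : j = i)//; apply/val_inj; case: E.
move=> [+ H] i; rewrite in_itv/= -ler_norml => H1.
rewrite /consrV mxE; case: fintype.splitP => j _; rewrite ?H//.
by rewrite !ord1 !mxE eqxx mulr1n.
Qed.

Lemma lebesgue_rV_box n (c : R) : 0 <= c ->
  (lebesgue_rV R n [set x | (`|x| <= c)%R] < +oo)%E.
Proof.
move=> c0; elim: n => [|n IH]; first by rewrite /= diracE; case: (_ \in _); rewrite ltry.
rewrite lebesgue_rV_boxS//; apply: lte_mul_pinfty => //.
by rewrite lebesgue_measure_itv/=; case: ifP.
Qed.

Lemma lebesgue_rV_box_gt0 n (c : R) : 0 < c ->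
  (0 < lebesgue_rV R n [set x | (`|x| <= c)%R])%E.
Proof.
move=> c0; elim: n => [|n IH].
  rewrite /= diracE mem_set ?lte01//= (_ : `|0| = 0) ?ltW//.
  exact: normr0.
rewrite lebesgue_rV_boxS ?ltW//; apply: mule_gt0 => //.
rewrite lebesgue_measure_itv/= lte_fin ifT; last by rewrite (@lt_trans _ _ 0)// oppr_lt0.
by rewrite -EFinB lte_fin; lra.
Qed.

Lemma lebesgue_rV_bounded n (A : set 'rV[R]_n) (c : R) : measurable A ->
  (forall x, A x -> `|x| <= c) -> (lebesgue_rV R n A < +oo)%E.
Proof.
move=> mA Ac; have [c0|c0] := leP 0 c; last first.
  rewrite (_ : A = set0) ?measure0//; apply/seteqP; split => x // /Ac xc.
  by have := le_lt_trans xc c0; rewrite ltNge normr_ge0.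
apply: le_lt_trans (lebesgue_rV_box n c0); apply: le_measure; rewrite ?inE//.
rewrite (_ : [set x | _] = ~` [set x | c < `|x|]); last first.
  by apply/seteqP; split => x /=; rewrite leNgt => /negP.
apply: measurableC; apply: open_measurable_rV.
rewrite (_ : [set x | _] = (fun x : 'rV[R]_n => `|x|) @^-1` [set s | c < s])//.
by apply: open_comp => [x _|]; [exact: norm_continuous|exact: open_gt].
Qed.

Lemma integral_translation n (y : 'rV[R]_n) (f : 'rV[R]_n -> \bar R) :
  measurable_fun setT f -> (forall x, 0 <= f x)%E ->
  (\int[lebesgue_rV R n]_x f (x + y)%R = \int[lebesgue_rV R n]_x f x)%E.
Proof.
move=> mf f0.
have mt : measurable_fun setT (fun x : 'rV[R]_n => x + y).
  exact: measurable_rV_add.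
transitivity (\int[pushforward (lebesgue_rV R n) (fun x => (x + y)%R)]_x f x)%E.
  by rewrite ge0_integral_pushforward.
apply: eq_measure_integral => A mA _.
exact: lebesgue_rV_translation.
Qed.

Lemma ig_translation n (y : 'rV[R]_n) (f : 'rV[R]_n -> R) :
  ig (lebesgue_rV R n) f -> ig (lebesgue_rV R n) (fun x => f (x + y)).
Proof.
move=> hf; have mf := igM hf; apply/integrableP; split.
  by apply/measurable_EFinP; apply: measurableT_comp => //; exact: measurable_rV_add.
have /integrableP[_] := hf; rewrite -(@integral_translation n y)//.
by apply/measurable_EFinP; exact: measurableT_comp.
Qed.

Lemma int_translation n (y : 'rV[R]_n) (f : 'rV[R]_n -> R) :
  measurable_fun setT f ->
  \int[lebesgue_rV R n]_x f (x + y) = \int[lebesgue_rV R n]_x f x.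
Proof.
move=> mf; rewrite /Rintegral; congr fine.
have mE : measurable_fun setT (EFin \o f) by exact/measurable_EFinP.
rewrite [LHS]integralE [RHS]integralE; congr (_ - _)%E.
- rewrite -[RHS](integral_translation y (measurable_funepos mE))//.
  by apply: eq_integral => x _; rewrite !funeposE.
- rewrite -[RHS](integral_translation y (measurable_funeneg mE))//.
  by apply: eq_integral => x _; rewrite !funenegE.
Qed.

End translation.

(** * Fubini's theorem and integration of derivatives *)

(** [fine] sends both infinities to 0, so they lie in the preimage of $Y$ exactly when $0\in Y$. *)
Lemma measurable_fine (R : realType) : measurable_fun setT (@fine R).
Proof.
move=> _ Y mY; rewrite setTI.
rewrite (_ : _ @^-1` _ = (EFin @` Y) `|`
  (if 0 \in Y then [set +oo; -oo]%E else set0)).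
  apply: measurableU; first exact: measurable_image_EFin.
  by case: ifP => // _; apply: measurableU; exact: emeasurable_set1.
apply/seteqP; split => [[x| |]|x] /=.
- by move=> Yx; left; exists x.
- by move=> Y0; right; rewrite mem_set//; left.
- by move=> Y0; right; rewrite mem_set//; right.
- move=> [[y Yy <-//]|]; case: ifPn => // /set_mem Y0 [] -> //.
Qed.

Section real_fubini.
Context {d1 d2 : measure_display} {X : measurableType d1} {Y : measurableType d2}
  {R : realType}.
Variables (m1 : {sigma_finite_measure set X -> \bar R})
  (m2 : {sigma_finite_measure set Y -> \bar R}).
Variable F : X * Y -> R.
Hypothesis mF : measurable_fun setT F.

(** Tonelli applied to the positive and negative parts gives measurability of the inner integral at
    every point, whether or not it is finite; [conv] can thus be treated as a total function. *)
Lemma measurable_int1 : measurable_fun setT (fun x => \int[m2]_y F (x, y)).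
Proof.
have mE : measurable_fun setT (EFin \o F) by exact/measurable_EFinP.
apply: measurableT_comp; first exact: measurable_fine.
rewrite [X in measurable_fun _ X](_ : _ = (fun x => \int[m2]_y (EFin \o F)^\+ (x, y))
   \- (fun x => \int[m2]_y (EFin \o F)^\- (x, y)))%E; last first.
  apply/funext => x; rewrite integralE.
  by congr (_ - _)%E; apply: eq_integral => y _; rewrite ?funeposE ?funenegE.
by apply: emeasurable_funB; apply: measurable_fun_fubini_tonelli_F => //;
  [exact: measurable_funepos|exact: measurable_funeneg].
Qed.

Lemma measurable_int2 : measurable_fun setT (fun y => \int[m1]_x F (x, y)).
Proof.
have mE : measurable_fun setT (EFin \o F) by exact/measurable_EFinP.
apply: measurableT_comp; first exact: measurable_fine.
rewrite [X in measurable_fun _ X](_ : _ = (fun y => \int[m1]_x (EFin \o F)^\+ (x, y))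
   \- (fun y => \int[m1]_x (EFin \o F)^\- (x, y)))%E; last first.
  apply/funext => x; rewrite integralE.
  by congr (_ - _)%E; apply: eq_integral => y _; rewrite ?funeposE ?funenegE.
by apply: emeasurable_funB; apply: measurable_fun_fubini_tonelli_G => //;
  [exact: measurable_funepos|exact: measurable_funeneg].
Qed.

End real_fubini.

Section real_fubini.
Context {d1 d2 : measure_display} {X : measurableType d1} {Y : measurableType d2}
  {R : realType}.
Variables (m1 : {sigma_finite_measure set X -> \bar R})
  (m2 : {sigma_finite_measure set Y -> \bar R}).
Variable F : X * Y -> R.
Hypothesis mF : measurable_fun setT F.
Hypothesis F1 : forall x, ig m2 (fun y => F (x, y)).
Hypothesis F2 : forall y, ig m1 (fun x => F (x, y)).

Lemma EFin_int d (Z : measurableType d) (m : {measure set Z -> \bar R})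
    (f : Z -> R) : ig m f -> (\int[m]_z f z)%:E = (\int[m]_z (f z)%:E)%E.
Proof. by move=> hf; rewrite fineK//; exact: integrable_fin_num. Qed.

Lemma ig_prod1 : ig m1 (fun x => \int[m2]_y `|F (x, y)|) ->
  (m1 \x m2)%E.-integrable setT (EFin \o F).
Proof.
move=> H; apply/integrable12ltyP; first exact/measurable_EFinP.
rewrite (eq_integral (fun x => (\int[m2]_y `|F (x, y)|)%:E)).
  exact: integrable_lty H.
by move=> x _; rewrite EFin_int//; exact: ig_norm.
Qed.

Lemma ig_prod2 : ig m2 (fun y => \int[m1]_x `|F (x, y)|) ->
  (m1 \x m2)%E.-integrable setT (EFin \o F).
Proof.
move=> H; apply/integrable21ltyP; first exact/measurable_EFinP.
rewrite (eq_integral (fun y => (\int[m1]_x `|F (x, y)|)%:E)).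
  exact: integrable_lty H.
by move=> x _; rewrite EFin_int//; exact: ig_norm.
Qed.

(** Every section is integrable, so the inner integrals are finite at all points and Fubini's
    theorem passes to real-valued integrals without exceptional null sets. *)
Lemma rfubini : (m1 \x m2)%E.-integrable setT (EFin \o F) ->
  [/\ ig m1 (fun x => \int[m2]_y F (x, y)),
     ig m2 (fun y => \int[m1]_x F (x, y)) &
     \int[m1]_x \int[m2]_y F (x, y) = \int[m2]_y \int[m1]_x F (x, y)].
Proof.
move=> iF; split.
- apply: eq_integrable (integrable_fubini_F iF) => // x _.
  by rewrite /= EFin_int.
- have nF : measurable_fun setT (fun p => `|F p|) by exact: measurableT_comp.
  have : ig m2 (fun y => \int[m1]_x `|F (x, y)|).
    apply/integrableP; split; first exact/measurable_EFinP/(measurable_int2 m1 nF).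
    have := (integrable21ltyP m1 m2 ((measurable_EFinP _ _).2 mF)).1 iF.
    apply: le_lt_trans; rewrite le_eqVlt; apply/orP; left; apply/eqP.
    apply: eq_integral => y _ /=; rewrite ger0_norm; last exact: int_ge0.
    by rewrite EFin_int//; exact: ig_norm.
  move=> h; apply: (ig_le _ h); first exact: (measurable_int2 m1 mF).
  by move=> y; exact: norm_int.
- rewrite {1 3}/Rintegral; congr fine.
  transitivity (\int[m1]_x \int[m2]_y (F (x, y))%:E)%E.
    by apply: eq_integral => x _; rewrite EFin_int.
  transitivity (\int[m2]_y \int[m1]_x (F (x, y))%:E)%E.
    exact: (Fubini iF).
  by apply: eq_integral => x _; rewrite EFin_int.
Qed.

End real_fubini.

Section directional_derivative.
Context {R : realType} {V : normedModType R}.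
Implicit Types (F : V -> R) (v x : V).

Lemma is_derive_line F v x s g : is_derive (x + s *: v) v F g ->
  is_derive s (1 : R) (fun s => F (x + s *: v)) g.
Proof.
move=> [dF <-].
have E : (fun h : R => h^-1 *: (((fun s => F (x + s *: v)) \o shift s) (h *: (1 : R)) -
    F (x + s *: v))) =
    (fun h => h^-1 *: ((F \o shift (x + s *: v)) (h *: v) - F (x + s *: v))).
  apply/funext => h /=; congr (_ *: (F _ - _)).
  by rewrite [h *: 1]mulr1 scalerDl addrCA.
split; first by rewrite /derivable E.
by rewrite /derive E.
Qed.

Lemma line_is_derive F v x g : is_derive (0 : R) (1 : R) (fun s => F (x + s *: v)) g ->
  is_derive x v F g.
Proof.
move=> [dF <-].
have E : (fun h : R => h^-1 *: (((fun s => F (x + s *: v)) \o shift 0) (h *: (1 : R)) -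
    F (x + 0 *: v))) =
    (fun h => h^-1 *: ((F \o shift x) (h *: v) - F x)).
  apply/funext => h /=; rewrite scale0r !addr0; congr (_ *: (F _ - _)).
  by rewrite [h *: 1]mulr1 addrC.
move: dF; rewrite /derivable E => dF; split; first exact: dF.
by rewrite /derive E.
Qed.

End directional_derivative.

Section integration_by_parts.
Context {R : realType} {n : nat}.
Local Notation E := 'rV[R]_n.
Local Notation mu := (lebesgue_rV R n).
Local Notation lam := (@lebesgue_measure R).

Lemma FTC_line (F G : E -> R) (e x : E) :
  (forall x, is_derive x e F (G x)) -> continuous G ->
  lam.-integrable `[0, 1] (fun s => (G (x + s *: e))%:E) /\
  \int[lam]_(s in `[0%R, 1%R]) G (x + s *: e) = F (x + e) - F x.
Proof.
move=> dF cG.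
have d1 s : is_derive s (1 : R) (fun s => F (x + s *: e)) (G (x + s *: e)).
  exact: is_derive_line.
have cl : continuous (fun s : R => x + s *: e).
  by move=> s; apply: cvgD; [exact: cvg_cst|apply: cvgZr_tmp; exact: cvg_id].
have cGl : continuous (fun s : R => G (x + s *: e)).
  by move=> s; apply: continuous_comp; [exact: cl|exact: cG].
have wc : {within `[0, 1], continuous (fun s : R => G (x + s *: e))}.
  exact: continuous_subspaceT.
split.
  by apply: continuous_compact_integrable => //; exact: segment_compact.
rewrite /Rintegral (@continuous_FTC2 _ _ (fun s => F (x + s *: e)))//.
- by rewrite scale1r scale0r addr0.
- have cFl s : {for s, continuous (fun s : R => F (x + s *: e))}.
    apply/differentiable_continuous/derivable1_diffP.
    by case: (d1 s).
  split.
  + by move=> s _; case: (d1 s).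
  + by apply: cvg_at_right_filter; exact: cFl.
  + by apply: cvg_at_left_filter; exact: cFl.
- by move=> s _; rewrite derive1E; case: (d1 s).
Qed.

(** Integrate $F(x+e)-F(x)=\int_0^1G(x+se)\,ds$ over $x$: the left side vanishes by translation
    invariance, the right side is $\int G$ by Fubini and translation invariance again. Integrability
    of $F$ and $G$ stands in for boundary conditions at infinity. *)
Lemma int_derive0 (F G : E -> R) (e : E) : ig mu F ->
  (forall x, is_derive x e F (G x)) -> continuous G -> ig mu G ->
  \int[mu]_x G x = 0.
Proof.
move=> iF dF cG iG.
have mG := igM iG.
pose H (p : E * measurableTypeR R) := \1_(`[0, 1]%classic : set R) p.2 * G (p.1 + p.2 *: e).
have mline : measurable_fun setT (fun p : E * measurableTypeR R => p.1 + p.2 *: e).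
  under eq_fun => p do rewrite -[p.1]scale1r.
  exact: measurable_rV_lincomb.
have mH : measurable_fun setT H.
  apply: measurable_funM; last exact: (measurableT_comp mG).
  by apply: measurableT_comp => //; exact: measurable_snd.
have H1 x : ig lam (fun s => H (x, s)).
  have [+ _] := FTC_line x dF cG.
  rewrite integrable_mkcond// => h.
  apply: eq_integrable h => // s _; rewrite /H /= patchE indicE.
  by case: ifP; rewrite ?mul1r ?mul0r.
have H2 s : ig mu (fun x => H (x, s)).
  exact: (igZ (\1_(`[0, 1]%classic : set R) s) (ig_translation (s *: e) iG)).
have H3 x : \int[lam]_s H (x, s) = F (x + e) - F x.
  have [_ <-] := FTC_line x dF cG.
  rewrite [RHS]Rintegral_mkcond; apply: eq_int => s.
  rewrite /H patchE indicE; by case: ifP; rewrite ?mul1r ?mul0r.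
have H4 s : \int[mu]_x H (x, s) = \1_(`[0, 1]%classic : set R) s * \int[mu]_x G x.
  rewrite [LHS](intZ (\1_(`[0, 1]%classic : set R) s) (ig_translation (s *: e) iG)).
  by rewrite int_translation.
have iH : (mu \x lam)%E.-integrable setT (EFin \o H).
  apply: ig_prod2 => //.
  have h := igZ (\int[mu]_x `|G x|) (@integrable_indic_itv R 0 1 true false).
  apply: eq_ig h => s /=.
  have -> : (fun x => `|H (x, s)|) = (fun x => `|\1_(`[0, 1]%classic : set R) s| * `|G (x + s *: e)|).
    by apply/funext => x; rewrite /H normrM.
  rewrite intZ; last exact: (ig_norm (ig_translation (s *: e) iG)).
  rewrite (int_translation (s *: e) (f := fun x => `|G x|)); last exact: measurableT_comp.
  by rewrite mulrC/= ger0_norm.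
have [_ _] := rfubini mH H1 H2 iH.
under eq_int do rewrite H3; under [in RHS]eq_int do rewrite H4.
rewrite intB//; last exact: ig_translation.
rewrite (int_translation e (igM iF)) subrr => /esym.
under eq_int do rewrite mulrC.
rewrite intZ; last exact: integrable_indic_itv.
rewrite /Rintegral integral_indic//= setIT lebesgue_measure_itv/= lte_fin ltr01.
by rewrite -EFinB subr0/= mulr1.
Qed.

End integration_by_parts.

(** * Convolution with Lipschitz kernels *)

(* Otherwise conversion may unfold the recursive construction of the measure. *)
Opaque lebesgue_rV.

(** Derivatives are often obtained from a quadratic remainder because such a bound, when uniform in
    the base point, survives convolution. *)
Lemma quadratic_is_derive {R : realType} {V : normedModType R} (F : V -> R)
    (x e : V) (g L : R) :
  (forall h : R, `|h| <= 1 -> `|F (x + h *: e) - F x - h * g| <= L * h ^+ 2) ->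
  is_derive x e F g.
Proof.
move=> H; have H' : (fun h : R => h^-1 *: ((F \o shift x) (h *: e) - F x)) @ 0^' --> g.
  apply/cvgrPdist_le => eps eps0.
  have L0 : 0 <= L by have := H 1; rewrite normr1 expr1n mulr1 => /(_ (lexx _)); exact: le_trans.
  near=> h.
  have hn0 : h != 0 by near: h; exact: nbhs_dnbhs_neq.
  have h1 : `|h| <= 1.
    near: h; apply: dnbhs0_le; exact: ltr01.
  have hL : `|h| <= eps / (L + 1).
    near: h; apply: dnbhs0_le; by rewrite divr_gt0// ltr_wpDl.
  rewrite -(ler_pM2l (_ : 0 < `|h|)) ?normr_gt0// -normrM mulrBr /=.
  rewrite -[_ *: _]/(h^-1 * _) mulrA divff// mul1r (addrC (h *: e)) distrC.
  rewrite (le_trans (H _ h1))// -[h ^+ 2]real_normK ?num_real// expr2 mulrCA.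
  apply: ler_wpM2l => //; rewrite (le_trans (ler_wpM2l L0 hL))//.
  rewrite mulrCA; apply: ler_piMr; first exact: ltW.
  by rewrite ler_pdivrMr ?ltr_wpDl// mul1r lerDl.
split; first by apply/cvg_ex; exists g.
exact: cvg_lim H'.
Unshelve. all: by end_near. Qed.

Section kernels.
Context {R : realType} {n : nat}.
Local Notation E := 'rV[R]_n.
Local Notation mu := (lebesgue_rV R n).
Implicit Types (k f g h : E -> R) (x y z : E).

Definition ball_ind (r : R) z : R := (`|z| <= r)%R%:R.

Lemma ball_ind_ge0 r z : 0 <= ball_ind r z.
Proof. by rewrite /ball_ind ler0n. Qed.

Lemma measurable_ball_set (r : R) : measurable [set z : E | `|z| <= r].
Proof.
rewrite (_ : [set x | _] = ~` [set x | r < `|x|]); last first.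
  by apply/seteqP; split => x /=; rewrite leNgt => /negP.
apply: measurableC; apply: open_measurable_rV.
rewrite (_ : [set x | _] = (fun x : 'rV[R]_n => `|x|) @^-1` [set s | r < s])//.
by apply: open_comp => [x _|]; [exact: norm_continuous|exact: open_gt].
Qed.

Lemma ball_indE r : ball_ind r = \1_[set z : E | `|z| <= r].
Proof.
by apply/funext => z; rewrite /ball_ind indicE; congr (nat_of_bool _)%:R;
  apply/idP/idP => [H|/set_mem//]; exact/mem_set.
Qed.

Lemma measurable_ball_ind r : measurable_fun setT (ball_ind r : E -> R).
Proof. by rewrite ball_indE; apply: measurable_indic; exact: measurable_ball_set. Qed.

Lemma ig_ball_ind r : ig mu (ball_ind r).
Proof.
rewrite ball_indE; apply: ig_indic; first exact: measurable_ball_set.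
by apply: (@lebesgue_rV_bounded _ _ _ r) => //; exact: measurable_ball_set.
Qed.

Lemma ig_bdd_supp C r f : measurable_fun setT f -> (forall x, `|f x| <= C) ->
  (forall x, f x != 0 -> `|x| <= r) -> ig mu f.
Proof.
move=> mf fC fr; apply: (ig_le mf (igZ C (ig_ball_ind r))) => x.
rewrite /ball_ind; have [->|/fr ->] := eqVneq (f x) 0; last by rewrite mulr1.
by rewrite normr0 mulr_ge0// (le_trans _ (fC x)).
Qed.

(** Evenness is asked of $|k|$ only, so that a mollifier, which is even, and its partial
    derivatives, which are odd, are both kernels. *)
Definition kern (c : R) k := [/\ exists2 L, 0 <= L & forall x y, `|k x - k y| <= L * `|x - y|,
  exists C, forall x, `|k x| <= C, forall x, k x != 0 -> `|x| <= c &
  forall x, `|k (- x)| = `|k x| ].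

Definition conv k f x := \int[mu]_y (k (x - y) * f y).

Lemma lipschitz_cont k L : (forall x y, `|k x - k y| <= L * `|x - y|) -> continuous k.
Proof.
move=> H x; apply/(@cvgrPdist_le _ _ _ (nbhs x) (nbhs_filter x)) => eps eps0.
apply/nbhs_ballP.
have L1 : 0 < `|L| + 1 by rewrite ltr_wpDl.
exists (eps / (`|L| + 1)) => [|y]; first by rewrite /= divr_gt0.
rewrite -ball_normE /= => xy.
rewrite (le_trans (H _ _))// (@le_trans _ _ ((`|L| + 1) * `|x - y|))//.
  by rewrite ler_wpM2r// (le_trans (ler_norm _))// lerDl.
by rewrite mulrC -ler_pdivlMr// ltW.
Qed.

Lemma kern_cont c k : kern c k -> continuous k.
Proof. by move=> [[L _ H] _ _ _]; exact: lipschitz_cont H. Qed.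

Lemma kern_meas c k : kern c k -> measurable_fun setT k.
Proof. by move=> /kern_cont; exact: continuous_measurable_rV. Qed.

Lemma measurable_shift_sub (x : E) k : measurable_fun setT k ->
  measurable_fun setT (fun y => k (x - y)).
Proof. by move=> mk; apply: measurableT_comp => //; exact: measurable_rV_sub. Qed.

(** Evenness takes the place of invariance of the measure under reflection: $k(x-y)=k(y-x)$ is a
    translate of $k$. *)
Lemma ig_reflect k x : measurable_fun setT k -> (forall z, k (- z) = k z) ->
  ig mu k -> ig mu (fun y => k (x - y)).
Proof.
move=> mk ek ik; apply: eq_ig (ig_translation (- x) ik) => y.
by rewrite -ek opprB.
Qed.

Lemma int_reflect k x : measurable_fun setT k -> (forall z, k (- z) = k z) ->
  \int[mu]_y k (x - y) = \int[mu]_y k y.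
Proof.
move=> mk ek; rewrite -(int_translation (- x) mk); apply: eq_int => y.
by rewrite -ek opprB.
Qed.

Section kernel.
Variables (c : R) (k : E -> R).
Hypothesis kk : kern c k.

Let mk : measurable_fun setT k. Proof. exact: kern_meas kk. Qed.

Lemma kern_ig : ig mu k.
Proof. by case: kk => _ [C kC] ks _; exact: (ig_bdd_supp mk kC ks). Qed.

Lemma kern_sqi : sqi mu k.
Proof.
case: kk => _ [C kC] ks _; split => //.
apply: (@ig_bdd_supp (C ^+ 2) c); first exact: measurable_funX.
  by move=> x; rewrite normrX lerXn2r// nnegrE// (le_trans _ (kC x)).
by move=> x; rewrite expf_eq0/=; exact: ks.
Qed.

Lemma kern_shift_ig x : ig mu (fun y => `|k (x - y)|).
Proof.
apply: (@ig_reflect (fun z => `|k z|)); first exact: measurableT_comp.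
  by case: kk.
exact: (ig_norm kern_ig).
Qed.

Lemma kern_shift_ig' x : ig mu (fun y => k (x - y)).
Proof.
apply: (ig_le _ (kern_shift_ig x)) => //; exact: measurable_shift_sub.
Qed.

Lemma kern_shift_igl y : ig mu (fun x => `|k (x - y)|).
Proof. exact: (ig_translation (- y) (ig_norm kern_ig)). Qed.

Lemma kern_shift_int x : \int[mu]_y `|k (x - y)| = \int[mu]_y `|k y|.
Proof.
apply: (@int_reflect (fun z => `|k z|)); first exact: measurableT_comp.
by case: kk.
Qed.

Lemma kern_shift_intl y : \int[mu]_x `|k (x - y)| = \int[mu]_y `|k y|.
Proof.
by apply: (int_translation (- y) (f := fun z => `|k z|)); exact: measurableT_comp.
Qed.

Lemma kern_shift_sqi x : sqi mu (fun y => k (x - y)).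
Proof.
split; first exact: measurable_shift_sub.
have ke z : k (- z) ^+ 2 = k z ^+ 2.
  rewrite -real_normK ?num_real//; case: kk => _ _ _ ->.
  by rewrite real_normK ?num_real.
apply: (@ig_reflect (fun z => k z ^+ 2)) => //; first exact: measurable_funX.
exact: kern_sqi.2.
Qed.

Lemma kern_shift_n2 x : n2 mu (fun y => k (x - y)) = n2 mu k.
Proof.
have ke z : k (- z) ^+ 2 = k z ^+ 2.
  rewrite -real_normK ?num_real//; case: kk => _ _ _ ->.
  by rewrite real_normK ?num_real.
by apply: (@int_reflect (fun z => k z ^+ 2)) => //; exact: measurable_funX.
Qed.

Lemma conv_bound f x : sqi mu f ->
  `|conv k f x| <= Num.sqrt (n2 mu k) * Num.sqrt (n2 mu f).
Proof.
by move=> hf; rewrite -(kern_shift_n2 x); apply: cs_sqrt => //; exact: kern_shift_sqi.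
Qed.

Let mk2 : measurable_fun setT (fun p : E * E => k (p.1 - p.2)).
Proof.
apply: (measurableT_comp mk).
by apply: measurable_rV_sub; [exact: measurable_fst|exact: measurable_snd].
Qed.

Lemma conv_meas f : measurable_fun setT f -> measurable_fun setT (conv k f).
Proof.
move=> mf; have mF : measurable_fun setT (fun p : E * E => k (p.1 - p.2) * f p.2).
  apply: measurable_funM => //.
  by apply: (measurableT_comp mf); exact: measurable_snd.
exact: (measurable_int1 mu mF).
Qed.

Let bdd_shift_ig x h : ig mu h -> ig mu (fun y => `|k (x - y)| * h y).
Proof.
move=> ih; case: kk => _ [C kC] _ _.
apply: (@ig_bdd _ _ _ _ C) => //; last by move=> y; rewrite normr_id.
by apply: measurableT_comp => //; exact: measurable_shift_sub.
Qed.

Lemma kern_prod_igr h : ig mu h -> (mu \x mu)%E.-integrable setT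
  (EFin \o (fun p : E * E => `|k (p.1 - p.2)| * h p.2)).
Proof.
move=> ih; have mh := igM ih; apply: ig_prod2.
- apply: measurable_funM; first exact: measurableT_comp.
  by apply: (measurableT_comp mh); exact: measurable_snd.
- by move=> y /=; apply: eq_ig (igZ (h y) (kern_shift_igl y)) => x; rewrite mulrC.
- apply: eq_ig (igZ (\int[mu]_z `|k z|) (ig_norm ih)) => y /=.
  rewrite -(kern_shift_intl y) mulrC -intZ; last exact: kern_shift_igl.
  by apply: eq_int => x; rewrite normrM normr_id mulrC.
Qed.

Lemma kern_prod_igl h : ig mu h -> (mu \x mu)%E.-integrable setT
  (EFin \o (fun p : E * E => `|k (p.1 - p.2)| * h p.1)).
Proof.
move=> ih; have mh := igM ih; apply: ig_prod1.
- apply: measurable_funM; first exact: measurableT_comp.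
  by apply: (measurableT_comp mh); exact: measurable_fst.
- by move=> x /=; apply: eq_ig (igZ (h x) (kern_shift_ig x)) => y; rewrite mulrC.
- apply: eq_ig (igZ (\int[mu]_z `|k z|) (ig_norm ih)) => x /=.
  rewrite -(kern_shift_int x) mulrC -intZ; last exact: kern_shift_ig.
  by apply: eq_int => y; rewrite normrM normr_id mulrC.
Qed.

(** Young's inequality. Weighted Cauchy-Schwarz in $y$ with weight $|k(x-y)|$ gives
    $(k*f)^2\le\|k\|_1\,(|k|*f^2)$ at every point, and Fubini gives the second factor $\|k\|_1$. *)
Lemma conv_sqi f : sqi mu f -> sqi mu (conv k f) /\
  n2 mu (conv k f) <= (\int[mu]_z `|k z|) ^+ 2 * n2 mu f.
Proof.
move=> hf; set A := \int[mu]_z `|k z|.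
pose G (p : E * E) := `|k (p.1 - p.2)| * f p.2 ^+ 2.
have mf2 : measurable_fun setT (fun x => f x ^+ 2) by exact: igM hf.2.
have mG : measurable_fun setT G.
  apply: measurable_funM; first exact: measurableT_comp.
  by apply: (measurableT_comp mf2); exact: measurable_snd.
have [iG1 _ eG] := rfubini mG (fun x => bdd_shift_ig x hf.2)
  (fun y => eq_ig (fun x => mulrC _ _) (igZ (f y ^+ 2) (kern_shift_igl y)))
  (kern_prod_igr hf.2).
have iG : ig mu (fun x => \int[mu]_y (`|k (x - y)| * f y ^+ 2)) by [].
have key x : conv k f x ^+ 2 <= A * \int[mu]_y (`|k (x - y)| * f y ^+ 2).
  have ikf : ig mu (fun y => `|k (x - y)| * `|f y|).
    apply: eq_ig (ig_norm (sqi_mul (kern_shift_sqi x) hf)) => y.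
    by rewrite normrM.
  rewrite -[A](kern_shift_int x).
  apply: (@le_trans _ _ ((\int[mu]_y (`|k (x - y)| * `|f y|)) ^+ 2)).
    have -> : (fun y => `|k (x - y)| * `|f y|) = (fun y => `|k (x - y) * f y|).
      by apply/funext => y; rewrite normrM.
    by apply: sqr_le_norm; exact: norm_int (sqi_mul (kern_shift_sqi x) hf).
  have e2 : (fun y => `|k (x - y)| * `|f y| ^+ 2) = (fun y => `|k (x - y)| * f y ^+ 2).
    by apply/funext => y; rewrite real_normK ?num_real.
  rewrite -e2; apply: weighted_cs.
  - by move=> y; exact: normr_ge0.
  - exact: kern_shift_ig.
  - exact: ikf.
  - by rewrite e2; exact: bdd_shift_ig hf.2.
have mc : measurable_fun setT (fun x => conv k f x ^+ 2).
  by apply: measurable_funX; apply: conv_meas; exact: hf.1.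
have ic : ig mu (fun x => conv k f x ^+ 2).
  by apply: (ig_le mc (igZ A iG)) => x; rewrite ger0_norm ?sqr_ge0.
split; first by split; [apply: conv_meas; exact: hf.1|exact: ic].
apply: (le_trans (le_int ic (igZ A iG) key)).
rewrite (intZ _ iG) [X in A * X]eG expr2 -mulrA.
apply: ler_wpM2l; first by apply: int_ge0 => y; exact: normr_ge0.
rewrite /n2 -intZ; last exact: hf.2.
rewrite le_eqVlt; apply/orP; left; apply/eqP; apply: eq_int => y.
rewrite /G/= /A -(kern_shift_intl y) mulrC -intZ; last exact: kern_shift_igl.
by apply: eq_int => x; rewrite mulrC.
Qed.

(** Fubini for the adjoint of a convolution, isolated because it serves two settings: $L^2$ against
    $L^2$, and bounded against integrable. *)
Lemma conv_adjoint_gen f g : measurable_fun setT f -> measurable_fun setT g ->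
  (forall x, ig mu (fun y => k (x - y) * f y)) ->
  (forall y, ig mu (fun x => k (x - y) * g x)) ->
  (mu \x mu)%E.-integrable setT
    (EFin \o (fun p : E * E => k (p.1 - p.2) * f p.2 * g p.1)) ->
  [/\ ig mu (fun x => conv k f x * g x),
      ig mu (fun y => f y * \int[mu]_x (k (x - y) * g x)) &
   \int[mu]_x (conv k f x * g x) = \int[mu]_y (f y * \int[mu]_x (k (x - y) * g x))].
Proof.
move=> mf mg kf kg iF.
have mF : measurable_fun setT (fun p : E * E => k (p.1 - p.2) * f p.2 * g p.1).
  by have /measurable_int/measurable_EFinP := iF.
have kf' x : ig mu (fun y => k (x - y) * f y * g x).
  by apply: eq_ig (igZ (g x) (kf x)) => y; rewrite mulrC.
have kg' y : ig mu (fun x => k (x - y) * f y * g x).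
  by apply: eq_ig (igZ (f y) (kg y)) => x; rewrite mulrA (mulrC (f y)).
have [h1 h2 h3] := rfubini mF kf' kg' iF.
have e1 x : \int[mu]_y (k (x - y) * f y * g x) = conv k f x * g x.
  by rewrite mulrC -intZ//; apply: eq_int => y; rewrite mulrC.
have e2 y : \int[mu]_x (k (x - y) * f y * g x) = f y * \int[mu]_x (k (x - y) * g x).
  by rewrite -intZ//; apply: eq_int => x; rewrite mulrA (mulrC (f y)).
split.
- exact: eq_ig h1.
- exact: eq_ig h2.
- by rewrite -(eq_int _ e1) -(eq_int _ e2).
Qed.

Lemma sqi_shift_ig f x : sqi mu f -> ig mu (fun y => k (x - y) * f y).
Proof. by move=> hf; apply: sqi_mul => //; exact: kern_shift_sqi. Qed.

Lemma sqi_shift_igl g y : sqi mu g -> ig mu (fun x => k (x - y) * g x).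
Proof.
move=> hg; apply: sqi_mul => //; split; last exact: (ig_translation (- y) kern_sqi.2).
by apply: (measurableT_comp mk); exact: measurable_rV_sub.
Qed.

Lemma kern_prod_sqi f g : sqi mu f -> sqi mu g ->
  (mu \x mu)%E.-integrable setT
    (EFin \o (fun p : E * E => k (p.1 - p.2) * f p.2 * g p.1)).
Proof.
move=> hf hg.
have h := igD (kern_prod_igr hf.2) (kern_prod_igl hg.2).
apply: (ig_le _ h) => [|p].
  apply: measurable_funM; first apply: measurable_funM => //.
    by apply: (measurableT_comp hf.1); exact: measurable_snd.
  by apply: (measurableT_comp hg.1); exact: measurable_fst.
rewrite -mulrDr !normrM -mulrA ler_wpM2l// -normrM ler_norml.
by apply/andP; split; nra.
Qed.

Lemma conv_adjoint f g : sqi mu f -> sqi mu g ->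
  \int[mu]_x (conv k f x * g x) = \int[mu]_y (f y * \int[mu]_x (k (x - y) * g x)).
Proof.
move=> hf hg.
have [_ _ //] := conv_adjoint_gen hf.1 hg.1 (fun x => sqi_shift_ig x hf)
  (fun y => sqi_shift_igl y hg) (kern_prod_sqi hf hg).
Qed.

Lemma bdd_shift_ig2 C f x : measurable_fun setT f -> (forall y, `|f y| <= C) ->
  ig mu (fun y => k (x - y) * f y).
Proof.
move=> mf fC; apply: eq_ig (ig_bdd mf fC (kern_shift_ig' x)) => y.
by rewrite mulrC.
Qed.

Lemma conv_bdd C f x : measurable_fun setT f -> (forall y, `|f y| <= C) ->
  `|conv k f x| <= C * \int[mu]_y `|k y|.
Proof.
move=> mf fC; apply: le_trans (norm_int (bdd_shift_ig2 x mf fC)) _.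
rewrite -(kern_shift_int x) -intZ; last exact: kern_shift_ig.
apply: le_int => [||y].
- exact: (ig_norm (bdd_shift_ig2 x mf fC)).
- by apply: igZ; exact: kern_shift_ig.
- by rewrite normrM mulrC ler_wpM2r.
Qed.

Lemma conv_adjoint_bdd C f g : measurable_fun setT f -> (forall y, `|f y| <= C) ->
  ig mu g ->
  [/\ ig mu (fun x => conv k f x * g x),
      ig mu (fun y => f y * \int[mu]_x (k (x - y) * g x)) &
  \int[mu]_x (conv k f x * g x) = \int[mu]_y (f y * \int[mu]_x (k (x - y) * g x))].
Proof.
move=> mf fC ig_g; have mg := igM ig_g.
have kg y : ig mu (fun x => k (x - y) * g x).
  case: kk => _ [K kK] _ _; apply: (ig_bdd _ (fun x => kK (x - y)) ig_g).
  by apply: (measurableT_comp mk); exact: measurable_rV_sub.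
have iF : (mu \x mu)%E.-integrable setT
    (EFin \o (fun p : E * E => k (p.1 - p.2) * f p.2 * g p.1)).
  apply: (ig_le _ (igZ C (kern_prod_igl (ig_norm ig_g)))) => [|p].
    apply: measurable_funM; first apply: measurable_funM => //.
      by apply: (measurableT_comp mf); exact: measurable_snd.
    by apply: (measurableT_comp mg); exact: measurable_fst.
  rewrite !normrM [leLHS]mulrAC mulrC.
  by apply: ler_wpM2r => //; rewrite mulr_ge0.
exact: conv_adjoint_gen mf mg (fun x => bdd_shift_ig2 x mf fC) kg iF.
Qed.

(** The sum of two ball indicators has $L^2$ norm at most twice the square root of the volume of the
    ball. It is applied with $M=L|x-x'|$ to get a Lipschitz bound, and with $M=Lh^2$ to integrate a
    Taylor remainder. *)
Lemma int_bump_bound f M r x x' (kap : E -> R) : sqi mu f -> 0 <= M ->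
  measurable_fun setT kap ->
  (forall y, `|kap y| <= M * (ball_ind r (x - y) + ball_ind r (x' - y))) ->
  `|\int[mu]_y (kap y * f y)| <=
    M * (2 * Num.sqrt (\int[mu]_z ball_ind r z) * Num.sqrt (n2 mu f)).
Proof.
move=> hf M0 mkap hk.
set V := \int[mu]_z ball_ind r z.
have bs z : sqi mu (fun y => ball_ind r (z - y)) /\
    n2 mu (fun y => ball_ind r (z - y)) = V.
  have e y : ball_ind r (z - y) ^+ 2 = ball_ind r (z - y).
    by rewrite /ball_ind; case: (_ <= _); rewrite ?expr1n ?expr0n.
  have eb (w : E) : ball_ind r (- w) = ball_ind r w by rewrite /ball_ind normrN.
  split; last first.
    rewrite /n2 (eq_int _ e); apply: int_reflect => //; exact: measurable_ball_ind.
  split; first by apply: measurable_shift_sub; exact: measurable_ball_ind.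
  apply: eq_ig (fun y => esym (e y)) _; apply: ig_reflect => //.
    exact: measurable_ball_ind.
  exact: ig_ball_ind.
have hb : sqi mu (fun y => M * (ball_ind r (x - y) + ball_ind r (x' - y))).
  by apply: sqiZ; apply: sqiD; exact: (bs _).1.
have hkap : sqi mu kap.
  by apply: (sqi_le mkap hb) => y; rewrite (le_trans (hk y))// ler_norm.
rewrite mulrA; apply: (le_trans (cs_sqrt hkap hf)); apply: ler_wpM2r => //.
have -> : M * (2 * Num.sqrt V) = Num.sqrt (M ^+ 2 * (4 * V)).
  rewrite sqrtrM ?sqr_ge0// sqrtr_sqr ger0_norm// sqrtrM//; congr (_ * (_ * _)).
  by rewrite (_ : 4 = 2 ^+ 2) ?sqrtr_sqr ?ger0_norm//; ring.
rewrite ler_sqrt; last first.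
  by rewrite mulr_ge0 ?sqr_ge0// mulr_ge0//; apply: int_ge0 => z; exact: ball_ind_ge0.
apply: (@le_trans _ _ (n2 mu (fun y => M * (ball_ind r (x - y) + ball_ind r (x' - y))))).
  apply: le_int; [exact: hkap.2|exact: hb.2|] => y.
  rewrite -real_normK ?num_real// lerXn2r ?nnegrE//.
  by rewrite mulr_ge0// addr_ge0// ball_ind_ge0.
rewrite n2Z; last by apply: sqiD; exact: (bs _).1.
apply: ler_wpM2l; first exact: sqr_ge0.
have := n2D_le (bs x).1 (bs x').1; rewrite (bs x).2 (bs x').2; lra.
Qed.

Lemma conv_lipschitz f : sqi mu f ->
  exists2 K, 0 <= K & forall x x', `|conv k f x - conv k f x'| <= K * `|x - x'|.
Proof.
move=> hf; have [[L L0 kL] _ ks _] := kk.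
exists (L * (2 * Num.sqrt (\int[mu]_z ball_ind c z) * Num.sqrt (n2 mu f))).
  by rewrite !mulr_ge0.
move=> x x'; rewrite mulrAC /conv -intB; [|exact: sqi_shift_ig..].
have -> : (fun y => k (x - y) * f y - k (x' - y) * f y) =
    (fun y => (k (x - y) - k (x' - y)) * f y).
  by apply/funext => y; rewrite mulrBl.
apply: (@int_bump_bound _ _ _ x x') => //; first by rewrite mulr_ge0.
  by apply: measurable_funB; exact: measurable_shift_sub.
move=> y; rewrite /ball_ind.
have [k1|/ks k1] := eqVneq (k (x - y)) 0; last first.
  rewrite k1; apply: (le_trans (kL _ _)).
  rewrite (_ : x - y - (x' - y) = x - x'); last by rewrite opprB addrA subrK.
  by rewrite -[leLHS]mulr1 ler_wpM2l ?mulr_ge0// lerDl.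
have [k2|/ks k2] := eqVneq (k (x' - y)) 0.
  by rewrite k1 k2 subrr normr0 !mulr_ge0// addr_ge0.
rewrite k2; apply: (le_trans (kL _ _)).
rewrite (_ : x - y - (x' - y) = x - x'); last by rewrite opprB addrA subrK.
by rewrite -[leLHS]mulr1 ler_wpM2l ?mulr_ge0// lerDr.
Qed.

Lemma conv_cont f : sqi mu f -> continuous (conv k f).
Proof. by move=> /conv_lipschitz[K _]; exact: lipschitz_cont. Qed.

Lemma conv_is_derive dk (e : E) L f : kern c dk ->
  (forall z (h : R), `|k (z + h *: e) - k z - h * dk z| <= L * h ^+ 2) ->
  sqi mu f -> forall x, is_derive x e (conv k f) (conv dk f x).
Proof.
move=> kdk H hf x; have [_ _ ks _] := kk; have [_ _ dks _] := kdk.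
have mdk := kern_meas kdk.
have L0 : 0 <= L by have := H 0 1; rewrite expr1n mulr1; exact: le_trans.
(* For $|h|\le1$ the point $x-y+he$ is within $|e|$ of $x-y$, so all three kernel values in the
   remainder vanish once $|x-y|>c+|e|$. *)
pose r := c + `|e|.
apply: (@quadratic_is_derive _ _ _ _ _ _
  (L * (2 * Num.sqrt (\int[mu]_z ball_ind r z) * Num.sqrt (n2 mu f)))) => h h1.
have i1 := sqi_shift_ig (x + h *: e) hf; have i0 := sqi_shift_ig x hf.
have i2 : ig mu (fun y => dk (x - y) * f y).
  apply: sqi_mul => //; split; first exact: measurable_shift_sub.
  have ke z : dk (- z) ^+ 2 = dk z ^+ 2.
    rewrite -real_normK ?num_real//; case: kdk => _ _ _ ->.
    by rewrite real_normK ?num_real.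
  apply: (@ig_reflect (fun z => dk z ^+ 2)) => //; first exact: measurable_funX.
  case: kdk => _ [C kC] _ _; apply: (@ig_bdd_supp (C ^+ 2) c); first exact: measurable_funX.
    by move=> z; rewrite normrX lerXn2r// nnegrE// (le_trans _ (kC z)).
  by move=> z; rewrite expf_eq0/=; exact: dks.
rewrite /conv -(intZ h i2) -intB// -intB//; last 2 first.
- exact: igB.
- exact: igZ.
have -> : (fun y => k (x + h *: e - y) * f y - k (x - y) * f y - h * (dk (x - y) * f y)) =
    (fun y => (k (x + h *: e - y) - k (x - y) - h * dk (x - y)) * f y).
  by apply/funext => y; ring.
rewrite mulrAC; apply: (@int_bump_bound _ _ _ x x) => //.
- by rewrite mulr_ge0// sqr_ge0.
- apply: measurable_funB; first by apply: measurable_funB; exact: measurable_shift_sub.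
  by apply: measurable_funM => //; exact: measurable_shift_sub.
move=> y; rewrite (addrAC x); have [xr|xr] := leP `|x - y| r.
  rewrite /ball_ind xr (le_trans (H _ _))//.
  by apply: ler_peMr; [rewrite mulr_ge0// sqr_ge0|rewrite /= lerDl].
rewrite /ball_ind (leNgt _ r) xr/= addr0 mulr0.
have e0 := normr_ge0 e.
have -> : k (x - y) = 0.
  apply/eqP; apply: contraTT xr => /ks; rewrite -leNgt /r => xc; lra.
have -> : dk (x - y) = 0.
  apply/eqP; apply: contraTT xr => /dks; rewrite -leNgt /r => xc; lra.
have -> : k (x - y + h *: e) = 0.
  apply/eqP; apply: contraTT xr => /ks; rewrite -leNgt /r => xc.
  have he : `|h *: e| <= `|e| by rewrite normrZ ler_piMl.
  have := ler_normB (x - y + h *: e) (h *: e); rewrite addrK; lra.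
by rewrite subrr mulr0 subrr normr0.
Qed.

End kernel.

End kernels.

(** * Mollifiers *)

Lemma cvg0_squeeze {R : realType} (u v : nat -> R) :
  (forall n, 0 <= u n <= v n) -> v @ \oo --> 0 -> u @ \oo --> 0.
Proof.
move=> uv v0; apply: (@squeeze_cvgr _ _ _ _ (fun=> 0) v) => //.
- by near=> n; exact: uv.
- exact: cvg_cst.
Unshelve. all: by end_near. Qed.

(** The Dynkin argument below starts from open sets, hence this second generating family. *)
Lemma rV_measurable_open {R : realType} n :
  @measurable _ 'rV[R]_n = <<s [set A : set 'rV[R]_n | open A] >>.
Proof.
apply/seteqP; split => A; last first.
  apply: smallest_sub; first exact: sigma_algebra_measurable.
  by move=> B; exact: open_measurable_rV.
pose T := g_sigma_algebraType [set A : set 'rV[R]_n | open A].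
move: A; apply: smallest_sub; first exact: (@sigma_algebra_measurable _ T).
rewrite -bigcup_seq; apply: bigcup_sub => i _ A [B mB <-].
have mi : measurable_fun (setT : set T) (fun x : T => (x : 'rV[R]_n) 0 i).
  apply: (measurability _ (RGenOpens.measurableE R)).
  move=> _ [_ [a [b ->] <-]]; rewrite setTI; apply: sub_sigma_algebra => /=.
  apply: open_comp; last exact: interval_open.
  by move=> x _; exact: continuous_coord.
exact: mi.
Qed.

Record mollifier {R : realType} {n : nat} (c : R) (rho : 'rV[R]_n -> R)
    (drho : 'I_n -> 'rV[R]_n -> R) : Prop := Mollifier {
  moll_kern : kern c rho;
  moll_dkern : forall j, kern c (drho j);
  moll_ge0 : forall x, 0 <= rho x;
  moll_int : \int[lebesgue_rV R n]_x rho x = 1;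
  moll_even : forall x, rho (- x) = rho x;
  moll_odd : forall j x, drho j (- x) = - drho j x;
  (* [drho j] is the partial derivative, with a remainder uniform in [z] *)
  moll_diff : forall j, exists L, forall z (h : R),
    `|rho (z + h *: delta_mx 0 j) - rho z - h * drho j z| <= L * h ^+ 2;
  moll_test : forall x, test_function (fun y => rho (x - y))
}.

Section mollifier_theory.
Context {R : realType} {n : nat}.
Local Notation E := 'rV[R]_n.
Local Notation mu := (lebesgue_rV R n).
Implicit Types (f g h S : E -> R).

Lemma convD c k f g x : kern c k -> sqi mu f -> sqi mu g ->
  conv k (fun y => f y + g y) x = conv k f x + conv k g x.
Proof.
move=> kk hf hg; rewrite /conv -intD; [|exact: (sqi_shift_ig kk)..].
by apply: eq_int => y; rewrite mulrDr.
Qed.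

Lemma convZ c k a f x : kern c k -> sqi mu f ->
  conv k (fun y => a * f y) x = a * conv k f x.
Proof.
move=> kk hf; rewrite /conv -intZ; last exact: (sqi_shift_ig kk).
by apply: eq_int => y; rewrite mulrCA.
Qed.

Lemma convB c k f g x : kern c k -> sqi mu f -> sqi mu g ->
  conv k (fun y => f y - g y) x = conv k f x - conv k g x.
Proof.
move=> kk hf hg; rewrite /conv -intB; [|exact: (sqi_shift_ig kk)..].
by apply: eq_int => y; rewrite mulrBr.
Qed.

Section one.
Context (c : R) (rho : E -> R) (drho : 'I_n -> E -> R).
Hypothesis hm : mollifier c rho drho.
Let kk := moll_kern hm.

Lemma moll_norm_int : \int[mu]_x `|rho x| = 1.
Proof.
by rewrite -(moll_int hm); apply: eq_int => x; rewrite ger0_norm// (moll_ge0 hm).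
Qed.

Lemma moll_shift_int x : \int[mu]_y rho (x - y) = 1.
Proof.
rewrite -moll_norm_int -(kern_shift_int kk x); apply: eq_int => y.
by rewrite ger0_norm// (moll_ge0 hm).
Qed.

Lemma moll_evenB x y : rho (x - y) = rho (y - x).
Proof. by rewrite -(moll_even hm) opprB. Qed.

Lemma moll_sqi f : sqi mu f -> sqi mu (conv rho f).
Proof. by move=> hf; exact: (conv_sqi kk hf).1. Qed.

Lemma dmoll_sqi j f : sqi mu f -> sqi mu (conv (drho j) f).
Proof. by move=> hf; exact: (conv_sqi (moll_dkern hm j) hf).1. Qed.

Lemma moll_n2 f : sqi mu f -> n2 mu (conv rho f) <= n2 mu f.
Proof.
by move=> hf; have := (conv_sqi kk hf).2; rewrite moll_norm_int expr1n mul1r.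
Qed.

Lemma moll_adjoint f g : sqi mu f -> sqi mu g ->
  \int[mu]_x (conv rho f x * g x) = \int[mu]_x (f x * conv rho g x).
Proof.
move=> hf hg; rewrite (conv_adjoint kk hf hg); apply: eq_int => y.
by congr (_ * _); apply: eq_int => x; rewrite moll_evenB.
Qed.

Lemma moll_is_derive j f x : sqi mu f ->
  is_derive x (delta_mx 0 j) (conv rho f) (conv (drho j) f x).
Proof.
move=> hf; have [L HL] := moll_diff hm j.
exact: (conv_is_derive kk (moll_dkern hm j) HL hf).
Qed.

Lemma rho_shift_is_derive j x y :
  is_derive y (delta_mx 0 j) (fun y => rho (x - y)) (- drho j (x - y)).
Proof.
have [L HL] := moll_diff hm j; apply: (@quadratic_is_derive _ _ _ _ _ _ L) => h _.
have := HL (x - y) (- h); rewrite sqrrN mulrN mulNr.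
by rewrite opprD addrA scaleNr.
Qed.

(** Expand the square and use $\|\rho*f\|\le\|f\|$: convergence in $L^2$ is reduced to that of the
    single number $\langle f,\rho*f\rangle$. *)
Lemma moll_err f : sqi mu f ->
  n2 mu (fun x => conv rho f x - f x) <=
  2 * (n2 mu f - \int[mu]_x (f x * conv rho f x)).
Proof.
move=> hf; have hm' := moll_sqi hf; rewrite n2B//.
rewrite (_ : \int[mu]_x (conv rho f x * f x) = \int[mu]_x (f x * conv rho f x)); last first.
  by apply: eq_int => x; rewrite mulrC.
have := moll_n2 hf; lra.
Qed.

Lemma moll_bdd C f x : measurable_fun setT f -> (forall y, `|f y| <= C) ->
  `|conv rho f x| <= C.
Proof.
by move=> mf fC; have := conv_bdd kk x mf fC; rewrite moll_norm_int mulr1.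
Qed.

Lemma moll_adjoint_bdd C S g : measurable_fun setT S -> (forall y, `|S y| <= C) ->
  ig mu g -> [/\ ig mu (fun x => conv rho S x * g x),
    ig mu (fun x => S x * conv rho g x) &
  \int[mu]_x (conv rho S x * g x) = \int[mu]_x (S x * conv rho g x)].
Proof.
move=> mS SC ig_g; have [h1 h2 h3] := conv_adjoint_bdd kk mS SC ig_g.
have e y : \int[mu]_x (rho (x - y) * g x) = conv rho g y.
  by apply: eq_int => x; rewrite moll_evenB.
split; first exact: h1.
- by apply: eq_ig h2 => y; rewrite e.
- by rewrite h3; apply: eq_int => y; rewrite e.
Qed.

(* [conv rho (h ^+ 2) - 2 h conv rho h + h ^+ 2] is the average of
   [(h y - h x) ^+ 2], hence nonnegative. *)
Lemma moll_sq_err C S h : measurable_fun setT S -> (forall y, `|S y| <= C) ->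
  sqi mu h ->
  `|\int[mu]_x ((conv rho S x - S x) * h x ^+ 2)| <=
  C * (4 * (Num.sqrt (n2 mu h) * Num.sqrt (n2 mu (fun x => conv rho h x - h x)))).
Proof.
move=> mS SC hh; have C0 : 0 <= C by apply: le_trans (SC 0).
set P := Num.sqrt (n2 mu h) * _.
have hMh := moll_sqi hh; have hd := sqiB hMh hh.
have [i1 i2 e1] := moll_adjoint_bdd mS SC hh.2.
(* The adjoint identity with weight 1 shows that $\rho*h^2$ is integrable and has the same integral
   as $h^2$. *)
have m1 : measurable_fun setT (fun _ : E => 1 : R) by exact: measurable_cst.
have [_ j2 e2] := moll_adjoint_bdd m1 (fun=> (lexx `|1 : R|)) hh.2.
have iMh2 : ig mu (conv rho (fun x => h x ^+ 2)).
  by apply: eq_ig j2 => x; rewrite mul1r.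
have eMh2 : \int[mu]_x conv rho (fun x => h x ^+ 2) x = n2 mu h.
  transitivity (\int[mu]_x (1 * conv rho (fun x => h x ^+ 2) x)).
    by apply: eq_int => x; rewrite mul1r.
  rewrite -e2; apply: eq_int => x.
  rewrite /conv (_ : \int[mu]_y _ = 1) ?mul1r// -[RHS](moll_shift_int x).
  by apply: eq_int => y; rewrite mulr1.
have iS : ig mu (fun x => S x * h x ^+ 2) by apply: ig_bdd hh.2 => //; exact: SC.
pose D x := conv rho (fun x => h x ^+ 2) x - 2 * (h x * conv rho h x) + h x ^+ 2.
pose F x := h x * (conv rho h x - h x).
have iF : ig mu F by exact: sqi_mul.
have iD : ig mu D.
  apply: igD; last exact: hh.2.
  by apply: igB => //; apply: igZ; exact: sqi_mul.
have D0 x : 0 <= D x.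
  rewrite /D /conv.
  have r0 := kern_shift_ig' kk x; have r1 := sqi_shift_ig kk x hh.
  have r2 : ig mu (fun y => rho (x - y) * h y ^+ 2).
    have [_ [K HK] _ _] := kk.
    apply: ig_bdd hh.2 => [|y]; last exact: HK.
    by apply: measurable_shift_sub; exact: kern_meas kk.
  rewrite mulrA -intZ// -[h x ^+ 2]mulr1 -[X in _ + _ * X](moll_shift_int x) -intZ//.
  rewrite -intB//; last exact: igZ.
  rewrite -intD//; [|by apply: igB => //; exact: igZ|exact: igZ].
  apply: int_ge0 => y.
  rewrite (_ : _ + _ = rho (x - y) * (h y - h x) ^+ 2); last by ring.
  by rewrite mulr_ge0 ?sqr_ge0// (moll_ge0 hm).
have intF : `|\int[mu]_x F x| <= P by exact: cs_sqrt.
have intD' : \int[mu]_x D x <= 2 * P.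
  have -> : \int[mu]_x D x = - 2 * \int[mu]_x F x.
    rewrite /D intD//; [|by apply: igB => //; apply: igZ; exact: sqi_mul|exact: hh.2].
    rewrite intB//; last by apply: igZ; exact: sqi_mul.
    rewrite intZ; last exact: sqi_mul.
    rewrite eMh2 /F (_ : (fun x => h x * (conv rho h x - h x)) =
      (fun x => h x * conv rho h x - h x ^+ 2)); last by apply/funext => x; ring.
    rewrite intB; [|exact: sqi_mul|exact: hh.2].
    by rewrite /n2; ring.
  by move: intF; rewrite ler_norml => /andP[]; lra.
have nF : \int[mu]_x `|F x| <= P.
  rewrite (_ : (fun x => `|F x|) = fun x => `|h x| * `|conv rho h x - h x|).
    exact: cs_abs.
  by apply/funext => x; rewrite normrM.
(* After moving the kernel onto $h^2$, the identity $\rho*h^2-h^2=D+2F$ is used. Since $D\ge0$ and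
   $\int D=-2\int F$, each of the two parts costs at most $2CP$, whence the constant 4. *)
have -> : \int[mu]_x ((conv rho S x - S x) * h x ^+ 2) =
    \int[mu]_x (S x * D x) + 2 * \int[mu]_x (S x * F x).
  transitivity (\int[mu]_x (conv rho S x * h x ^+ 2 - S x * h x ^+ 2)).
    by apply: eq_int => x; rewrite mulrBl.
  rewrite intB// e1 -intB// -intZ; last by apply: ig_bdd iF.
  rewrite -intD; [|by apply: ig_bdd iD|by apply: igZ; apply: ig_bdd iF].
  by apply: eq_int => x; rewrite /D /F; ring.
have b1 : `|\int[mu]_x (S x * D x)| <= C * (2 * P).
  apply: le_trans (norm_int (ig_bdd mS SC iD)) _.
  apply: (@le_trans _ _ (C * \int[mu]_x D x)); last exact: ler_wpM2l.
  rewrite -intZ//; apply: le_int => [||x].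
  - by apply: ig_norm; exact: (ig_bdd mS SC iD).
  - exact: igZ.
  - by rewrite normrM [`|D x|]ger0_norm// ler_wpM2r.
have b2 : `|\int[mu]_x (S x * F x)| <= C * P.
  apply: le_trans (norm_int (ig_bdd mS SC iF)) _.
  apply: (@le_trans _ _ (C * \int[mu]_x `|F x|)); last exact: ler_wpM2l.
  rewrite -intZ; last exact: ig_norm.
  apply: le_int => [||x].
  - by apply: ig_norm; exact: (ig_bdd mS SC iF).
  - by apply: igZ; exact: ig_norm.
  - by rewrite normrM ler_wpM2r.
apply: le_trans (ler_normD _ _) _; rewrite normrM ger0_norm//; lra.
Qed.

End one.
End mollifier_theory.

(** * Convergence of mollifications *)

Lemma cvg_affine0 {R : realType} (u v w : nat -> R) a b :
  (forall m, w m = a * (u m - v m) + b) -> u @ \oo --> 0 -> v @ \oo --> 0 ->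
  w @ \oo --> b.
Proof.
move=> /funext -> u0 v0; rewrite -[b in X in _ --> X]add0r -(mulr0 a) -(subrr 0).
by apply: cvgD (cvg_cst b); apply: cvgMl_tmp; exact: cvgB.
Qed.

Section mollifier_convergence.
Import HBNNSimple.
Context {R : realType} {n : nat}.
Local Notation E := 'rV[R]_n.
Local Notation mu := (lebesgue_rV R n).
Implicit Types (f g h S : E -> R).

Variables (c : nat -> R) (rho : nat -> E -> R) (drho : nat -> 'I_n -> E -> R).
Hypothesis hm : forall m, mollifier (c m) (rho m) (drho m).
Hypothesis c0 : c @ \oo --> 0.

Let err f m := n2 mu (fun x => conv (rho m) f x - f x).
(** The convergence is proved for a growing class: a linear space closed under $L^2$ limits,
    containing the indicators of bounded open sets, hence of bounded measurable sets, hence all of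
    $L^2$. *)
Let good f := sqi mu f /\ err f @ \oo --> 0.

Let err_ge0 f m : 0 <= err f m. Proof. exact: n2_ge0. Qed.

Let goodD f g : good f -> good g -> good (fun x => f x + g x).
Proof.
move=> [hf f0] [hg g0]; split; first exact: sqiD.
apply: (@cvg0_squeeze _ _ (fun m => 2 * err f m + 2 * err g m)) => [m|]; last first.
  rewrite -[0]addr0 -{1 2}[0](mulr0 (2 : R)).
  by apply: cvgD; apply: cvgMl_tmp.
rewrite err_ge0 /err; have kk := moll_kern (hm m).
rewrite (_ : (fun x => _ - (f x + g x)) =
  fun x => (conv (rho m) f x - f x) + (conv (rho m) g x - g x)); last first.
  by apply/funext => x; rewrite (convD _ kk)//; ring.
by apply: n2D_le; apply: sqiB => //; exact: (moll_sqi (hm m)).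
Qed.

Let goodZ a f : good f -> good (fun x => a * f x).
Proof.
move=> [hf f0]; split; first exact: sqiZ.
rewrite (_ : err _ = fun m => a ^+ 2 * err f m).
  by rewrite -(mulr0 (a ^+ 2)); apply: cvgMl_tmp.
apply/funext => m; rewrite /err -n2Z; last first.
  by apply: sqiB => //; exact: (moll_sqi (hm m)).
congr n2; apply/funext => x.
by rewrite (convZ _ _ (moll_kern (hm m)))//; ring.
Qed.

Let good0 : good (fun=> 0).
Proof.
split; first exact: sqi0.
rewrite (_ : err _ = fun=> 0); first exact: cvg_cst.
apply/funext => m; rewrite /err /n2 -[RHS](int0 mu); apply: eq_int => x.
have -> : conv (rho m) (fun=> 0) x = 0.
  by rewrite /conv -[RHS](int0 mu); apply: eq_int => y; rewrite mulr0.
by rewrite subrr expr0n.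
Qed.

Let good_sum (I : Type) (s : seq I) (F : I -> E -> R) :
  (forall i, good (F i)) -> good (fun x => \sum_(i <- s) F i x).
Proof.
move=> hF; elim: s => [|i s IH].
  rewrite (_ : (fun x => _) = fun=> 0); first exact: good0.
  by apply/funext => x; rewrite big_nil.
rewrite (_ : (fun x => _) = fun x => F i x + \sum_(i <- s) F i x); first exact: goodD.
by apply/funext => x; rewrite big_cons.
Qed.

Let good_closed f (F : nat -> E -> R) : sqi mu f -> (forall m, good (F m)) ->
  (fun m => n2 mu (fun x => f x - F m x)) @ \oo --> 0 -> good f.
Proof.
move=> hf hF Ff; split => //; apply/cvgrPdist_le => eps eps0.
have /cvgrPdist_le/(_ (eps / 16)) := Ff.
(* Splitting $f$ as $(f-F_k)+F_k$, the first part has error at most $4\cdot\varepsilon/16$ by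
   contractivity and the second $\varepsilon/16$; [n2D_le] doubles both, for a total of
   $10\varepsilon/16$. *)
have e16 : 0 < eps / 16 by rewrite divr_gt0.
move=> /(_ e16)[k _ /(_ k (leqnn k))]; rewrite sub0r normrN ger0_norm ?n2_ge0// => fk.
have [hk /cvgrPdist_le/(_ (eps / 16) e16)] := hF k.
apply: filterS => m; rewrite !sub0r !normrN !ger0_norm ?err_ge0// => ek.
have kk := moll_kern (hm m).
have hd := sqiB hf hk.
have h1 : err (fun x => f x - F k x) m <= 4 * (eps / 16).
  rewrite /err; apply: le_trans (_ : _ <= 2 * n2 mu (conv (rho m) (fun x => f x - F k x)) +
     2 * n2 mu (fun x => - (f x - F k x))) _.
    by apply: n2D_le; [exact: (moll_sqi (hm m))|exact: sqiN].
  have -> : n2 mu (fun x => - (f x - F k x)) = n2 mu (fun x => f x - F k x).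
    by apply: eq_int => x; rewrite sqrrN.
  have := moll_n2 (hm m) hd; lra.
have -> : err f m = n2 mu (fun x => (conv (rho m) (fun x => f x - F k x) x - (f x - F k x)) +
   (conv (rho m) (F k) x - F k x)).
  congr n2; apply/funext => x; rewrite (convB _ kk hf hk); ring.
apply: le_trans (n2D_le _ _) _.
- by apply: sqiB => //; exact: (moll_sqi (hm m)).
- by apply: sqiB => //; exact: (moll_sqi (hm m)).
move: h1 ek; rewrite /err; lra.
Qed.

Let indic_sqi (A : set E) (r : R) : measurable A -> (forall x, A x -> `|x| <= r) ->
  sqi mu \1_A.
Proof.
move=> mA Ar; split; first exact: measurable_indic.
apply: eq_ig (ig_indic mA (lebesgue_rV_bounded mA Ar)) => x.
by rewrite indicE; case: (_ \in _); rewrite ?expr1n ?expr0n.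
Qed.

(* Only [int_A conv (rho m) 1_A --> mu A] is needed (lemma [moll_err]), and on an open set
   the integrand converges pointwise. *)
Let good_open (A : set E) (r : R) : open A -> (forall x, A x -> `|x| <= r) ->
  good \1_A.
Proof.
move=> oA Ar; have mA := open_measurable_rV oA; have hA := indic_sqi mA Ar.
have A1 x : `|\1_A x| <= 1 :> R.
  by rewrite indicE; case: (_ \in _); rewrite ?normr1 ?normr0.
split => //.
have key : \int[mu]_x (\1_A x * conv (rho m) \1_A x) @[m --> \oo] --> \int[mu]_x \1_A x.
  apply: (@dct _ _ _ mu _ _ \1_A).
  - move=> m; apply: measurable_funM; first exact: hA.1.
    by apply: (conv_meas (moll_kern (hm m))); exact: hA.1.
  - exact: hA.1.
  - exact: ig_indic mA (lebesgue_rV_bounded mA Ar).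
  - move=> x; have [Ax|nAx] := boolP (x \in A); last first.
      rewrite indicE (negPf nAx)/=.
      by under eq_fun do rewrite mul0r; exact: cvg_cst.
    rewrite indicE Ax; under eq_fun do rewrite mul1r.
    have /nbhs_ballP[e /= e0 xe] := open_nbhs_nbhs (conj oA (set_mem Ax)).
    apply: (@cvg_near_cst).
    have /cvgrPdist_lt/(_ e e0) := c0; apply: filterS => m cm.
    rewrite /conv -[RHS](moll_shift_int (hm m) x); apply: eq_int => y.
    have [->|ry] := eqVneq (rho m (x - y)) 0; first by rewrite mul0r.
    rewrite indicE mem_set ?mulr1//; apply: xe.
    have [_ _ ks _] := moll_kern (hm m).
    rewrite -ball_normE/= (le_lt_trans (ks _ ry))// (le_lt_trans (ler_norm _))//.
    by move: cm; rewrite sub0r normrN.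
  - move=> m x; have i0 : 0 <= \1_A x :> R by rewrite indicE ler0n.
    rewrite normrM (ger0_norm i0); apply: ler_piMr => //.
    by apply: (moll_bdd (hm m)) => //; exact: hA.1.
have e2 : n2 mu \1_A = \int[mu]_x \1_A x.
  apply: eq_int => x; rewrite indicE.
  by case: (_ \in _); rewrite ?expr1n ?expr0n.
apply: (@cvg0_squeeze _ _ (fun m => 2 * (n2 mu \1_A - \int[mu]_x (\1_A x * conv (rho m) \1_A x)))).
  by move=> m; rewrite err_ge0; exact: (moll_err (hm m)).
rewrite -(mulr0 2); apply: cvgMl_tmp; rewrite -(subrr (n2 mu \1_A)).
by apply: cvgB; [exact: cvg_cst|rewrite e2; exact: key].
Qed.

Let obox (k : nat) : set E := [set x | `|x| < k%:R].

Let obox_open k : open (obox k).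
Proof.
rewrite /obox (_ : [set x | _] = (fun x : E => `|x|) @^-1` [set s | s < k%:R])//.
by apply: open_comp => [x _|]; [exact: norm_continuous|exact: open_lt].
Qed.

Let oboxr k x : obox k x -> `|x| <= k%:R. Proof. by move=> /ltW. Qed.

(** Dynkin's lemma on the open sets. Everything is intersected with one fixed box so that
    complements also have finite measure and the indicators stay in $L^2$. *)
Let good_indic_box k (A : set E) : measurable A -> good \1_(A `&` obox k).
Proof.
have Br (B : set E) x : (B `&` obox k) x -> `|x| <= k%:R by move=> [_ /ltW].
have mB (B : set E) : measurable B -> measurable (B `&` obox k).
  by move=> mB; apply: measurableI => //; exact: open_measurable_rV.
rewrite rV_measurable_open; move: A.
apply: (@dynkin_induction _ _ [set A : set E | open A]).
- exact: rV_measurable_open.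
- by move=> A B /= oA oB; exact: openI.
- by rewrite setTI; exact: (good_open (@obox_open k) (@oboxr k)).
- move=> A /= oA; apply: (@good_open _ k%:R); last exact: Br.
  by apply: openI => //; exact: obox_open.
- move=> A mA gA.
  have gT : good \1_(obox k) by exact: (good_open (@obox_open k) (@oboxr k)).
  rewrite (_ : \1_(~` A `&` obox k) = fun x => \1_(obox k) x + (-1) * \1_(A `&` obox k) x).
    exact: goodD gT (goodZ (-1) gA).
  apply/funext => x; rewrite !indicE !in_setI in_setC.
  by case: (_ \in _); case: (_ \in _) => /=; rewrite ?mulr0 ?mulr1 ?addr0 ?subrr.
- move=> F mF tF gF.
  pose G m := fun x => \sum_(i < m) \1_(F i `&` obox k) x : R.
  have mU : measurable (\bigcup_k0 F k0) by exact: bigcup_measurable.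
  have hU : sqi mu \1_(\bigcup_k0 F k0 `&` obox k) by apply: (indic_sqi (mB _ mU) (Br _)).
  have GE m x : G m x = \1_((\big[setU/set0]_(i < m) F i) `&` obox k) x.
    rewrite /G; elim: m => [|m IH]; first by rewrite !big_ord0 set0I indic0.
    rewrite !big_ord_recr/= IH !indicE !in_setI in_setU.
    case: (x \in obox k); rewrite ?andbT ?andbF ?addr0//.
    have [xm|//] := boolP (x \in F m); rewrite ?orbT ?orbF ?addr0//=.
    rewrite (_ : _ \in _ = false) ?add0r//; apply/negbTE/negP.
    rewrite inE -bigcup_mkord => -[i /= im Fi].
    move/trivIsetP: tF => /(_ i m I I (negbT (ltn_eqF im))).
    by rewrite -subset0 => /(_ x); apply; split => //; exact: set_mem.
  apply: (good_closed (F := G)) => //; first by move=> m; exact: good_sum.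
  pose D m := \1_((\bigcup_k0 F k0) `&` obox k) : E -> R.
  have : \int[mu]_x ((\1_(\bigcup_k0 F k0 `&` obox k) x - G m x) ^+ 2) @[m --> \oo] -->
      \int[mu]_(x in setT) (0 : R).
    apply: (@dct _ _ _ mu _ _ (fun x => \1_(\bigcup_k0 F k0 `&` obox k) x)).
    + move=> m; apply: measurable_funX; apply: measurable_funB; first exact: hU.1.
      rewrite (_ : G m = \1_((\big[setU/set0]_(i < m) F i) `&` obox k)); last first.
        by apply/funext => x; rewrite GE.
      by apply: measurable_indic; apply: mB; exact: bigsetU_measurable.
    + exact: measurable_cst.
    + exact: ig_indic (mB _ mU) (lebesgue_rV_bounded (mB _ mU) (Br _)).
    + move=> x; apply: cvg_near_cst.
      have [/[1!inE] -[[i _ Fi] Bx]|nx] := boolP (x \in \bigcup_k0 F k0 `&` obox k).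
        exists i.+1 => // m /= im.
        have m1 : (\bigcup_k0 F k0 `&` obox k) x by split => //; exists i.
        have m2 : ((\big[setU/set0]_(i < m) F i) `&` obox k) x.
          by split => //; rewrite -bigcup_mkord; exists i.
        by rewrite GE !indicE (mem_set m1) (mem_set m2) subrr expr0n.
      near=> m; rewrite GE !indicE (negPf nx) (_ : x \in _ = false) ?subrr ?expr0n//.
      apply/negbTE; apply: contra nx; rewrite !inE => -[]; rewrite -bigcup_mkord.
      by move=> [i /= _ Fi] Bx; split => //; exists i.
    + move=> m x; rewrite ger0_norm ?sqr_ge0// GE !indicE.
      have : (x \in (\big[setU/set0]_(i < m) F i) `&` obox k) ==> (x \in \bigcup_k0 F k0 `&` obox k).
        apply/implyP; rewrite !inE => -[]; rewrite -bigcup_mkord.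
        by move=> [i /= _ Fi] Bx; split => //; exists i.
      by case: (_ \in _); case: (_ \in _) => //= _; rewrite ?subr0 ?subrr ?expr1n ?expr0n.
  by rewrite int0.
Unshelve. all: by end_near. Qed.

Let good_box_sfun k (s : {nnsfun E >-> R}) : good (fun x => s x * \1_(obox k) x).
Proof.
pose r : seq R := finmap.enum_fset (fset_set (range s)).
rewrite (_ : (fun x => _) =
  fun x => \sum_(y <- r) (y * \1_((s @^-1` [set y]) `&` obox k) x)).
  by apply: good_sum => y; apply: goodZ; exact: good_indic_box.
apply/funext => x; rewrite (fimfunE s) fsbig_finite//= mulr_suml.
apply: eq_bigr => y _; rewrite -mulrA !indicE in_setI.
by case: (_ \in _); case: (_ \in _); rewrite ?mulr1 ?mulr0.
Qed.

Let good_ge0 f : sqi mu f -> (forall x, 0 <= f x) -> good f.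
Proof.
move=> hf f0; have mf : measurable_fun setT (EFin \o f) by apply/measurable_EFinP; exact: hf.1.
pose s := nnsfun_approx measurableT mf.
pose F m x := s m x * \1_(obox m) x.
have sf x : s m x @[m --> \oo] --> f x.
  have := cvg_nnsfun_approx measurableT mf (fun x _ => f0 x : (0 <= (EFin \o f) x)%E)
    (I : [set: E] x).
  by move=> /fine_cvg.
have sle m x : s m x <= f x.
  apply: (cvgr_to_ge (sf x)); exists m => // k /= mk.
  by have /lefP/(_ x) := nd_nnsfun_approx measurableT mf mk.
have Ff x : F m x @[m --> \oo] --> f x.
  rewrite -[f x]mulr1; apply: cvgM; first exact: sf.
  apply: cvg_near_cst; exists (Num.truncn `|x|).+1 => // m /= xm.
  rewrite indicE mem_set// /obox/= (lt_le_trans (truncnS_gt _))//.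
  by rewrite ler_nat.
have F01 m x : 0 <= F m x <= f x.
  rewrite /F indicE; case: (_ \in _); rewrite ?mulr0 ?mulr1 ?lexx ?f0//.
  by rewrite sle andbT; exact: fun_ge0.
apply: (good_closed (F := F)) => //; first by move=> m; exact: good_box_sfun.
have : \int[mu]_x ((f x - F m x) ^+ 2) @[m --> \oo] --> \int[mu]_(x in setT) (0 : R).
  apply: (@dct _ _ _ mu _ _ (fun x => f x ^+ 2)).
  - move=> m; apply: measurable_funX; apply: measurable_funB; first exact: hf.1.
    apply: measurable_funM; first exact: measurable_funPT.
    by apply: measurable_indic; apply: open_measurable_rV; exact: obox_open.
  - exact: measurable_cst.
  - exact: hf.2.
  - move=> x; rewrite (_ : 0 = (f x - f x) ^+ 2); last by rewrite subrr expr0n.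
    by rewrite expr2; apply: cvgM; apply: cvgB; rewrite ?Ff//; exact: cvg_cst.
  - move=> m x; rewrite ger0_norm ?sqr_ge0//; apply: sqr_le_norm.
    by have /andP[h1 h2] := F01 m x; rewrite ger0_norm ?subr_ge0// lerBlDr lerDl.
by rewrite int0.
Qed.

Lemma moll_cvg f : sqi mu f ->
  n2 mu (fun x => conv (rho m) f x - f x) @[m --> \oo] --> 0.
Proof.
move=> hf.
have hp : sqi mu (fun x => Num.max (f x) 0).
  apply: (sqi_le _ hf); first by apply: measurable_maxr => //; exact: hf.1.
  move=> x; case: (leP (f x) 0) => // fx; by rewrite normr0.
have hn : sqi mu (fun x => Num.max (- f x) 0).
  apply: (sqi_le _ hf).
    by apply: measurable_maxr => //; apply: measurableT_comp => //; exact: hf.1.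
  move=> x; case: (leP (- f x) 0) => // fx; by rewrite ?normrN ?normr0.
have gp : good (fun x => Num.max (f x) 0).
  by apply: (good_ge0 hp) => x; rewrite le_max lexx orbT.
have gn : good (fun x => Num.max (- f x) 0).
  by apply: (good_ge0 hn) => x; rewrite le_max lexx orbT.
have [_] := goodD gp (goodZ (-1) gn).
rewrite (_ : (fun x => _) = f)//; apply/funext => x; rewrite mulN1r.
case: (leP (f x) 0) => fx.
  by rewrite add0r max_l ?opprK// oppr_ge0.
by rewrite max_r ?subr0// oppr_le0 ltW.
Qed.

(** Polarisation reduces $fg$ to squares, to which [moll_sq_err] applies. [S] may depend on [m],
    with a common bound, because the removal of a double mollification takes [S m] to be itself a
    mollification. *)
Lemma moll_weak_cvg C (S : nat -> E -> R) f g :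
  (forall m, measurable_fun setT (S m)) -> (forall m y, `|S m y| <= C) ->
  sqi mu f -> sqi mu g ->
  \int[mu]_x (conv (rho m) (S m) x * (f x * g x)) -
  \int[mu]_x (S m x * (f x * g x)) @[m --> \oo] --> 0.
Proof.
move=> mS SC hf hg.
have sq h : sqi mu h ->
    \int[mu]_x ((conv (rho m) (S m) x - S m x) * h x ^+ 2) @[m --> \oo] --> 0.
  move=> hh; apply: norm_cvg0.
  apply: (@cvg0_squeeze _ _ (fun m => C * (4 * (Num.sqrt (n2 mu h) *
      Num.sqrt (n2 mu (fun x => conv (rho m) h x - h x)))))).
    by move=> m; rewrite normr_ge0/=; exact: (moll_sq_err (hm m)).
  rewrite -(mulr0 C); apply: cvgMl_tmp; rewrite -(mulr0 4); apply: cvgMl_tmp.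
  rewrite -(mulr0 (Num.sqrt (n2 mu h))); apply: cvgMl_tmp.
  rewrite -sqrtr0; apply: continuous_cvg; first exact: sqrt_continuous.
  exact: moll_cvg.
have mM m : measurable_fun setT (conv (rho m) (S m)) by exact: (conv_meas (moll_kern (hm m))).
have Mb m x : `|conv (rho m) (S m) x| <= C by exact: (moll_bdd (hm m)).
have dB m x : `|conv (rho m) (S m) x - S m x| <= C + C.
  by rewrite (le_trans (ler_normB _ _))// lerD.
have mD m : measurable_fun setT (fun x => conv (rho m) (S m) x - S m x).
  exact: measurable_funB.
have E m : \int[mu]_x (conv (rho m) (S m) x * (f x * g x)) -
    \int[mu]_x (S m x * (f x * g x)) =
    4^-1 * (\int[mu]_x ((conv (rho m) (S m) x - S m x) * (f x + g x) ^+ 2) -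
    \int[mu]_x ((conv (rho m) (S m) x - S m x) * (f x - g x) ^+ 2)) + 0.
  have p1 := ig_bdd (mD m) (dB m) (sqiD hf hg).2.
  have p2 := ig_bdd (mD m) (dB m) (sqiB hf hg).2.
  have p3 := ig_bdd (mS m) (SC m) (sqi_mul hf hg).
  have p4 := ig_bdd (mM m) (Mb m) (sqi_mul hf hg).
  rewrite -(intB p1 p2) -(intZ _ (igB p1 p2)) -(intB p4 p3) addr0.
  by apply: eq_int => x; field.
exact: cvg_affine0 E (sq _ (sqiD hf hg)) (sq _ (sqiB hf hg)).
Qed.

End mollifier_convergence.

(** * Existence of mollifiers *)

Section flat_functions.
Context {R : realType}.
Implicit Types (p : {poly R}) (x y : R).

(* The functions [p(1/x) exp(-1/x)] are closed under derivation. *)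
Definition flat p x : R := if 0 < x then p.[x^-1] * expR (- x^-1) else 0.

Lemma powX_expRN_le (m : nat) y : 0 <= y -> y ^+ m * expR (- y) <= m`!%:R.
Proof.
case: m => [|m] y0.
  by rewrite expr0 mul1r -expR0 ler_expR oppr_le0.
rewrite expRN ler_pdivrMr ?expR_gt0// mulrC -ler_pdivrMr ?ltr0n ?fact_gt0//.
by rewrite (le_trans _ (expR_ge1Dxn m y0))// lerDr.
Qed.

(** With $y=1/x$, the $i$-th term divided by $x^2$ is at most
    $|p_i|\,y^{i+2}e^{-y}\le|p_i|\,(i+2)!$. The quadratic bound makes the origin a point of
    differentiability, with derivative 0. *)
Lemma flat_bound p : exists L, forall x, `|x| <= 1 -> `|flat p x| <= L * x ^+ 2.
Proof.
exists (\sum_(i < size p) `|p`_i| * (i.+2)`!%:R) => x x1.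
have L0 : 0 <= \sum_(i < size p) `|p`_i| * (i.+2)`!%:R.
  by apply: sumr_ge0 => i _; rewrite mulr_ge0.
rewrite /flat; case: ifPn => x0; last by rewrite normr0 mulr_ge0// sqr_ge0.
have xi0 : 0 < x^-1 by rewrite invr_gt0.
rewrite -ler_pdivrMr ?exprn_gt0// -exprVn.
rewrite normrM (ger0_norm (expR_ge0 _)) horner_coef -mulrA.
apply: le_trans (ler_wpM2r _ (ler_norm_sum _ _ _)) _.
  by rewrite mulr_ge0 ?expR_ge0// exprn_ge0// ltW.
rewrite mulr_suml; apply: ler_sum => i _.
rewrite normrM -mulrA; apply: ler_wpM2l => //.
rewrite ger0_norm ?exprn_ge0 ?(ltW xi0)// (_ : _ * _ = x^-1 ^+ i.+2 * expR (- x^-1)).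
  by apply: powX_expRN_le; exact: ltW.
by rewrite -[i.+2]addn2 exprD -mulrA [in RHS](mulrC _ (expR _)).
Qed.

Lemma flat_is_derive p x : is_derive x (1 : R) (flat p) (flat ((p - p^`()) * 'X^2) x).
Proof.
have [x0|x0|->] := ltgtP x 0.
- rewrite {2}/flat ltNge ltW//=.
  have := is_derive_cst (0 : R) x (1 : R); apply: near_eq_is_derive => //.
  have : \forall y \near x, y < 0 by exact: lt_nbhsl.
  by apply: filterS => y y0; rewrite /flat ltNge ltW.
- rewrite {2}/flat x0.
  have dV : is_derive x (1 : R) (fun y : R => y^-1) (- x ^- 2).
    apply: is_derive_eq (is_deriveV (f := id) _ (is_derive_id x (1 : R))) _.
      exact: lt0r_neq0.
    by rewrite [LHS]mulr1.
  have d1 : is_derive x (1 : R) (horner p \o (fun y : R => y^-1)) (p^`().[x^-1] * (- x ^- 2)).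
    exact: is_derive1_comp.
  have d2 : is_derive x (1 : R) (expR \o (fun y : R => - y^-1)) (expR (- x^-1) * - (- x ^- 2)).
    exact: is_derive1_comp.
  have := is_deriveM d1 d2.
  rewrite (_ : _ *: _ + _ = ((p - p^`()) * 'X^2).[x^-1] * expR (- x^-1)); last first.
    rewrite hornerM hornerXn hornerD hornerN -exprVn /=.
    by rewrite /GRing.scale/=; ring.
  apply: near_eq_is_derive => //.
  have : \forall y \near x, 0 < y by exact: lt_nbhsr.
  by apply: filterS => y y0; rewrite /flat y0.
- have [L HL] := flat_bound p.
  rewrite {2}/flat ltxx; apply: (@quadratic_is_derive _ _ _ _ _ _ L) => h h1.
  by rewrite add0r [h *: 1]mulr1 mulr0 {2}/flat ltxx !subr0; exact: HL.
Qed.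

End flat_functions.

(** * Smooth functions of one variable and a bump function *)

Section smooth1.
Context {R : realType}.
Implicit Types (f g : R -> R).

Fixpoint Dk (k : nat) f : Prop :=
  if k is k'.+1 then exists2 f', (forall x, is_derive x (1 : R) f (f' x)) & Dk k' f'
  else continuous f.

Definition smooth f := forall k, Dk k f.

Lemma is_derive_continuous f f' : (forall x, is_derive x (1 : R) f (f' x)) ->
  continuous f.
Proof.
by move=> df x; apply/differentiable_continuous/derivable1_diffP; case: (df x).
Qed.

Lemma DkW k f : Dk k.+1 f -> Dk k f.
Proof.
elim: k f => [|k IH] f /=; first by move=> [f' df _]; exact: is_derive_continuous df.
by move=> [f' df f'S]; exists f' => //; exact: IH.
Qed.

Lemma DkD k f g : Dk k f -> Dk k g -> Dk k (fun x => f x + g x).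
Proof.
elim: k f g => [|k IH] f g /=; first by move=> cf cg x; apply: cvgD; [exact: cf|exact: cg].
move=> [f' df hf] [g' dg hg]; exists (fun x => f' x + g' x); last exact: IH.
by move=> x; apply: is_deriveD.
Qed.

Lemma DkM k f g : Dk k f -> Dk k g -> Dk k (fun x => f x * g x).
Proof.
elim: k f g => [|k IH] f g; first by move=> cf cg x; apply: cvgM; [exact: cf|exact: cg].
move=> hf hg; have hf' := DkW hf; have hg' := DkW hg.
move: hf hg => [f' df hf] [g' dg hg]; exists (fun x => f x * g' x + g x * f' x).
  by move=> x; exact: is_deriveM (df x) (dg x).
by apply: DkD; exact: IH.
Qed.

Lemma Dk_affine k f (a s : R) : Dk k f -> Dk k (fun x => f (a + s * x)).
Proof.
elim: k f => [|k IH] f /=.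
  move=> cf x; apply: (@continuous_comp _ _ _ (fun x => a + s * x) f); last exact: cf.
  by apply: cvgD; [exact: cvg_cst|apply: cvgMl_tmp; exact: cvg_id].
move=> [f' df hf]; exists (fun x => s * f' (a + s * x)).
  move=> x; rewrite mulrC.
  have d2 : is_derive x (1 : R) (fun x => a + s * x) s.
    have := is_deriveD (is_derive_cst a x (1 : R)) (is_deriveZ s (is_derive_id x (1 : R))).
    by rewrite add0r [s *: 1]mulr1.
  exact: (is_derive1_comp (df _) d2).
apply: DkM; last exact: IH.
elim: k {IH hf} => [|k IH] /=; first by move=> x; exact: cvg_cst.
exists (fun=> 0); first by move=> x; exact: is_derive_cst.
elim: k {IH} => [|k IH] /=; first by move=> x; exact: cvg_cst.
by exists (fun=> 0) => // x; exact: is_derive_cst.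
Qed.

Lemma smooth_flat (p : {poly R}) : smooth (flat p).
Proof.
move=> k; elim: k p => [|k IH] p /=.
  by apply: is_derive_continuous => x; exact: flat_is_derive.
by exists (flat ((p - p^`()) * 'X^2)) => // x; exact: flat_is_derive.
Qed.

Lemma smooth_deriv f : smooth f -> (forall x, is_derive x (1 : R) f ((derive1 f) x)) /\
  smooth (derive1 f).
Proof.
move=> sf.
have d1 x : is_derive x (1 : R) f ((derive1 f) x).
  have [f' df _] := sf 1%N.
  by rewrite derive1E; case: (df x) => dfx e; split.
split=> // k; have [f' df hf] := sf k.+1.
rewrite (_ : (derive1 f) = f')//; apply/funext => x; rewrite derive1E.
by case: (df x).
Qed.

Lemma smooth_continuous f : smooth f -> continuous f.
Proof. by move=> /(_ 0%N). Qed.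

Definition supp_in (c : R) f := forall x, c < `|x| -> f x = 0.

Lemma supp_deriv c f : smooth f -> supp_in c f -> supp_in c (derive1 f).
Proof.
move=> sf fc x cx; rewrite derive1E; apply: derive_val.
have := is_derive_cst (0 : R) x (1 : R); apply: near_eq_is_derive => //.
have : \forall y \near x, c < `|y|.
  have : (Num.norm \o (id : R -> R)) @ x --> `|x| by exact: norm_continuous.
  by move=> /cvgr_gt; apply.
by apply: filterS => y /fc ->.
Qed.

Lemma smooth_bounded c f : smooth f -> supp_in c f ->
  exists2 C, 0 <= C & forall x, `|f x| <= C.
Proof.
move=> /smooth_continuous cf fc.
have cw : {within `[- `|c|, `|c|], continuous (fun x => `|f x|)}.
  apply: continuous_subspaceT => x.
  by apply: continuous_comp; [exact: cf|exact: norm_continuous].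
have cc : - `|c| <= `|c| by rewrite (@le_trans _ _ 0)// oppr_le0.
have [M _ HM] := EVT_max cc cw.
exists `|f M| => // x; have [xc|xc] := leP `|x| `|c|.
  by apply: HM; rewrite in_itv/= -ler_norml.
by rewrite fc ?normr0// (le_lt_trans (ler_norm c)).
Qed.

Lemma smooth_mvt f (a b : R) : smooth f ->
  exists2 t, `|t - a| <= `|b - a| & f b - f a = (derive1 f) t * (b - a).
Proof.
move=> sf; have [df _] := smooth_deriv sf.
have cf := smooth_continuous sf.
have [ab|ab] := leP a b.
  have [t] := MVT_segment ab (fun x _ => df x) (continuous_subspaceT cf).
  rewrite in_itv/= => /andP[h1 h2] e; exists t => //.
  by rewrite !ger0_norm ?subr_ge0// lerD2r.
have [t] := MVT_segment (ltW ab) (fun x _ => df x) (continuous_subspaceT cf).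
rewrite in_itv/= => /andP[h1 h2] e; exists t.
  by rewrite !ler0_norm ?subr_le0 ?(ltW ab)// lerN2 lerD2r.
by rewrite -[b - a]opprB mulrN -e opprB.
Qed.

Lemma smooth_lipschitz c f : smooth f -> supp_in c f ->
  exists2 L, 0 <= L & forall x y, `|f x - f y| <= L * `|x - y|.
Proof.
move=> sf fc; have [df sf'] := smooth_deriv sf.
have [L L0 HL] := smooth_bounded sf' (supp_deriv sf fc).
exists L => // x y; have [t _ ->] := smooth_mvt y x sf.
by rewrite normrM ler_wpM2r.
Qed.

(** Mean value theorem together with a Lipschitz bound on the derivative; this is the source of the
    uniform remainder [moll_diff]. *)
Lemma smooth_taylor c f : smooth f -> supp_in c f ->
  exists2 L, 0 <= L & forall x h, `|f (x + h) - f x - h * (derive1 f) x| <= L * h ^+ 2.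
Proof.
move=> sf fc; have [df sf'] := smooth_deriv sf.
have [L L0 HL] := smooth_lipschitz sf' (supp_deriv sf fc).
exists L => // x h; have [t ht ->] := smooth_mvt x (x + h) sf.
rewrite addrAC subrr add0r in ht *.
rewrite mulrC -mulrBr normrM -[h ^+ 2]real_normK ?num_real// expr2 mulrCA.
apply: ler_wpM2l => //; apply: le_trans (HL _ _) _.
exact: ler_wpM2l.
Qed.

Lemma bump_exists (c : R) : 0 < c -> exists b : R -> R,
  [/\ smooth b, supp_in c b, forall x, 0 <= b x, 0 < b 0 & forall x, b (- x) = b x].
Proof.
move=> c0; pose F := flat (1 : {poly R}).
have F0 x : 0 <= F x by rewrite /F /flat; case: ifP; rewrite // hornerC mul1r expR_ge0.
(* On $|x|<c$ this is $e^{-1/(c+x)}e^{-1/(c-x)}$, and outside one of the factors vanishes; the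
   arguments are written in the shape of [Dk_affine]. *)
exists (fun x => F (c + 1 * x) * F (c + (- 1) * x)); split.
- move=> k; apply: DkM; apply: Dk_affine; exact: smooth_flat.
- move=> x cx; rewrite /F /flat.
  have [x0|x0] := leP 0 x.
    rewrite [X in _ * X]ifF ?mulr0//; apply/negbTE; rewrite -leNgt.
    by move: cx; rewrite ger0_norm//; lra.
  rewrite [X in X * _]ifF ?mul0r//; apply/negbTE; rewrite -leNgt.
  by move: cx; rewrite ltr0_norm//; lra.
- by move=> x; rewrite mulr_ge0.
- by rewrite !mulr0 addr0 /F /flat c0 hornerC mul1r mulr_gt0// expR_gt0.
- by move=> x; rewrite mulrC; congr (F _ * F _); ring.
Qed.

End smooth1.

(** * Tensor products of functions of one variable *)

Section tensor.
Context {R : realType} {n : nat}.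
Local Notation E := 'rV[R]_n.
Local Notation mu := (lebesgue_rV R n).

Definition tens (G : 'I_n -> R -> R) (y : E) : R := \prod_i G i (y 0 i).

(** Differentiating a tensor product in direction $j$ replaces its $j$-th factor by the derivative,
    so tensor products of smooth functions form a class stable under partial derivatives. *)
Definition upd (G : 'I_n -> R -> R) j g i := if i == j then g else G i.

Lemma tens_upd G j g y :
  tens (upd G j g) y = g (y 0 j) * \prod_(i | i != j) G i (y 0 i).
Proof.
rewrite /tens (bigD1 j)//= /upd eqxx; congr (_ * _).
by apply: eq_bigr => i /negPf ->.
Qed.

Lemma tensE G j y : tens G y = G j (y 0 j) * \prod_(i | i != j) G i (y 0 i).
Proof. by rewrite /tens (bigD1 j). Qed.

Lemma tens_line G j (x : E) (s : R) :
  tens G (x + s *: delta_mx 0 j) =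
  G j (x 0 j + s) * \prod_(i | i != j) G i (x 0 i).
Proof.
rewrite (tensE _ j); congr (G j _ * _).
  by rewrite !mxE !eqxx mulr1.
by apply: eq_bigr => i ij; rewrite !mxE eqxx (negPf ij) mulr0 addr0.
Qed.

Lemma tens_is_derive G j (a : R) x : (forall i, smooth (G i)) ->
  is_derive x (delta_mx 0 j) (fun y => a * tens G y) (a * tens (upd G j (derive1 (G j))) x).
Proof.
move=> sG; apply: line_is_derive; set P := \prod_(i | i != j) G i (x 0 i).
rewrite (_ : (fun s => _) = (fun s => (a * P) *: (G j \o shift (x 0 j)) s)); last first.
  apply/funext => s; rewrite tens_line /= -/P [RHS](_ : _ = (a * P) * G j (s + x 0 j))//.
  by rewrite (addrC s); ring.
rewrite tens_upd -/P (_ : a * (_ * P) = (a * P) *: (derive1 (G j) (x 0 j) * 1)); last first.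
  by rewrite mulr1 -[RHS]/((a * P) * derive1 (G j) (x 0 j)) -mulrA (mulrC P).
apply: is_deriveZ; apply: is_derive1_comp; last exact: is_derive_shift.
by rewrite /= add0r; exact: (smooth_deriv (sG j)).1.
Qed.

Lemma tens_continuous G : (forall i, continuous (G i)) -> continuous (tens G).
Proof.
move=> cG; rewrite /tens; elim: (index_enum _) => [|i s IH].
  rewrite (_ : (fun y => _) = fun=> 1); first exact: cst_continuous.
  by apply/funext => y; rewrite big_nil.
rewrite (_ : (fun y => _) =
    (fun y : E => G i (y 0 i) * \prod_(i <- s) G i (y 0 i))); last first.
  by apply/funext => y; rewrite big_cons.
move=> x; apply: (@continuousM _ _ (fun y : E => G i (y 0 i))); last exact: IH.
apply: (@continuous_comp _ _ _ (fun y : E => y 0 i) (G i)); last exact: cG.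
exact: continuous_coord.
Qed.

Lemma Ck_tens k (a : R) G : (forall i, smooth (G i)) -> Ck k (fun y => a * tens G y).
Proof.
have ct G' : (forall i, smooth (G' i)) -> continuous (fun y => a * tens G' y).
  move=> sG x; apply: (@continuousM _ _ (fun=> a)); first exact: cst_continuous.
  by apply: tens_continuous => i; exact: smooth_continuous.
elim: k G => [|k IH] G sG /=; first exact: ct.
split; first exact: ct.
move=> j; split; first by move=> x; case: (tens_is_derive j a x sG).
rewrite (_ : pderiv j _ = fun y => a * tens (upd G j (derive1 (G j))) y); last first.
  by apply/funext => x; rewrite /pderiv; case: (tens_is_derive j a x sG).
apply: IH => i; rewrite /upd; case: eqP => // _.
exact: (smooth_deriv (sG j)).2.
Qed.

(** The two bounds are proved together because the Lipschitz constant of a product involves the sup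
    bounds of its factors. *)
Lemma tens_lipschitz G :
  (forall i, exists2 C, 0 <= C & forall s, `|G i s| <= C) ->
  (forall i, exists2 L, 0 <= L & forall s t, `|G i s - G i t| <= L * `|s - t|) ->
  (exists2 C, 0 <= C & forall y, `|tens G y| <= C) /\
  exists2 L, 0 <= L & forall x y, `|tens G x - tens G y| <= L * `|x - y|.
Proof.
move=> GC GL; rewrite /tens; elim: (index_enum _) => [|i s [[C C0 HC] [L L0 HL]]].
  split; first by exists 1 => // y; rewrite big_nil normr1.
  by exists 0 => // x y; rewrite !big_nil subrr normr0 mul0r.
have [C' C'0 HC'] := GC i; have [L' L'0 HL'] := GL i; split.
  exists (C' * C) => [|y]; first exact: mulr_ge0.
  by rewrite big_cons normrM ler_pM.
exists (L' * C + C' * L) => [|x y]; first by rewrite addr_ge0// mulr_ge0.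
rewrite !big_cons; set p := \prod_(_ <- _) _; set q := \prod_(_ <- _) _.
rewrite (_ : _ - _ = (G i (x 0 i) - G i (y 0 i)) * p + G i (y 0 i) * (p - q)); last by ring.
rewrite (le_trans (ler_normD _ _))// [leRHS]mulrDl !normrM; apply: lerD.
  rewrite mulrAC; apply: ler_pM => //; last exact: HC.
  apply: le_trans (HL' _ _) _; apply: ler_wpM2l => //.
  by have := coord_le_norm (x - y) i; rewrite !mxE.
by rewrite -mulrA; apply: ler_pM => //; exact: HL.
Qed.

Lemma tens_supp c G : 0 <= c -> (forall i, supp_in c (G i)) ->
  forall x, tens G x != 0 -> `|x| <= c.
Proof.
move=> c0 Gc x; apply: contraNT; rewrite -ltNge => xc.
have [i ci] : exists i, c < `|x 0 i|.
  apply/not_existsP => H; move: xc; rewrite ltNge => /negP; apply.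
  by apply: rV_norm_le => // i; rewrite leNgt; apply/negP => /(H i).
by rewrite (tensE _ i) (Gc i _ ci) mul0r.
Qed.

Lemma kernZ c k a : kern c k -> kern c (fun x : E => a * k x).
Proof.
move=> [[L L0 HL] [C HC] ks ke]; split.
- exists (`|a| * L) => [|x y]; first by rewrite mulr_ge0.
  by rewrite -mulrBr normrM -mulrA ler_wpM2l.
- by exists (`|a| * C) => x; rewrite normrM ler_wpM2l.
- by move=> x; rewrite mulf_eq0 negb_or => /andP[_]; exact: ks.
- by move=> x; rewrite !normrM ke.
Qed.

Lemma kern_tens c G : 0 <= c -> (forall i, smooth (G i)) ->
  (forall i, supp_in c (G i)) -> (forall i s, `|G i (- s)| = `|G i s|) ->
  kern c (tens G).
Proof.
move=> c0 sG Gc Ge; have [[C C0 HC] HL] := tens_lipschitz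
  (fun i => smooth_bounded (sG i) (Gc i)) (fun i => smooth_lipschitz (sG i) (Gc i)).
split => //; first by exists C.
- exact: tens_supp.
- move=> x; rewrite /tens !normr_prod; apply: eq_bigr => i _.
  by rewrite mxE.
Qed.

Lemma derive1_even (b : R -> R) s : smooth b -> (forall x, b (- x) = b x) ->
  derive1 b (- s) = - derive1 b s.
Proof.
move=> sb eb; have [db _] := smooth_deriv sb.
have d2 : is_derive s (1 : R) (b \o -%R) (derive1 b (- s) * (- 1)).
  exact: is_derive1_comp.
have e : b \o -%R = b by apply/funext.
move: d2; rewrite e => -[_]; case: (db s) => _ -> ->.
by rewrite mulrN1 opprK.
Qed.

Lemma mollifier_exists (c : R) : 0 < c ->
  exists rho drho, @mollifier R n c rho drho.
Proof.
move=> c0; have [b [sb bc b0 b00 be]] := bump_exists c0.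
pose G (i : 'I_n) := b; pose DG j := upd G j (derive1 b).
have [db sb'] := smooth_deriv sb.
have sG i : smooth (G i) by [].
have c0' := ltW c0.
have kG : kern c (tens G).
  by apply: kern_tens => // i s; rewrite /G be.
have kDG j : kern c (tens (DG j)).
  apply: kern_tens => // i; rewrite /DG /upd; case: eqP => // _.
  - exact: supp_deriv.
  - by move=> s; rewrite derive1_even// normrN.
  - by move=> s; rewrite /G be.
pose Z := \int[mu]_x tens G x.
have tG0 x : 0 <= tens G x by apply: prodr_ge0 => i _; exact: b0.
have Z0 : 0 < Z.
  have tG00 : 0 < tens G 0.
    by apply: prodr_gt0 => i _; rewrite /G mxE.
  have [[L L0 HL] _ _ _] := kG; set t := tens G 0 in tG00 *.
  (* By the Lipschitz bound the product stays above half its value at 0 on the ball of radius $e$, a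
     set of positive measure, so the normalising constant is positive. The 1 guards against
     $L=0$. *)
  pose e := t / 2 / (L + 1).
  have L1 : 0 < L + 1 by rewrite ltr_wpDl.
  have e0 : 0 < e by rewrite !divr_gt0.
  have iG := kern_ig kG.
  apply: (@lt_le_trans _ _ (\int[mu]_x (t / 2 * ball_ind e x))).
    rewrite intZ; last exact: ig_ball_ind.
    rewrite mulr_gt0 ?divr_gt0// ball_indE int_indic; last exact: measurable_ball_set.
    apply: fine_gt0; rewrite lebesgue_rV_box_gt0//=.
    by apply: lebesgue_rV_box; exact: ltW.
  apply: le_int => // [|x]; first by apply: igZ; exact: ig_ball_ind.
  rewrite /ball_ind; have [xe|xe] := leP `|x| e; last by rewrite mulr0.
  rewrite mulr1; have := HL 0 x; rewrite sub0r normrN -/t => H.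
  have : `|t - tens G x| <= t / 2.
    rewrite (le_trans H)// (le_trans (ler_wpM2l L0 xe))// /e mulrCA ler_piMr//.
      by rewrite divr_ge0// ltW.
    by rewrite ler_pdivrMr// mul1r lerDl.
  by rewrite ler_norml => /andP[_]; lra.
exists (fun x => Z^-1 * tens G x), (fun j x => Z^-1 * tens (DG j) x); split.
- exact: kernZ.
- by move=> j; exact: kernZ.
- by move=> x; rewrite mulr_ge0// invr_ge0 ltW.
- rewrite intZ; last exact: kern_ig kG.
  by rewrite mulVf// gt_eqF.
- by move=> x; congr (_ * _); apply: eq_bigr => i _; rewrite mxE /G be.
- move=> j x; rewrite -mulrN /DG !tens_upd mxE derive1_even// mulNr.
  congr (_ * - (_ * _)).
  by apply: eq_bigr => i _; rewrite mxE /G be.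
- move=> j.
  have [L L0 HL] := smooth_taylor sb bc; have [C C0 HC] := smooth_bounded sb bc.
  exists (Z^-1 * (L * \prod_(i < n | i != j) C)) => z h.
  rewrite tens_line (tensE _ j) /DG tens_upd.
  set P := \prod_(i | i != j) G i (z 0 i).
  rewrite (_ : _ - _ - _ = Z^-1 * ((b (z 0 j + h) - b (z 0 j) - h * derive1 b (z 0 j)) * P)); last first.
    by rewrite /G; ring.
  have Zi : 0 <= Z^-1 by rewrite invr_ge0 ltW.
  rewrite normrM (ger0_norm Zi) -mulrA ler_wpM2l// normrM mulrAC.
  apply: ler_pM => //.
  by rewrite normr_prod; apply: ler_prod => i _; rewrite normr_ge0/= /G.
- move=> x; split.
    move=> k; pose H (i : 'I_n) (s : R) := b (x 0 i + (-1) * s).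
    rewrite (_ : (fun y => _) = fun y => Z^-1 * tens H y).
      by apply: Ck_tens => i m; exact: Dk_affine.
    apply/funext => y; congr (_ * _); apply: eq_bigr => i _.
    by rewrite /H /G !mxE mulN1r.
  exists [set y | forall i, `[x 0 i - c, x 0 i + c]%classic (y 0 i)]; split.
    apply: (@rV_compact _ _ (fun i => `[x 0 i - c, x 0 i + c]%classic)) => i.
    exact: segment_compact.
  move=> y /= ny; apply/eqP; apply/negPn/negP.
  rewrite mulf_eq0 negb_or => /andP[_] /(tens_supp c0' (fun i => bc)) xy; apply: ny => i.
  have := le_trans (coord_le_norm _ i) xy; rewrite !mxE in_itv/= ler_norml => /andP[h1 h2].
  by apply/andP; split; lra.
Qed.

End tensor.

(** * Test functions and test fields *)

Section Lp_components.
Context {R : realType} {d : nat}.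
Local Notation E := 'rV[R]_d.
Local Notation mu := (lebesgue_rV R d).

Lemma mxnorm2_sq m n (A : 'M[R]_(m, n)) : mxnorm2 A ^+ 2 = \sum_i \sum_j A i j ^+ 2.
Proof.
rewrite /mxnorm2 sqr_sqrtr.
  by apply: eq_bigr => i _; apply: eq_bigr => j _; rewrite expr2.
by apply: sumr_ge0 => i _; apply: sumr_ge0 => j _; rewrite -expr2 sqr_ge0.
Qed.

Lemma mxnorm2_ge0 m n (A : 'M[R]_(m, n)) : 0 <= mxnorm2 A.
Proof. exact: sqrtr_ge0. Qed.

Lemma coord_le_mxnorm2 m n (A : 'M[R]_(m, n)) i j : `|A i j| <= mxnorm2 A.
Proof.
rewrite -sqrtr_sqr /mxnorm2 ler_sqrt; last first.
  by apply: sumr_ge0 => k _; apply: sumr_ge0 => l _; rewrite -expr2 sqr_ge0.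
rewrite /mxdot (bigD1 i)//= (bigD1 j)//= -expr2 -addrA lerDl addr_ge0//.
  by apply: sumr_ge0 => k _; rewrite -expr2 sqr_ge0.
by apply: sumr_ge0 => k _; apply: sumr_ge0 => l _; rewrite -expr2 sqr_ge0.
Qed.

Lemma mxnorm2_le m n (A : 'M[R]_(m, n)) C : 0 <= C -> (forall i j, `|A i j| <= C) ->
  mxnorm2 A <= (m * n)%:R * C.
Proof.
move=> C0 AC; have := mxnorm2_sq A.
have : \sum_i \sum_j A i j ^+ 2 <= ((m * n)%:R * C) ^+ 2.
  apply: (@le_trans _ _ (\sum_(i < m) \sum_(j < n) C ^+ 2)).
    by apply: ler_sum => i _; apply: ler_sum => j _; exact: sqr_le_norm.
  rewrite !sumr_const !card_ord -mulrnA mulnC -[leLHS]mulr_natl exprMn.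
  rewrite ler_wpM2r ?sqr_ge0// expr2 -natrM ler_nat.
  by case: (m * n)%N => // k; rewrite leq_pmulr.
move=> h1 h2; rewrite -h2 in h1.
rewrite -(ger0_norm (mxnorm2_ge0 A)) -sqrtr_sqr.
have mn0 : 0 <= (m * n)%:R * C by rewrite mulr_ge0.
by rewrite -[leRHS](ger0_norm mn0) -sqrtr_sqr ler_sqrt// sqr_ge0.
Qed.

Lemma measurable_mxnorm2_sq m n (v : E -> 'M[R]_(m, n)) :
  (forall i j, measurable_fun setT (fun x => v x i j)) ->
  measurable_fun setT (fun x => mxnorm2 (v x) ^+ 2).
Proof.
move=> mv; rewrite (_ : (fun x => _) = fun x => \sum_i \sum_j v x i j ^+ 2).
  apply: measurable_sum => i; apply: measurable_sum => j.
  exact: measurable_funX.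
by apply/funext => x; rewrite mxnorm2_sq.
Qed.

Lemma Lpnorm2_lty m n (v : E -> 'M[R]_(m, n)) :
  (Lpnorm 2%:E v < +oo)%E = (\int[mu]_x (mxnorm2 (v x) ^+ 2)%:E < +oo)%E.
Proof.
have e : (Lpnorm 2%:E v `^ 2 = \int[mu]_x (mxnorm2 (v x) ^+ 2)%:E)%E.
  rewrite /Lpnorm powR_Lnorm//; apply: eq_integral => x _ /=.
  by rewrite ger0_norm ?mxnorm2_ge0// powR_mulrn// mxnorm2_ge0.
apply/idP/idP => h; first by rewrite -e poweR_lty.
by rewrite -e in h; apply: lty_poweRy h.
Qed.

Lemma in_Lp2P m n (v : E -> 'M[R]_(m, n)) :
  in_Lp 2%:E v <-> forall i j, sqi mu (fun x => v x i j).
Proof.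
rewrite /in_Lp Lpnorm2_lty; split.
  move=> [mv hv] i j; split => //.
  have mN := measurable_mxnorm2_sq mv.
  apply: (@ig_le _ _ _ _ _ (fun x => mxnorm2 (v x) ^+ 2)); first exact: measurable_funX.
    apply/integrableP; split; first exact/measurable_EFinP.
    under eq_integral => x _ do rewrite /= ger0_norm ?sqr_ge0//.
    exact: hv.
  by move=> x; rewrite ger0_norm ?sqr_ge0//; apply: sqr_le_norm; exact: coord_le_mxnorm2.
move=> hv; split; first by move=> i j; exact: (hv i j).1.
rewrite (eq_integral (fun x => (\sum_i \sum_j v x i j ^+ 2)%:E)); last first.
  by move=> x _; rewrite mxnorm2_sq.
have h : ig mu (fun x => \sum_i \sum_j v x i j ^+ 2).
  by apply: ig_sum => i; apply: ig_sum => j; exact: (hv i j).2.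
exact: integrable_lty h.
Qed.

Lemma int_mxnorm2 m n (v : E -> 'M[R]_(m, n)) : (forall i j, sqi mu (fun x => v x i j)) ->
  (\int[mu]_x (mxnorm2 (v x) ^+ 2)%:E = (\sum_i \sum_j n2 mu (fun x => v x i j))%:E)%E.
Proof.
move=> hv; rewrite -EFin_int; last first.
  apply: (@eq_ig _ _ _ _ (fun x => \sum_i \sum_j v x i j ^+ 2)).
    by move=> x; rewrite mxnorm2_sq.
  by apply: ig_sum => i; apply: ig_sum => j; exact: (hv i j).2.
congr EFin; under eq_int do rewrite mxnorm2_sq.
rewrite int_sum; last by move=> i; apply: ig_sum => j; exact: (hv i j).2.
by apply: eq_bigr => i _; rewrite int_sum// => j; exact: (hv i j).2.
Qed.

(** The norm of exponent [+oo] is the essential supremum only when the whole space has positive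
    measure, so unfolding it requires this fact. *)
Lemma mu_setT_gt0 : (0 < mu [set: E])%E.
Proof.
apply: lt_le_trans (@lebesgue_rV_box_gt0 R d 1 ltr01) _.
by apply: le_measure; rewrite ?inE//; exact: measurable_ball_set.
Qed.

Lemma in_Lpy m n (v : E -> 'M[R]_(m, n)) C :
  (forall i j, measurable_fun setT (fun x => v x i j)) ->
  (forall x i j, `|v x i j| <= C) -> in_Lp +oo v.
Proof.
move=> mv vC; split => //; rewrite /Lpnorm unlock mu_setT_gt0.
apply: (@le_lt_trans _ _ ((m * n)%:R * `|C|)%:E); last by rewrite ltry.
apply/ess_supP; apply: aeW => x /=; rewrite lee_fin ger0_norm ?mxnorm2_ge0//.
by apply: mxnorm2_le => // i j; rewrite (le_trans (vC _ _ _))// ler_norm.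
Qed.

Lemma Lpnormy_ae m n (v : E -> 'M[R]_(m, n)) (a : R) : (Lpnorm +oo v <= a%:E)%E ->
  \forall x \ae mu, forall i j, `|v x i j| <= a.
Proof.
rewrite /Lpnorm unlock mu_setT_gt0 => /ess_supP; apply: filterS => x /=.
rewrite lee_fin ger0_norm ?mxnorm2_ge0// => h i j.
exact: le_trans (coord_le_mxnorm2 _ _ _) h.
Qed.

Definition sqv (v : E -> E) := forall i, sqi mu (fun x => v x 0 i).

Lemma int_mxdot (v w : E -> E) : sqv v ->
  sqv w ->
  \int[mu]_x mxdot (v x) (w x) = \sum_i \int[mu]_x (v x 0 i * w x 0 i).
Proof.
move=> hv hw; rewrite -int_sum; last by move=> i; exact: sqi_mul.
by apply: eq_int => x; rewrite /mxdot big_ord1.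
Qed.

End Lp_components.

(** * Integration by parts against test functions; mollified fields as test fields *)

Section test_functions.
Context {R : realType} {d : nat}.
Local Notation E := 'rV[R]_d.
Local Notation mu := (lebesgue_rV R d).
Local Notation e_ j := (delta_mx 0 j : E).

Lemma ig_cont_supp (f : E -> R) r : continuous f -> (forall x, f x != 0 -> `|x| <= r) ->
  (exists C, forall x, `|f x| <= C) /\ ig mu f.
Proof.
move=> cf fr; suff [C HC] : exists C, forall x, `|f x| <= C.
  by split; [exists C|apply: (ig_bdd_supp (continuous_measurable_rV cf) HC fr)].
have cK : compact [set x : E | `|x| <= r].
  apply: bounded_closed_compact.
    by exists r; split; [exact: num_real|move=> M rM x /= xr; rewrite (le_trans xr)// ltW].
  rewrite (_ : [set x | _] = ~` ((fun x : E => `|x|) @^-1` [set s | r < s])); last first.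
    by apply/seteqP; split => x /=; rewrite leNgt => /negP.
  apply: open_closedC; apply: open_comp; last exact: open_gt.
  by move=> x _; exact: norm_continuous.
have /compact_bounded[M [_ HM]] := continuous_compact (continuous_subspaceT cf) cK.
exists (`|M| + 1) => x; have [->|/fr xr] := eqVneq (f x) 0; first by rewrite normr0 addr_ge0.
apply: (HM (`|M| + 1)); last by exists x.
by rewrite (le_lt_trans (ler_norm M))// ltrDl.
Qed.

Record good_test (psi : E -> R) (dpsi : 'I_d -> E -> R) : Prop := GoodTest {
  gt_cont : continuous psi;
  gt_dcont : forall j, continuous (dpsi j);
  gt_derive : forall j x, is_derive x (e_ j) psi (dpsi j x);
  gt_supp : exists r, (forall x, psi x != 0 -> `|x| <= r) /\
    forall j x, dpsi j x != 0 -> `|x| <= r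
}.

Lemma test_function_good (psi : E -> R) : test_function psi ->
  good_test psi (fun j => pderiv j psi).
Proof.
move=> [psiC [K [cK Kpsi]]].
have [c0 c1] := psiC 1%N.
have [r Kr] : exists r, forall x, K x -> `|x| <= r.
  have [M [_ HM]] := compact_bounded cK.
  by exists (`|M| + 1) => x; apply: HM; rewrite (le_lt_trans (ler_norm M))// ltrDl.
have sup x : psi x != 0 -> `|x| <= r.
  by move=> px; apply: Kr; apply: contra_neqP px => /Kpsi.
split.
- exact: c0.
- by move=> j; have [_ /= c2] := c1 j.
- by move=> j x; have [+ _] := c1 j; move=> /(_ x) dx; split.
- exists r; split => // j x; apply: contraNT; rewrite -ltNge => rx; apply/eqP.
  apply: derive_val; apply: line_is_derive.
  have := is_derive_cst (0 : R) (0 : R) (1 : R); apply: near_eq_is_derive => //.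
  have cl : continuous (fun s : R => `|x + s *: e_ j|).
    move=> s; apply: continuous_comp; last exact: norm_continuous.
    by apply: cvgD; [exact: cvg_cst|apply: cvgZr_tmp; exact: cvg_id].
  have : (fun s : R => `|x + s *: e_ j|) @ (0 : R) --> `|x|.
    by have := cl 0; rewrite /continuous_at scale0r addr0.
  move=> /cvgr_gt/(_ r rx); apply: filterS => s rs.
  apply/esym/eqP; apply/negPn/negP => /sup; by rewrite leNgt rs.
Qed.

Section good.
Variables (psi : E -> R) (dpsi : 'I_d -> E -> R).
Hypothesis gpsi : good_test psi dpsi.

Lemma good_sqi : sqi mu psi /\ forall j, sqi mu (dpsi j).
Proof.
have [r [h1 h2]] := gt_supp gpsi.
have H f : continuous f -> (forall x, f x != 0 -> `|x| <= r) -> sqi mu f.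
  move=> cf fr; split; first exact: continuous_measurable_rV.
  apply: (ig_cont_supp (r := r) _ _).2.
    rewrite (_ : (fun x => _) = fun x => f x * f x); first by move=> x; apply: continuousM; exact: cf.
    by apply/funext => x; rewrite expr2.
  by move=> x; rewrite expf_eq0/=; exact: fr.
by split; [exact: (H _ (gt_cont gpsi) h1)|move=> j; exact: (H _ (@gt_dcont _ _ gpsi j) (h2 j))].
Qed.

Lemma int_by_parts (F : E -> R) (DF : E -> R) j : continuous F -> continuous DF ->
  (forall x, is_derive x (e_ j) F (DF x)) ->
  [/\ ig mu (fun x => F x * dpsi j x), ig mu (fun x => DF x * psi x) &
  \int[mu]_x (F x * dpsi j x) = - \int[mu]_x (DF x * psi x)].
Proof.
move=> cF cDF dF; have [r [h1 h2]] := gt_supp gpsi.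
have i1 : ig mu (fun x => F x * dpsi j x).
  apply: (ig_cont_supp (r := r) _ _).2.
    by move=> x; apply: continuousM; [exact: cF|exact: (gt_dcont gpsi)].
  by move=> x; rewrite mulf_eq0 negb_or => /andP[_]; exact: h2.
have i2 : ig mu (fun x => DF x * psi x).
  apply: (ig_cont_supp (r := r) _ _).2.
    by move=> x; apply: continuousM; [exact: cDF|exact: (gt_cont gpsi)].
  by move=> x; rewrite mulf_eq0 negb_or => /andP[_]; exact: h1.
split => //; apply/eqP; rewrite -addr_eq0 -intD//; apply/eqP.
apply: (@int_derive0 _ _ (fun x => F x * psi x) _ (e_ j)).
- apply: (ig_cont_supp (r := r) _ _).2.
    by move=> x; apply: continuousM; [exact: cF|exact: (gt_cont gpsi)].
  by move=> x; rewrite mulf_eq0 negb_or => /andP[_]; exact: h1.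
- move=> x; have := is_deriveM (dF x) (gt_derive gpsi j x).
  by rewrite [psi x *: _]mulrC.
- have c1 : continuous (fun x => F x * dpsi j x).
    by move=> x; apply: continuousM; [exact: cF|exact: (gt_dcont gpsi)].
  have c2 : continuous (fun x => DF x * psi x).
    by move=> x; apply: continuousM; [exact: cDF|exact: (gt_cont gpsi)].
  by move=> x; exact: (continuousD (c1 x) (c2 x)).
- exact: igD.
Qed.

End good.

(** This allows a test function to be used as the $q$ of the weak incompressibility condition, and
    so yields [div_free] for a solution. *)
Lemma test_function_W12 (psi : E -> R) : test_function psi ->
  in_W1p 2%:E (fun x : E => (psi x)%:M : 'rV[R]_1) (fun x : E => \row_j pderiv j psi x).
Proof.
move=> tpsi; have gpsi := test_function_good tpsi.
have [s1 s2] := good_sqi gpsi; split.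
- apply/in_Lp2P => i j; apply: eq_sqi s1 => x.
  by rewrite !ord1 mxE eqxx mulr1n.
- apply/in_Lp2P => i j; apply: eq_sqi (s2 j) => x.
  by rewrite mxE.
- move=> ph tph; have gph := test_function_good tph.
  apply/matrixP => i j; rewrite !mxE.
  have [_ _] := int_by_parts gph (gt_cont gpsi) (@gt_dcont _ _ gpsi j) (gt_derive gpsi j).
  rewrite ord1 => e.
  under eq_int do rewrite mxE eqxx mulr1n.
  rewrite e opprK; apply: eq_int => x; by rewrite mxE.
Qed.

Lemma div_freeE (v : E -> E) (psi : E -> R) : test_function psi ->
  \tr (dist_grad v psi) = - \sum_j \int[mu]_x (v x 0 j * pderiv j psi x).
Proof.
by move=> tpsi; rewrite /mxtrace -sumrN; apply: eq_bigr => i _; rewrite mxE.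
Qed.

Section mollified.
Variables (c : R) (rho : E -> R) (drho : 'I_d -> E -> R).
Hypothesis hm : mollifier c rho drho.

Lemma moll_pderiv j x : pderiv j (fun y => rho (x - y)) = fun y => - drho j (x - y).
Proof.
by apply/funext => y; rewrite /pderiv; case: (rho_shift_is_derive hm j x y).
Qed.

Lemma moll_div_free (v : E -> E) x : sqv v ->
  div_free v -> \sum_j conv (drho j) (fun y => v y 0 j) x = 0.
Proof.
move=> hv /(_ _ (moll_test hm x)); rewrite div_freeE; last exact: (moll_test hm).
move=> e; rewrite -[RHS]e -sumrN; apply: eq_bigr => j _.
rewrite /conv moll_pderiv -intN; last first.
  have := sqi_shift_ig (moll_dkern hm j) x (hv j).
  move=> /igN; apply: eq_ig => y; by rewrite mulrN mulrC.
by apply: eq_int => y; rewrite mulrN opprK mulrC.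
Qed.

Lemma moll_weak_deriv j f psi : sqi mu f -> test_function psi ->
  \int[mu]_x (conv rho f x * pderiv j psi x) =
  - \int[mu]_x (conv (drho j) f x * psi x).
Proof.
move=> hf tpsi; have gpsi := test_function_good tpsi.
have [_ _] := int_by_parts gpsi (conv_cont (moll_kern hm) hf)
  (conv_cont (moll_dkern hm j) hf) (fun x => moll_is_derive hm j x hf).
by [].
Qed.

Definition mollv (v : E -> E) : E -> E := fun x => \row_i conv rho (fun y => v y 0 i) x.

Lemma mollvE v x i : mollv v x 0 i = conv rho (fun y => v y 0 i) x.
Proof. by rewrite mxE. Qed.

Lemma mollv_div_free (v : E -> E) : sqv v -> div_free v ->
  div_free (mollv v).
Proof.
move=> hv dv psi tpsi; rewrite div_freeE//.
have [s1 s2] := good_sqi (test_function_good tpsi).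
rewrite (eq_bigr (fun j => - \int[mu]_x (conv (drho j) (fun y => v y 0 j) x * psi x))).
  rewrite sumrN opprK -int_sum; last first.
    by move=> j; apply: sqi_mul => //; exact: (dmoll_sqi hm).
  rewrite -[RHS](int0 mu); apply: eq_int => x.
  by rewrite -mulr_suml moll_div_free// mul0r.
move=> j _; rewrite -moll_weak_deriv//; apply: eq_int => x.
by rewrite mollvE.
Qed.

(** Constancy in time makes the time-Lipschitz conditions hold with constant 0. In space, the sup
    bounds on the field and its gradient come from Cauchy-Schwarz with the $L^2$ norms of $\rho$ and
    $\partial_j\rho$, although $v$ is only in $L^2$. *)
Lemma mollv_test_field (T : R) (v : E -> E) : sqv v ->
  div_free v ->
  test_field T (fun=> mollv v)
    (fun=> fun x => \matrix_(i, j) conv (drho j) (fun y => v y 0 i) x).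
Proof.
move=> hv dv.
have L0 p m n : p != 0 -> Lpnorm p (fun x : E => (0 : 'M[R]_(m, n))) = 0%E.
  move=> p0; rewrite /Lpnorm (_ : _ \o _ = cst 0%E) ?Lnorm0//.
  apply/funext => x /=; rewrite /mxnorm2 /mxdot big1 ?sqrtr0// => i _.
  by rewrite big1// => j _; rewrite mxE mul0r.
split.
- have /choice[L HL] : forall i : 'I_d, exists L, 0 <= L /\ forall x y,
      `|conv rho (fun y => v y 0 i) x - conv rho (fun y => v y 0 i) y| <= L * `|x - y|.
    by move=> i; have [L L0' HL] := conv_lipschitz (moll_kern hm) (hv i); exists L.
  exists ((1 * d)%:R * \sum_i L i) => s t x y _ _.
  have SL : 0 <= \sum_i L i by apply: sumr_ge0 => i _; exact: (HL i).1.
  rewrite -mulrA; apply: mxnorm2_le; first by rewrite mulr_ge0// addr_ge0// mxnorm2_ge0.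
  move=> i j; rewrite ord1 !mxE; apply: le_trans ((HL j).2 x y) _.
  apply: ler_pM; [exact: (HL j).1|exact: normr_ge0| |].
    by rewrite (bigD1 j)//= lerDl; apply: sumr_ge0 => k _; exact: (HL k).1.
  rewrite (@le_trans _ _ (mxnorm2 (x - y)))//; last by rewrite lerDr.
  apply: rV_norm_le; first exact: mxnorm2_ge0.
  by move=> k; exact: coord_le_mxnorm2.
- move=> t _; split.
    apply/in_Lp2P => i j; rewrite ord1; apply: eq_sqi (moll_sqi hm (hv j)) => x.
    by rewrite mollvE.
  split.
  + apply: (@in_Lpy _ _ _ _ _ (\sum_i Num.sqrt (n2 mu rho) * Num.sqrt (n2 mu (fun x => v x 0 i)))).
      move=> i j; rewrite ord1 (_ : (fun x => _) = conv rho (fun y => v y 0 j)); last first.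
        by apply/funext => x; rewrite mollvE.
      by apply: (conv_meas (moll_kern hm)); exact: (hv j).1.
    move=> x i j; rewrite ord1 mollvE; apply: le_trans (conv_bound (moll_kern hm) x (hv j)) _.
    by rewrite (bigD1 j)//= lerDl; apply: sumr_ge0 => k _; rewrite mulr_ge0.
  + apply: (@in_Lpy _ _ _ _ _ (\sum_i \sum_j Num.sqrt (n2 mu (drho j)) * Num.sqrt (n2 mu (fun x => v x 0 i)))).
      move=> i j; rewrite (_ : (fun x => _) = conv (drho j) (fun y => v y 0 i)); last first.
        by apply/funext => x; rewrite mxE.
      by apply: (conv_meas (moll_dkern hm j)); exact: (hv i).1.
    move=> x i j; rewrite mxE; apply: le_trans (conv_bound (moll_dkern hm j) x (hv i)) _.
    rewrite (bigD1 i)//= (bigD1 j)//= -addrA lerDl; apply: addr_ge0.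
      by apply: sumr_ge0 => k _; rewrite mulr_ge0.
    by apply: sumr_ge0 => k _; apply: sumr_ge0 => l _; rewrite mulr_ge0.
  + move=> psi tpsi; apply/matrixP => i j; rewrite !mxE.
    rewrite (_ : \int[mu]_x _ = \int[mu]_x (conv rho (fun y => v y 0 i) x * pderiv j psi x)).
      by rewrite moll_weak_deriv// opprK; apply: eq_int => x; rewrite mxE.
    by apply: eq_int => x; rewrite mollvE.
- exists 0 => s t _ _; rewrite mul0r.
  split; under [X in Lpnorm _ X]eq_fun do rewrite subrr; by rewrite L0.
- by move=> t _; exact: mollv_div_free.
Qed.

End mollified.
End test_functions.

(** * Mollified transport identities at a fixed time *)

Section bilinear_convergence.
Context {d : measure_display} {X : measurableType d} {R : realType}.
Variable mu : {measure set X -> \bar R}.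

Lemma int_mul3_bound (g a b : X -> R) C : measurable_fun setT g ->
  (forall x, `|g x| <= C) -> sqi mu a -> sqi mu b ->
  `|\int[mu]_x (g x * (a x * b x))| <= C * (Num.sqrt (n2 mu a) * Num.sqrt (n2 mu b)).
Proof.
move=> mg gC ha hb; have hab := sqi_mul ha hb.
have ig1 := ig_bdd mg gC hab.
apply: le_trans (norm_int ig1) _.
have igab := ig_norm hab.
have e : (fun x => `|a x * b x|) = (fun x => `|a x| * `|b x|).
  by apply/funext => x; rewrite normrM.
apply: (@le_trans _ _ (C * \int[mu]_x `|a x * b x|)).
  rewrite -intZ//; apply: le_int.
  - exact: ig_norm.
  - exact: igZ.
  - by move=> x; rewrite normrM ler_wpM2r.
have C0 : 0 <= C := le_trans (normr_ge0 _) (gC point).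
by rewrite e ler_wpM2l//; exact: cs_abs.
Qed.

(** The weights [g n] are only uniformly bounded and may oscillate, so the conclusion is a
    difference tending to 0 rather than a limit. *)
Lemma l2_bil_cvg (a b g : nat -> X -> R) (a0 b0 : X -> R) C :
  (forall n, measurable_fun setT (g n)) -> (forall n x, `|g n x| <= C) ->
  (forall n, sqi mu (a n)) -> (forall n, sqi mu (b n)) -> sqi mu a0 -> sqi mu b0 ->
  n2 mu (fun x => a n x - a0 x) @[n --> \oo] --> 0 ->
  n2 mu (fun x => b n x - b0 x) @[n --> \oo] --> 0 ->
  \int[mu]_x (g n x * (a n x * b n x)) - \int[mu]_x (g n x * (a0 x * b0 x))
  @[n --> \oo] --> 0.
Proof.
move=> mg gC ha hb ha0 hb0 ca cb; apply: norm_cvg0.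
pose A n := Num.sqrt (n2 mu (fun x => a n x - a0 x)).
pose B n := Num.sqrt (n2 mu (fun x => b n x - b0 x)).
have cA : A @ \oo --> 0.
  by rewrite -sqrtr0; apply: continuous_cvg => //; exact: sqrt_continuous.
have cB : B @ \oo --> 0.
  by rewrite -sqrtr0; apply: continuous_cvg => //; exact: sqrt_continuous.
apply: (@cvg0_squeeze _ _ (fun n => C * (A n * B n) +
    C * (A n * Num.sqrt (n2 mu b0)) + C * (Num.sqrt (n2 mu a0) * B n))).
  move=> n; rewrite normr_ge0/=.
  have hda := sqiB (ha n) ha0; have hdb := sqiB (hb n) hb0.
  have i1 := ig_bdd (mg n) (gC n) (sqi_mul (ha n) (hb n)).
  have i2 := ig_bdd (mg n) (gC n) (sqi_mul ha0 hb0).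
  have j1 := ig_bdd (mg n) (gC n) (sqi_mul hda hdb).
  have j2 := ig_bdd (mg n) (gC n) (sqi_mul hda hb0).
  have j3 := ig_bdd (mg n) (gC n) (sqi_mul ha0 hdb).
  have -> : \int[mu]_x (g n x * (a n x * b n x)) - \int[mu]_x (g n x * (a0 x * b0 x)) =
     \int[mu]_x (g n x * ((a n x - a0 x) * (b n x - b0 x))) +
     \int[mu]_x (g n x * ((a n x - a0 x) * b0 x)) +
     \int[mu]_x (g n x * (a0 x * (b n x - b0 x))).
    rewrite -(intB i1 i2) -(intD j1 j2) -(intD (igD j1 j2) j3).
    by apply: eq_int => x; ring.
  apply: le_trans (ler_normD _ _) _; apply: lerD; last exact: int_mul3_bound.
  by apply: le_trans (ler_normD _ _) _; apply: lerD; exact: int_mul3_bound.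
have c1 : C * (A n * B n) @[n --> \oo] --> 0.
  by rewrite -(mulr0 C) -(mulr0 0); apply: cvgMl_tmp; exact: cvgM.
have c2 : C * (A n * Num.sqrt (n2 mu b0)) @[n --> \oo] --> 0.
  by rewrite -(mulr0 C) -(mul0r (Num.sqrt (n2 mu b0))); apply: cvgMl_tmp; apply: cvgMr_tmp.
have c3 : C * (Num.sqrt (n2 mu a0) * B n) @[n --> \oo] --> 0.
  by rewrite -(mulr0 C) -(mulr0 (Num.sqrt (n2 mu a0))); apply: cvgMl_tmp; apply: cvgMl_tmp.
have H := cvgD (cvgD c1 c2) c3; rewrite !addr0 in H; exact: H.
Qed.

End bilinear_convergence.

Section sums.
Context {R : realDomainType} {d : nat}.

Lemma sum2_add3_eq0 (f g h : 'I_d -> 'I_d -> R) :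
  (forall i j, f i j + g i j + h i j = 0) ->
  \sum_i \sum_j f i j + \sum_i \sum_j g i j + \sum_i \sum_j h i j = 0.
Proof.
move=> H; rewrite -!big_split; apply: big1 => i _ /=.
by rewrite -!big_split; apply: big1 => j _ /=.
Qed.

Lemma add_twice_eq0 (a b : R) : a = 0 -> a + b + b = 0 -> b = 0.
Proof. by move=> -> h; lra. Qed.

Lemma add3_eq0_opp (a b c : R) : c = 0 -> a + b + c = 0 -> a = - b.
Proof. by move=> -> h; lra. Qed.

End sums.

Section mollified_identities.
Context {R : realType} {d : nat}.
Local Notation E := 'rV[R]_d.
Local Notation mu := (lebesgue_rV R d).
Local Notation e_ j := (delta_mx 0 j : E).

(** Integration by parts against the test function $\rho(x-\cdot)$ transfers the derivative from the
    outer kernel to the inner one. *)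
Lemma moll_comm c rho drho j (f : E -> R) x : mollifier c rho drho -> sqi mu f ->
  conv (drho j) (conv rho f) x = conv rho (conv (drho j) f) x.
Proof.
move=> hm hf; have gpsi := test_function_good (moll_test hm x).
have [_ _] := int_by_parts gpsi (conv_cont (moll_kern hm) hf)
  (conv_cont (moll_dkern hm j) hf) (fun x => moll_is_derive hm j x hf).
rewrite (moll_pderiv hm) => e.
have h := moll_sqi hm hf; have h' := dmoll_sqi hm j hf.
apply: oppr_inj; rewrite {1}/conv -intN; last exact: (sqi_shift_ig (moll_dkern hm j)).
rewrite (_ : conv rho (conv (drho j) f) x = \int[mu]_y (conv (drho j) f y * rho (x - y))).
  by rewrite -e; apply: eq_int => y; rewrite mulrN mulrC.
by apply: eq_int => y; rewrite mulrC.
Qed.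

Section fields.
Variables (S : 'I_d -> 'I_d -> E -> R) (A : R) (V : E -> E).
Hypothesis mS : forall i j, measurable_fun setT (S i j).
Hypothesis SA : forall i j x, `|S i j x| <= A.
Hypothesis symS : forall i j x, S i j x = S j i x.
Hypothesis hV : sqv V.
Hypothesis divV : div_free V.
Hypothesis gradV : forall psi, test_function psi ->
  dist_symgrad V psi = \matrix_(i, j) \int[mu]_x (S i j x * psi x).

Let Vc i : E -> R := fun x => V x 0 i.

(** The distributional identity tested with $\rho(x-\cdot)$: after mollification the symmetric
    gradient is the function $\rho*S$ at every point, even though no such statement holds for the
    full gradient. *)
Lemma moll_symgrad c rho drho i j x : mollifier c rho drho ->
  conv (drho j) (Vc i) x + conv (drho i) (Vc j) x = 2 * conv rho (S i j) x.
Proof.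
move=> hm; have /matrixP/(_ i j) := gradV (moll_test hm x); rewrite /dist_symgrad.
have e k l : dist_grad V (fun y => rho (x - y)) k l = conv (drho l) (Vc k) x.
  rewrite /dist_grad mxE (moll_pderiv hm) /conv -intN.
    by apply: eq_int => y; rewrite mulrN opprK mulrC.
  have := igN (sqi_shift_ig (moll_dkern hm l) x (hV k)).
  by apply: eq_ig => y; rewrite mulrN mulrC.
move: (dist_grad V _) e => M e; rewrite !mxE !e => h.
rewrite (_ : conv rho (S i j) x = \int[mu]_y (S i j y * rho (x - y))); last first.
  by apply: eq_int => y; rewrite mulrC.
by rewrite -h mulrA divff ?mul1r.
Qed.

Section one_mollifier.
Variables (c c' : R) (rho rho' : E -> R) (drho drho' : 'I_d -> E -> R).
Hypothesis hm : mollifier c rho drho.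
Hypothesis hm' : mollifier c' rho' drho'.
Variable v : E -> E.
Hypothesis hv : sqv v.
Hypothesis divv : div_free v.

Let W i : E -> R := conv rho (Vc i).
Let dW i j : E -> R := conv (drho j) (Vc i).
Let ph i : E -> R := conv rho' (fun x => v x 0 i).
Let dph i j : E -> R := conv (drho' j) (fun x => v x 0 i).

(** Put $W=\rho*V$ and $\varphi=\rho'*v$. Since $\operatorname{div}W=0$, the product rule turns
    $\int\partial_j\varphi_iW_iW_j$ into $-\int\varphi_i\,\partial_jW_i\,W_j$. Since
    $\operatorname{div}\varphi=0$, the sum of $\int\varphi_i\,\partial_iW_j\,W_j$, a gradient of
    $|W|^2/2$ tested against $\varphi$, is zero. Adding it symmetrises $\partial_jW_i$ into
    $2(\rho*S)_{ij}$. *)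
Lemma moll_transport :
  \sum_i \sum_j \int[mu]_x (dph i j x * (W i x * W j x)) =
  - 2 * \sum_i \sum_j \int[mu]_x (conv rho (S i j) x * (W j x * ph i x)).
Proof.
have hW i : sqi mu (W i) := moll_sqi hm (hV i).
have hdW i j : sqi mu (dW i j) := dmoll_sqi hm j (hV i).
have hph i : sqi mu (ph i) := moll_sqi hm' (hv i).
have cW i : continuous (W i) := conv_cont (moll_kern hm) (hV i).
have cdW i j : continuous (dW i j) := conv_cont (moll_dkern hm j) (hV i).
have cph i : continuous (ph i) := conv_cont (moll_kern hm') (hv i).
have cdph i j : continuous (dph i j) := conv_cont (moll_dkern hm' j) (hv i).
have phC i x := conv_bound (moll_kern hm') x (hv i).
have dphC i j x := conv_bound (moll_dkern hm' j) x (hv i).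
have mph i := continuous_measurable_rV (cph i).
have mdph i j := continuous_measurable_rV (cdph i j).
have dWE i j x : is_derive x (e_ j) (W i) (dW i j x) := moll_is_derive hm j x (hV i).
have dphE i j x : is_derive x (e_ j) (ph i) (dph i j x) := moll_is_derive hm' j x (hv i).
have I1 i j k l : ig mu (fun x => dph i j x * (W k x * W l x)).
  exact: (ig_bdd (mdph i j) (dphC i j) (sqi_mul (hW k) (hW l))).
have I2 i k l m : ig mu (fun x => ph i x * (dW k l x * W m x)).
  exact: (ig_bdd (mph i) (phC i) (sqi_mul (hdW k l) (hW m))).
have I0 i k l : ig mu (fun x => ph i x * (W k x * W l x)).
  exact: (ig_bdd (mph i) (phC i) (sqi_mul (hW k) (hW l))).
(* the product rule for [ph i * W k * W l] in direction j *)
have main i j k l : \int[mu]_x (dph i j x * (W k x * W l x)) +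
    \int[mu]_x (ph i x * (dW k j x * W l x)) +
    \int[mu]_x (ph i x * (dW l j x * W k x)) = 0.
  pose F x := ph i x * (W k x * W l x).
  pose G x := dph i j x * (W k x * W l x) + ph i x * (dW k j x * W l x) +
    ph i x * (dW l j x * W k x).
  suff <- : \int[mu]_x G x = 0.
    by rewrite (intD (igD (I1 i j k l) (I2 i k j l)) (I2 i l j k)) (intD (I1 i j k l) (I2 i k j l)).
  apply: (@int_derive0 _ _ F G (e_ j)).
  - exact: I0.
  - move=> x; apply: is_derive_eq (is_deriveM (dphE i j x) (is_deriveM (dWE k j x) (dWE l j x))) _.
    transitivity (ph i x * (W k x * dW l j x + W l x * dW k j x) + (W k x * W l x) * dph i j x).
      by [].
    by rewrite /G; ring.
  - have c1 : continuous (fun x => dph i j x * (W k x * W l x)).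
      move=> x; apply: continuousM; first exact: cdph.
      by apply: continuousM; exact: cW.
    have c2 m q : continuous (fun x => ph i x * (dW m j x * W q x)).
      move=> x; apply: continuousM; first exact: cph.
      by apply: continuousM; [exact: cdW|exact: cW].
    by move=> x; exact: (continuousD (continuousD (c1 x) (c2 k l x)) (c2 l k x)).
  - exact: igD (igD (I1 _ _ _ _) (I2 _ _ _ _)) (I2 _ _ _ _).
have divW x : \sum_j dW j j x = 0 := moll_div_free hm x hV divV.
have divph x : \sum_j dph j j x = 0 := moll_div_free hm' x hv divv.
have z1 : \sum_i \sum_j \int[mu]_x (ph i x * (dW j j x * W i x)) = 0.
  apply: big1 => i _; rewrite -int_sum; last by move=> j; exact: I2.
  rewrite -[RHS](int0 mu); apply: eq_int => x.
  by rewrite -mulr_sumr -mulr_suml divW mul0r mulr0.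
have z2 : \sum_i \sum_j \int[mu]_x (dph i i x * (W j x * W j x)) = 0.
  rewrite exchange_big; apply: big1 => j _; rewrite -int_sum; last by move=> i; exact: I1.
  rewrite -[RHS](int0 mu); apply: eq_int => x.
  by rewrite -mulr_suml divph mul0r.
have z3 : \sum_i \sum_j \int[mu]_x (ph i x * (dW j i x * W j x)) = 0.
  have e := sum2_add3_eq0 (fun i j => main i i j j).
  by apply: (add_twice_eq0 z2 e).
have z4 : \sum_i \sum_j \int[mu]_x (dph i j x * (W i x * W j x)) =
    - \sum_i \sum_j \int[mu]_x (ph i x * (dW i j x * W j x)).
  have e := sum2_add3_eq0 (fun i j => main i j i j).
  by apply: (add3_eq0_opp z1 e).
apply: (etrans z4); rewrite mulNr; congr (- _).
rewrite -[LHS]addr0 -[in X in _ + X]z3 -big_split mulr_sumr; apply: eq_bigr => i _.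
rewrite -big_split mulr_sumr; apply: eq_bigr => j _ /=.
rewrite -(intD (I2 _ _ _ _) (I2 _ _ _ _)).
have mMS : measurable_fun setT (conv rho (S i j)) by exact: (conv_meas (moll_kern hm)).
have MSA x : `|conv rho (S i j) x| <= A by exact: (moll_bdd hm).
rewrite -intZ; last exact: (ig_bdd mMS MSA (sqi_mul (hW j) (hph i))).
apply: eq_int => x; rewrite -mulrDr -mulrDl (moll_symgrad i j x hm).
by ring.
Qed.

End one_mollifier.
End fields.
End mollified_identities.

Lemma cvg_eq {R : realType} (f g : nat -> R) (l : R) :
  f @ \oo --> l -> (forall n, f n = g n) -> g @ \oo --> l.
Proof. by move=> h /funext <-. Qed.

Lemma cvg_cst_eq {R : realType} (a l : R) : (fun=> a : R) @ \oo --> l -> a = l.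
Proof.
move=> h; have h' : (fun=> a : R) @ \oo --> a by exact: cvg_cst.
by rewrite -(cvg_lim (@Rhausdorff R) h) (cvg_lim (@Rhausdorff R) h').
Qed.

Lemma cvg0D {R : realType} (f g : nat -> R) :
  f @ \oo --> 0 -> g @ \oo --> 0 -> (fun n => f n + g n) @ \oo --> 0.
Proof. by move=> cf cg; rewrite -[0]addr0; exact: (cvgD cf cg). Qed.

Lemma cvg0Z {R : realType} (a : R) (f : nat -> R) :
  f @ \oo --> 0 -> (fun n => a * f n) @ \oo --> 0.
Proof. by move=> cf; rewrite -[0](mulr0 a); apply: cvgMl_tmp; exact: cf. Qed.

Lemma cvg0_sum {R : realType} (I : Type) (s : seq I) (f : I -> nat -> R) :
  (forall i, f i @ \oo --> 0) -> (fun n => \sum_(i <- s) f i n) @ \oo --> 0.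
Proof.
move=> H; elim: s => [|i s IH].
  rewrite (_ : (fun n => _) = fun=> 0); first exact: cvg_cst.
  by apply/funext => n; rewrite big_nil.
rewrite (_ : (fun n => _) = fun n => f i n + \sum_(j <- s) f j n).
  exact: cvg0D (H i) IH.
by apply/funext => n; rewrite big_cons.
Qed.

Lemma sum2_sym {R : realFieldType} (I : finType) (f g : I -> I -> R) :
  (forall i j, f i j + f j i = 2 * g i j) -> \sum_i \sum_j f i j = \sum_i \sum_j g i j.
Proof.
move=> H; suff : 2 * \sum_i \sum_j f i j = 2 * \sum_i \sum_j g i j by lra.
have -> : 2 * \sum_i \sum_j f i j = \sum_i \sum_j f i j + \sum_i \sum_j f j i.
  by rewrite [X in _ = _ + X]exchange_big; lra.
rewrite mulr_sumr -big_split; apply: eq_bigr => i _.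
by rewrite mulr_sumr -big_split; apply: eq_bigr => j _; exact: H.
Qed.

Lemma sqrtM_le_half {R : rcfType} (a b : R) : 0 <= a -> 0 <= b ->
  Num.sqrt a * Num.sqrt b <= (a + b) / 2.
Proof.
move=> a0 b0; have := sqr_ge0 (Num.sqrt a - Num.sqrt b).
by rewrite sqrrB !sqr_sqrtr// -mulr_natr; lra.
Qed.

(** * Removing the mollification at a fixed time *)

Section strain_limits.
Context {R : realType} {d : nat}.
Local Notation E := 'rV[R]_d.
Local Notation mu := (lebesgue_rV R d).

Variables (c : nat -> R) (rho : nat -> E -> R) (drho : nat -> 'I_d -> E -> R).
Hypothesis hm : forall m, mollifier (c m) (rho m) (drho m).
Hypothesis c0 : c @ \oo --> 0.

Lemma moll2_cvg f : sqi mu f ->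
  n2 mu (fun x => conv (rho m) (conv (rho m) f) x - f x) @[m --> \oo] --> 0.
Proof.
move=> hf; apply: (@cvg0_squeeze _ _ (fun m => 4 * n2 mu (fun x => conv (rho m) f x - f x))).
  move=> m; rewrite n2_ge0/=.
  have h1 := moll_sqi (hm m) hf; have hd := sqiB h1 hf.
  rewrite (_ : (fun x => conv (rho m) (conv (rho m) f) x - f x) =
    fun x => conv (rho m) (fun y => conv (rho m) f y - f y) x + (conv (rho m) f x - f x)).
    apply: le_trans (n2D_le (moll_sqi (hm m) hd) hd) _.
    have := moll_n2 (hm m) hd; lra.
  by apply/funext => x; rewrite (convB _ (moll_kern (hm m)) h1 hf); ring.
by rewrite -(mulr0 4); apply: cvgMl_tmp; exact: moll_cvg.
Qed.

Variables (S : 'I_d -> 'I_d -> E -> R) (A : R) (V : E -> E).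
Hypothesis mS : forall i j, measurable_fun setT (S i j).
Hypothesis SA : forall i j x, `|S i j x| <= A.
Hypothesis symS : forall i j x, S i j x = S j i x.
Hypothesis hV : sqv V.
Hypothesis divV : div_free V.
Hypothesis gradV : forall psi, test_function psi ->
  dist_symgrad V psi = \matrix_(i, j) \int[mu]_x (S i j x * psi x).

Let Vc i : E -> R := fun x => V x 0 i.

(** The kernel of $V$ in [moll_transport] is sent to a point mass while the kernel of $v$ stays
    fixed. On the right both $\rho_n*V$ and $\rho_n*S$ move: first $V$ is replaced under the bounded
    weight $\rho_n*S$, then the weight itself. *)
Lemma transport c' rho' drho' (v : E -> E) : mollifier c' rho' drho' ->
  sqv v -> div_free v ->
  \sum_i \sum_j \int[mu]_x (conv (drho' j) (fun x => v x 0 i) x * (Vc i x * Vc j x)) =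
  - 2 * \sum_i \sum_j \int[mu]_x (S i j x * (Vc j x * conv rho' (fun x => v x 0 i) x)).
Proof.
move=> hm' hv divv.
pose ph i := conv rho' (fun x => v x 0 i).
pose dph i j := conv (drho' j) (fun x => v x 0 i).
pose W n i := conv (rho n) (Vc i).
have hW n i : sqi mu (W n i) := moll_sqi (hm n) (hV i).
have hph i : sqi mu (ph i) := moll_sqi hm' (hv i).
pose L i j : R := \int[mu]_x (dph i j x * (Vc i x * Vc j x)).
pose Ln i j n : R := \int[mu]_x (dph i j x * (W n i x * W n j x)).
pose P i j : R := \int[mu]_x (S i j x * (Vc j x * ph i x)).
pose Pn i j n : R := \int[mu]_x (conv (rho n) (S i j) x * (W n j x * ph i x)).
have E n : \sum_i \sum_j Ln i j n = - 2 * \sum_i \sum_j Pn i j n.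
  exact: (moll_transport mS SA hV divV gradV (hm n) hm' hv divv).
have cL i j : Ln i j n - L i j @[n --> \oo] --> 0.
  apply: (@l2_bil_cvg _ _ _ mu (fun n => W n i) (fun n => W n j) (fun=> dph i j) (Vc i) (Vc j)
    (Num.sqrt (n2 mu (drho' j)) * Num.sqrt (n2 mu (fun x => v x 0 i)))).
  - by move=> _; exact: (conv_meas (moll_dkern hm' j) (hv i).1).
  - by move=> _ x; exact: (conv_bound (moll_dkern hm' j) x (hv i)).
  - by move=> n; exact: hW.
  - by move=> n; exact: hW.
  - exact: hV.
  - exact: hV.
  - exact: (moll_cvg hm c0 (hV i)).
  - exact: (moll_cvg hm c0 (hV j)).
have mMS n i j : measurable_fun setT (conv (rho n) (S i j)) := conv_meas (moll_kern (hm n)) (mS i j).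
have MSA n i j x : `|conv (rho n) (S i j) x| <= A := moll_bdd (hm n) x (mS i j) (SA i j).
have cP i j : Pn i j n - P i j @[n --> \oo] --> 0.
  have h1 : Pn i j n - \int[mu]_x (conv (rho n) (S i j) x * (Vc j x * ph i x)) @[n --> \oo] --> 0.
    apply: (@l2_bil_cvg _ _ _ mu (fun n => W n j) (fun=> ph i)
      (fun n => conv (rho n) (S i j)) (Vc j) (ph i) A).
    - by move=> n; exact: mMS.
    - by move=> n x; exact: MSA.
    - by move=> n; exact: hW.
    - by move=> _; exact: hph.
    - exact: hV.
    - exact: hph.
    - exact: (moll_cvg hm c0 (hV j)).
    - rewrite (_ : (fun=> _) = fun=> 0); first exact: cvg_cst.
      apply/funext => n; rewrite /n2 -[RHS](int0 mu); apply: eq_int => x.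
      by rewrite subrr expr0n.
  have h2 := moll_weak_cvg hm c0 (S := fun=> S i j) (fun=> mS i j) (fun=> SA i j) (hV j) (hph i).
  apply: (cvg_eq (cvg0D h1 h2)) => n.
  by rewrite /= addrA subrK.
have key : \sum_i \sum_j (Ln i j n - L i j) + 2 * \sum_i \sum_j (Pn i j n - P i j)
    @[n --> \oo] --> 0.
  apply: cvg0D; last apply: cvg0Z.
    by apply: cvg0_sum => i; apply: cvg0_sum => j; exact: cL.
  by apply: cvg0_sum => i; apply: cvg0_sum => j; exact: cP.
have ek n : \sum_i \sum_j (Ln i j n - L i j) + 2 * \sum_i \sum_j (Pn i j n - P i j) =
    - (\sum_i \sum_j L i j + 2 * \sum_i \sum_j P i j).
  have sB (f g : 'I_d -> 'I_d -> R) : \sum_i \sum_j (f i j - g i j) =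
      \sum_i \sum_j f i j - \sum_i \sum_j g i j.
    by rewrite -sumrB; apply: eq_bigr => i _; rewrite -sumrB.
  have ar (p q r s : R) : p = - 2 * q -> p - r + 2 * (q - s) = - (r + 2 * s) by move=> ->; ring.
  exact: (etrans (congr2 (fun p q => p + 2 * q) (sB (fun i j => Ln i j n) L)
    (sB (fun i j => Pn i j n) P)) (ar _ _ _ _ (E n))).
have : \sum_i \sum_j L i j + 2 * \sum_i \sum_j P i j = 0.
  apply: oppr_inj; rewrite oppr0; apply: (@cvg_unique _ (@Rhausdorff R) _ _) key.
  by rewrite (funext ek); exact: cvg_cst.
by rewrite mulNr => /eqP; rewrite addr_eq0 => /eqP.
Qed.

(** The form $T(a,a,\rho*\rho*w)$ of the overview; the derivative falls on the outer kernel, so that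
    $w$ need only be in $L^2$. *)
Definition trilin (m : nat) (a w : E -> E) : R :=
  \sum_i \sum_j \int[mu]_x
    (conv (drho m j) (conv (rho m) (fun x => w x 0 i)) x * (a x 0 i * a x 0 j)).

Lemma trilin_V m (v : E -> E) : sqv v -> div_free v ->
  trilin m V v = - 2 * \sum_i \sum_j
   \int[mu]_x (S i j x * (Vc j x * conv (rho m) (conv (rho m) (fun x => v x 0 i)) x)).
Proof.
move=> hv divv.
have e i : (fun x => mollv (rho m) v x 0 i) = conv (rho m) (fun x => v x 0 i).
  by apply/funext => x; rewrite mollvE.
have hMv i : sqi mu (fun x => mollv (rho m) v x 0 i).
  by rewrite e; exact: (moll_sqi (hm m) (hv i)).
have := transport (hm m) hMv (mollv_div_free (hm m) hv divv).
under eq_bigr do under eq_bigr do rewrite e.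
rewrite /trilin => ->; congr (_ * _); apply: eq_bigr => i _; apply: eq_bigr => j _.
by rewrite e.
Qed.

(** The derivative is commuted inwards until it falls on the kernel next to $V$. As $u_iu_j$ is
    symmetric, only the symmetric part of the mollified gradient contributes, and [moll_symgrad]
    identifies it. *)
Lemma trilin_uV m (u : E -> E) : sqv u ->
  trilin m u V = \sum_i \sum_j
   \int[mu]_x (conv (rho m) (conv (rho m) (S i j)) x * (u x 0 i * u x 0 j)).
Proof.
move=> hu.
have hdW i j : sqi mu (conv (drho m j) (Vc i)) := dmoll_sqi (hm m) j (hV i).
pose f i j : R := \int[mu]_x (conv (rho m) (conv (drho m j) (Vc i)) x * (u x 0 i * u x 0 j)).
have -> : trilin m u V = \sum_i \sum_j f i j.
  apply: eq_bigr => i _; apply: eq_bigr => j _; apply: eq_int => x.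
  by rewrite (moll_comm j x (hm m) (hV i)).
have iuu i j : ig mu (fun x => u x 0 i * u x 0 j) := sqi_mul (hu i) (hu j).
have fig i j k l : ig mu (fun x => conv (rho m) (conv (drho m j) (Vc i)) x * (u x 0 k * u x 0 l)).
  apply: ig_bdd (iuu k l) => [|x].
    exact: (conv_meas (moll_kern (hm m)) (hdW i j).1).
  exact: (conv_bound (moll_kern (hm m)) x (hdW i j)).
apply: sum2_sym => i j.
have fji : f j i = \int[mu]_x (conv (rho m) (conv (drho m i) (Vc j)) x * (u x 0 i * u x 0 j)).
  by apply: eq_int => x; rewrite (mulrC (u x 0 j)).
have MSA y : `|conv (rho m) (S i j) y| <= A := moll_bdd (hm m) y (mS i j) (SA i j).
have e x : conv (rho m) (fun y => conv (drho m j) (Vc i) y + conv (drho m i) (Vc j) y) x =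
    2 * conv (rho m) (conv (rho m) (S i j)) x.
  have k := bdd_shift_ig2 (moll_kern (hm m)) x (conv_meas (moll_kern (hm m)) (mS i j)) MSA.
  rewrite {1 2}/conv -(intZ 2 k); apply: eq_int => y.
  by rewrite (moll_symgrad hV gradV i j y (hm m)) mulrCA.
have ig2 : ig mu (fun x => conv (rho m) (conv (rho m) (S i j)) x * (u x 0 i * u x 0 j)).
  have mMS := conv_meas (moll_kern (hm m)) (mS i j).
  apply: ig_bdd (iuu i j) => [|x].
    exact: (conv_meas (moll_kern (hm m)) mMS).
  exact: (moll_bdd (hm m) x mMS MSA).
apply: (etrans (congr2 +%R (erefl (f i j)) fji)).
apply: (etrans (esym (intD (fig i j i j) (fig j i i j)))).
apply: (etrans _ (intZ 2 ig2)); apply: eq_int => x.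
by rewrite -mulrDl -(convD x (moll_kern (hm m)) (hdW i j) (hdW j i)) e -mulrA.
Qed.

Definition sform (a b : E -> E) : R :=
  \sum_i \sum_j \int[mu]_x (S i j x * (a x 0 i * b x 0 j)).

Let sig (a b : E -> E) i j : sqv a ->
  sqv b -> ig mu (fun x => S i j x * (a x 0 i * b x 0 j)).
Proof. by move=> ha hb; exact: (ig_bdd (mS i j) (SA i j) (sqi_mul (ha i) (hb j))). Qed.

Lemma sformC (a b : E -> E) : sform a b = sform b a.
Proof.
rewrite /sform exchange_big; apply: eq_bigr => i _; apply: eq_bigr => j _.
by apply: eq_int => x; rewrite symS (mulrC (a x 0 j)).
Qed.

Lemma sform_sub (a b : E -> E) : sqv a ->
  sqv b ->
  sform (fun x => a x - b x) (fun x => a x - b x) = sform a a - 2 * sform a b + sform b b.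
Proof.
move=> ha hb.
have -> : sform a a - 2 * sform a b + sform b b =
    sform a a + (- 1) * sform a b + (- 1) * sform b a + sform b b.
  by rewrite (sformC b a); ring.
rewrite /sform !mulr_sumr -!big_split; apply: eq_bigr => i _ /=.
rewrite !mulr_sumr -!big_split; apply: eq_bigr => j _ /=.
have i1 := sig i j ha ha; have i2 := igZ (- 1) (sig i j ha hb).
have i3 := igZ (- 1) (sig i j hb ha); have i4 := sig i j hb hb.
apply: (etrans _ (congr2 +%R (congr2 +%R (congr2 +%R (erefl _)
  (intZ (- 1) (sig i j ha hb))) (intZ (- 1) (sig i j hb ha))) (erefl _))).
apply: (etrans _ (congr2 +%R (congr2 +%R (intD i1 i2) (erefl _)) (erefl _))).
apply: (etrans _ (congr2 +%R (intD (igD i1 i2) i3) (erefl _))).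
apply: (etrans _ (intD (igD (igD i1 i2) i3) i4)).
by apply: eq_int => x; rewrite !mxE; ring.
Qed.

Let sum2_le (g : 'I_d -> 'I_d -> R) (p q : 'I_d -> R) B : 0 <= B ->
  (forall i j, `|g i j| <= B * ((p i + q j) / 2)) ->
  `|\sum_i \sum_j g i j| <= B * d%:R / 2 * (\sum_i p i + \sum_i q i).
Proof.
move=> B0 H; apply: le_trans (ler_norm_sum _ _ _) _.
apply: (@le_trans _ _ (\sum_i \sum_j B / 2 * (p i + q j))).
  apply: ler_sum => i _; apply: le_trans (ler_norm_sum _ _ _) _.
  by apply: ler_sum => j _; apply: le_trans (H i j) _; lra.
have -> : \sum_i \sum_j B / 2 * (p i + q j) =
    B / 2 * (\sum_i \sum_(j < d) p i + \sum_(i < d) \sum_j q j).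
  rewrite -big_split mulr_sumr; apply: eq_bigr => i _ /=.
  by rewrite -big_split mulr_sumr.
rewrite sumr_const card_ord -[X in _ * (_ + X)]mulr_natl.
under eq_bigr do rewrite sumr_const card_ord -mulr_natl.
by rewrite -mulr_sumr; lra.
Qed.

Definition en (a : E -> E) : R := \sum_i n2 mu (fun x => a x 0 i).

Hypothesis A0 : 0 <= A.

Lemma sform_le (a : E -> E) : sqv a ->
  `|sform a a| <= A * d%:R * en a.
Proof.
move=> ha; pose p i := n2 mu (fun x => a x 0 i).
have h : `|sform a a| <= A * d%:R / 2 * (\sum_i p i + \sum_i p i).
  apply: (sum2_le A0) => i j.
  apply: le_trans (int_mul3_bound (mS i j) (SA i j) (ha i) (ha j)) _.
  by apply: ler_wpM2l => //; apply: sqrtM_le_half; exact: n2_ge0.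
by apply: le_trans h _; rewrite /en -/p; lra.
Qed.

Lemma trilin_uV_le m (u : E -> E) : sqv u ->
  `|trilin m u V| <= A * d%:R * en u.
Proof.
move=> hu; rewrite (trilin_uV m hu); pose p i := n2 mu (fun x => u x 0 i).
have h : `|\sum_i \sum_j
   \int[mu]_x (conv (rho m) (conv (rho m) (S i j)) x * (u x 0 i * u x 0 j))| <=
   A * d%:R / 2 * (\sum_i p i + \sum_i p i).
  apply: (sum2_le A0) => i j.
  have mMS := conv_meas (moll_kern (hm m)) (mS i j).
  have MSA y : `|conv (rho m) (S i j) y| <= A := moll_bdd (hm m) y (mS i j) (SA i j).
  apply: le_trans (int_mul3_bound (conv_meas (moll_kern (hm m)) mMS)
    (fun x => moll_bdd (hm m) x mMS MSA) (hu i) (hu j)) _.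
  by apply: ler_wpM2l => //; apply: sqrtM_le_half; exact: n2_ge0.
by apply: le_trans h _; rewrite /en -/p; lra.
Qed.

Lemma trilin_V_le m (v : E -> E) : sqv v -> div_free v ->
  `|trilin m V v| <= A * d%:R * (en V + en v).
Proof.
move=> hv divv; rewrite (trilin_V m hv divv).
pose p i := n2 mu (fun x => V x 0 i); pose q i := n2 mu (fun x => v x 0 i).
have h : `|\sum_i \sum_j \int[mu]_x (S i j x *
   (Vc j x * conv (rho m) (conv (rho m) (fun x => v x 0 i)) x))| <=
   A * d%:R / 2 * (\sum_i q i + \sum_i p i).
  apply: (sum2_le A0) => i j.
  have h1 := moll_sqi (hm m) (hv i); have h2 := moll_sqi (hm m) h1.
  apply: le_trans (int_mul3_bound (mS i j) (SA i j) (hV j) h2) _.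
  apply: ler_wpM2l => //; rewrite mulrC.
  apply: (@le_trans _ _ (Num.sqrt (q i) * Num.sqrt (p j))).
    apply: ler_wpM2r; first exact: sqrtr_ge0.
    rewrite ler_sqrt; last exact: n2_ge0.
    exact: le_trans (moll_n2 (hm m) h1) (moll_n2 (hm m) (hv i)).
  by apply: sqrtM_le_half; exact: n2_ge0.
rewrite normrM normrN (ger0_norm (ler0n _ 2)).
have -> : en V = \sum_i p i by [].
have -> : en v = \sum_i q i by [].
lra.
Qed.

Let sum2B (I : finType) (f g : I -> I -> R) :
  \sum_i \sum_j f i j - \sum_i \sum_j g i j = \sum_i \sum_j (f i j - g i j).
Proof. by rewrite -sumrB; apply: eq_bigr => i _; rewrite -sumrB. Qed.

Lemma trilin_V_cvg (v : E -> E) : sqv v -> div_free v ->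
  trilin m V v + 2 * sform v V @[m --> \oo] --> 0.
Proof.
move=> hv divv.
pose P i j := \int[mu]_x (S i j x * (Vc j x * v x 0 i)).
pose Pm i j m := \int[mu]_x (S i j x *
  (Vc j x * conv (rho m) (conv (rho m) (fun x => v x 0 i)) x)).
have cP i j : Pm i j m - P i j @[m --> \oo] --> 0.
  apply: (@l2_bil_cvg _ _ _ mu (fun=> Vc j)
    (fun m => conv (rho m) (conv (rho m) (fun x => v x 0 i)))
    (fun=> S i j) (Vc j) (fun x => v x 0 i) A).
  - by move=> _; exact: mS.
  - by move=> _ x; exact: SA.
  - by move=> _; exact: hV.
  - by move=> m; exact: (moll_sqi (hm m) (moll_sqi (hm m) (hv i))).
  - exact: hV.
  - exact: hv.
  - rewrite (_ : (fun=> _) = fun=> 0); first exact: cvg_cst.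
    apply/funext => n; rewrite /n2 -[RHS](int0 mu); apply: eq_int => x.
    by rewrite subrr expr0n.
  - exact: moll2_cvg (hv i).
have c1 : - 2 * \sum_i \sum_j (Pm i j m - P i j) @[m --> \oo] --> 0.
  by apply: cvg0Z; apply: cvg0_sum => i; apply: cvg0_sum => j; exact: cP.
apply: (cvg_eq c1) => m; rewrite (trilin_V m hv divv).
have -> : sform v V = \sum_i \sum_j P i j.
  rewrite /sform; apply: eq_bigr => i _; apply: eq_bigr => j _; apply: eq_int => x.
  by rewrite (mulrC (v x 0 i)).
have ar (p q : R) : - 2 * (p - q) = - 2 * p + 2 * q by ring.
exact: (etrans (congr1 ( *%R (- 2)) (esym (sum2B (fun i j => Pm i j m) P))) (ar _ _)).
Qed.

Lemma trilin_uV_cvg (u : E -> E) : sqv u ->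
  trilin m u V - sform u u @[m --> \oo] --> 0.
Proof.
move=> hu.
pose P i j := \int[mu]_x (S i j x * (u x 0 i * u x 0 j)).
pose Pm i j m := \int[mu]_x (conv (rho m) (conv (rho m) (S i j)) x * (u x 0 i * u x 0 j)).
have cP i j : Pm i j m - P i j @[m --> \oo] --> 0.
  have mMS m : measurable_fun setT (conv (rho m) (S i j)) :=
    conv_meas (moll_kern (hm m)) (mS i j).
  have MSA m y : `|conv (rho m) (S i j) y| <= A := moll_bdd (hm m) y (mS i j) (SA i j).
  have h1 := moll_weak_cvg hm c0 mMS MSA (hu i) (hu j).
  have h2 := moll_weak_cvg hm c0 (S := fun=> S i j) (fun=> mS i j) (fun=> SA i j) (hu i) (hu j).
  by apply: (cvg_eq (cvg0D h1 h2)) => m; rewrite /= addrA subrK.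
have c1 : \sum_i \sum_j (Pm i j m - P i j) @[m --> \oo] --> 0.
  by apply: cvg0_sum => i; apply: cvg0_sum => j; exact: cP.
apply: (cvg_eq c1) => m; rewrite (trilin_uV m hu).
exact: (esym (sum2B (fun i j => Pm i j m) P)).
Qed.

Lemma sform_V : sform V V = 0.
Proof.
(* [trilin m V V] tends both to [- 2 sform V V] and to [sform V V] *)
have h := cvg0D (trilin_V_cvg hV divV) (cvg0Z (- 1) (trilin_uV_cvg hV)).
have h3 : (fun n : nat => 3 * sform V V) @ \oo --> 0 by apply: (cvg_eq h) => m /=; ring.
by have := cvg_cst_eq h3; lra.
Qed.

Lemma trilin_cvg (u : E -> E) : sqv u -> div_free u ->
  trilin m V u + trilin m u V @[m --> \oo] --> sform (fun x => u x - V x) (fun x => u x - V x).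
Proof.
move=> hu divu; have h := cvg0D (trilin_V_cvg hu divu) (trilin_uV_cvg hu).
pose l := sform (fun x => u x - V x) (fun x => u x - V x).
have h' : (fun m => l + (trilin m V u + 2 * sform u V + (trilin m u V - sform u u))) @ \oo --> l.
  by rewrite -[X in _ --> X]addr0; apply: cvgD h; exact: cvg_cst.
apply: (cvg_eq h') => m.
by rewrite /l (sform_sub hu hV) sform_V; ring.
Qed.

(** The bound is uniform in [m] and will dominate the time integrals. The factor 3 collects $2B$
    from [trilin_V_le] and $B$ from [trilin_uV_le]. *)
Lemma trilin_le m (u : E -> E) B : sqv u -> div_free u ->
  en u <= B -> en V <= B ->
  `|trilin m V u + trilin m u V| <= A * (3 * d%:R * B).
Proof.
move=> hu divu uB VB; apply: le_trans (ler_normD _ _) _.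
have h1 := trilin_V_le m hu divu; have h2 := trilin_uV_le m hu.
have Ad : 0 <= A * d%:R by rewrite mulr_ge0.
apply: le_trans (lerD h1 h2) _; rewrite -mulrDr.
rewrite (_ : A * (3 * d%:R * B) = A * d%:R * (3 * B)); last by ring.
by apply: ler_wpM2l => //; lra.
Qed.

End strain_limits.

(** * Integrals over time *)

Section almost_everywhere.
Context {d : measure_display} {X : measurableType d} {R : realType}.
Variable mu : {measure set X -> \bar R}.

Lemma dct_ae (F : nat -> X -> R) (f g : X -> R) : (forall n, measurable_fun setT (F n)) ->
  measurable_fun setT f -> ig mu g ->
  (\forall x \ae mu, F n x @[n --> \oo] --> f x) ->
  (\forall x \ae mu, forall n, `|F n x| <= g x) ->
  \int[mu]_x F n x @[n --> \oo] --> \int[mu]_x f x.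
Proof.
move=> mF mf hg Ff Fg.
have [|||||hf _ h3] := @dominated_convergence _ _ _ mu setT measurableT
  (fun n x => (F n x)%:E) (EFin \o f) (EFin \o g).
- by move=> n; exact/measurable_EFinP.
- exact/measurable_EFinP.
- by apply: filterS Ff => x h _; apply: cvg_EFin; [exact: nearW|exact: h].
- exact: hg.
- by apply: filterS Fg => x h n _ /=; rewrite lee_fin.
by apply: fine_cvg; rewrite fineK; last exact: integrable_fin_num.
Qed.

Lemma eq_int_ae (f g : X -> R) : measurable_fun setT f -> measurable_fun setT g ->
  (\forall x \ae mu, f x = g x) -> \int[mu]_x f x = \int[mu]_x g x.
Proof.
move=> mf mg fg; congr fine; apply: ae_eq_integral => //; try exact/measurable_EFinP.
by apply: filterS fg => x -> _.
Qed.

Lemma ig_le_ae (f g : X -> R) : measurable_fun setT f -> ig mu g ->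
  (\forall x \ae mu, `|f x| <= g x) -> ig mu f.
Proof.
move=> mf hg fg; have [/measurable_EFinP mg _] := integrableP _ _ _ hg.
apply/integrableP; split; first exact/measurable_EFinP.
apply: le_lt_trans (integrableP _ _ _ hg).2.
apply: ae_ge0_le_integral => //.
- by apply/measurable_EFinP; exact: measurableT_comp.
- by apply/measurable_EFinP; exact: measurableT_comp.
- by apply: filterS fg => x h _; rewrite lee_fin (le_trans h)// ler_norm.
Qed.

End almost_everywhere.

Lemma cvg_geo2 {R : realType} (C : R) : (fun n : nat => C / 2 ^+ n) @ \oo --> 0.
Proof.
apply: cvg0Z; have h : `|2^-1 : R| < 1 by rewrite ger0_norm ?invr_ge0// invf_lt1 ?ltr1n.
by apply: (cvg_eq (cvg_expr h)) => n; rewrite exprVn.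
Qed.

Section time_integral.
Context {R : realType}.
Local Notation lam := (@lebesgue_measure R).

Definition tind (s t : R) (r : R) : R := \1_`]s, t] r.

Lemma tindE s t r : tind s t r = (s < r <= t)%R%:R.
Proof. by rewrite /tind indicE mem_setE in_itv. Qed.

Lemma tind_ge0 s t r : 0 <= tind s t r.
Proof. by rewrite tindE ler0n. Qed.

Lemma tind_le1 s t r : `|tind s t r| <= 1.
Proof. by rewrite tindE; case: (_ && _); rewrite ?normr0 ?normr1 ?ler01. Qed.

Lemma measurable_tind s t : measurable_fun setT (tind s t : measurableTypeR R -> R).
Proof. exact: measurable_indic. Qed.

Lemma ig_tind s t : ig lam (tind s t).
Proof.
have h : (lam (`]s, t]%classic : set R) < +oo)%E.
  by rewrite lebesgue_measure_itv/=; case: ifP => _; rewrite ?ltry// -EFinB ltry.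
by apply: (ig_indic _ h).
Qed.

Lemma int_tind s t : s <= t -> \int[lam]_r tind s t r = t - s.
Proof.
move=> st; have h : fine (lam (`]s, t]%classic : set R)) = t - s.
  rewrite lebesgue_measure_itv/= lte_fin.
  by case: ltgtP st => // -> _; rewrite /= subrr.
by rewrite -h; apply: int_indic.
Qed.

(** The indicator is placed in the integrand so that the lemmas on whole-space integrals apply; the
    half-open interval makes adjacent integrals add up exactly. *)
Definition tint (F : R -> R) s t := \int[lam]_r (tind s t r * F r).

Lemma ig_tind_mul (F : R -> R) K s t : measurable_fun setT (F : measurableTypeR R -> R) ->
  (forall r, `|F r| <= K) -> ig lam (fun r => tind s t r * F r).
Proof.
move=> mF FK; apply: eq_ig (ig_bdd mF FK (ig_tind s t)) => r.
by rewrite mulrC.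
Qed.

Lemma tint_split (F : R -> R) s m t : s <= m -> m <= t ->
  ig lam (fun r => tind s m r * F r) -> ig lam (fun r => tind m t r * F r) ->
  tint F s t = tint F s m + tint F m t.
Proof.
move=> sm mt h1 h2; rewrite /tint -(intD h1 h2); apply: eq_int => r.
rewrite -mulrDl; congr (_ * _); rewrite !tindE.
have [sr|rs] := ltP s r; have [rt|tr] := leP r t; have [rm|mr] := leP r m => //=;
 rewrite ?addr0 ?add0r//; lra.
Qed.

Lemma tint_bound (F : R -> R) K s t : s <= t -> ig lam (fun r => tind s t r * F r) ->
  (forall r, s <= r -> r <= t -> `|F r| <= K) -> `|tint F s t| <= K * (t - s).
Proof.
move=> st hF FK; apply: le_trans (norm_int hF) _.
rewrite -(int_tind st) -(intZ K (ig_tind s t)).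
apply: (le_int (ig_norm hF) (igZ K (ig_tind s t))) => r.
rewrite normrM (ger0_norm (tind_ge0 _ _ _)) mulrC tindE.
have [/andP[sr rt]|_] := boolP (s < r <= t); last by rewrite !mulr0.
by rewrite !mulr1 FK// ltW.
Qed.

(** Bisecting $n$ times gives $2^n$ increments of size $K(t-s)^2/4^n$, with sum $K(t-s)^2/2^n$. This
    replaces differentiation in time in the energy identity. *)
Lemma quadratic_increments_cst (G : R -> R) K T :
  (forall s t, 0 <= s -> s <= t -> t <= T -> `|G t - G s| <= K * (t - s) ^+ 2) ->
  forall t, 0 <= t -> t <= T -> G t = G 0.
Proof.
move=> H.
have halve n : forall s t, 0 <= s -> s <= t -> t <= T ->
    `|G t - G s| <= K * (t - s) ^+ 2 / 2 ^+ n.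
  elim: n => [|n IH] s t s0 st tT; first by rewrite expr0 divr1 H.
  pose m := (s + t) / 2.
  have sm : s <= m by rewrite /m; lra.
  have mt : m <= t by rewrite /m; lra.
  have h1 := IH s m s0 sm (le_trans mt tT).
  have h2 := IH m t (le_trans s0 sm) mt tT.
  have -> : G t - G s = (G t - G m) + (G m - G s) by ring.
  apply: le_trans (ler_normD _ _) _; apply: le_trans (lerD h2 h1) _.
  have n0 : (2 : R) ^+ n != 0 by rewrite expf_neq0.
  rewrite (exprS 2 n) le_eqVlt; apply/orP; left; apply/eqP; rewrite /m.
  by move: (2 ^+ n) n0 => q q0; field.
move=> t t0 tT; apply/eqP; rewrite -subr_eq0 -normr_le0.
have c := cvg_geo2 (K * (t - 0) ^+ 2).
by apply: (cvgr_to_ge c); apply: nearW => n; exact: halve.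
Qed.

(** A property valid almost everywhere on $]0,T[$ holds along a sequence converging to any
    prescribed point of $[0,T]$; identities between continuous functions then extend to every
    time. *)
Lemma ae_dense (P : R -> Prop) T t : 0 < T -> 0 <= t -> t <= T ->
  (\forall r \ae lam, r \in `]0, T[ -> P r) ->
  exists tau : nat -> R, [/\ forall n, 0 < tau n < T, forall n, P (tau n) &
    tau @ \oo --> t].
Proof.
move=> T0 t0 tT [N [mN N0 hN]].
have near_t (e : R) : 0 < e -> exists r, [/\ 0 < r < T, P r & `|r - t| <= e].
  move=> e0; apply: contrapT => hno.
  (* Cut down to $]0,T[$, the interval around $t$ keeps positive length even when $t$ is an
     endpoint, so it cannot be contained in a null set. *)
  pose a := Num.max 0 (t - e); pose b := Num.min T (t + e).
  have ab : a < b by rewrite /a /b lt_min !gt_max; apply/andP; split; apply/andP; split; lra.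
  have sub : `]a, b[%classic `<=` N.
    move=> r /=; rewrite in_itv/= gt_max lt_min => /andP[/andP[r0 r1] /andP[r2 r3]].
    apply: hN => /= hP; apply: hno; exists r; split.
    - by rewrite r0 r2.
    - by apply: hP; rewrite in_itv/= r0 r2.
    - by rewrite ler_norml; apply/andP; split; lra.
  have : (lam `]a, b[%classic <= lam N)%E by apply: le_measure; rewrite ?inE.
  by rewrite N0 lebesgue_measure_itv/= lte_fin ab -EFinB lee_fin; lra.
have /choice[tau htau] (n : nat) : exists r, [/\ 0 < r < T, P r & `|r - t| <= n.+1%:R^-1].
  exact: near_t.
exists tau; split; [by move=> n; case: (htau n)..|].
have h : (fun n => tau n - t) @ \oo --> 0.
  apply: norm_cvg0; apply: (cvg0_squeeze (v := fun n : nat => n.+1%:R^-1)).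
    by move=> n; rewrite normr_ge0/=; case: (htau n).
  exact: cvg_harmonic.
have h' : (fun n => t + (tau n - t)) @ \oo --> t.
  by rewrite -[X in _ --> X]addr0; apply: cvgD h; exact: cvg_cst.
by apply: (cvg_eq h') => n; rewrite addrC subrK.
Qed.

End time_integral.

(** * Gronwall's lemma with an integrable coefficient *)

Section gronwall.
Context {R : realType}.
Local Notation lam := (@lebesgue_measure R).

Lemma ig_tind_mul_ig (F : R -> R) s t : ig lam F -> ig lam (fun r => tind s t r * F r).
Proof. by move=> hF; exact: ig_bdd (measurable_tind s t) (tind_le1 s t) hF. Qed.

(** Absolute continuity of the integral: the part of $a$ above a level $N$ has small integral, and
    the rest is bounded. *)
Lemma tint_small (a : R -> R) (e : R) : ig lam a -> (forall r, 0 <= a r) -> 0 < e ->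
  exists2 del, 0 < del & forall s t, s <= t -> t - s <= del -> tint a s t <= e.
Proof.
move=> ha a0 e0; have ma := igM ha.
pose F (n : nat) (r : R) := if n%:R < a r then a r else 0.
have F0 n r : 0 <= F n r by rewrite /F; case: ifP.
have Fa n r : F n r <= a r by rewrite /F; case: ifP.
have mF n : measurable_fun setT (F n : measurableTypeR R -> R).
  by apply: measurable_fun_ifT => //; apply: measurable_fun_ltr.
have c : \int[lam]_r F n r @[n --> \oo] --> \int[lam]_(r in setT) (0 : R).
  apply: (@dct_ae _ _ _ lam F (fun=> 0) a) => //.
  - apply: aeW => r; apply: cvg_near_cst; near=> n.
    rewrite /F ifF//; apply/negbTE; rewrite -leNgt; near: n.
    exact: nbhs_infty_ger.
  - by apply: aeW => r n; rewrite ger0_norm.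
rewrite int0 in c.
have [N hN] : exists N : nat, \int[lam]_r F N r <= e / 2.
  have h : \forall n \near \oo, \int[lam]_r F n r <= e / 2.
    by apply: (cvgr_le _ c); rewrite divr_gt0.
  by have [N _ hN] := h; exists N; apply: hN => /=.
have hFi : ig lam (F N) by apply: (ig_le (mF N) ha) => r; rewrite ger0_norm.
(* On the interval $a\le(N+1)+F_N$, and each summand contributes at most $e/2$. Taking $N+1$ rather
   than $N$ avoids dividing by 0. *)
exists (e / 2 / N.+1%:R); first by rewrite !divr_gt0.
move=> s t st hst.
apply: (@le_trans _ _ (\int[lam]_r (N.+1%:R * tind s t r + F N r))).
  apply: (le_int (ig_tind_mul_ig s t ha) (igD (igZ _ (ig_tind s t)) hFi)) => r.
  rewrite tindE; case: (_ && _); rewrite ?mul0r ?mulr0 ?add0r// mul1r mulr1 /F.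
  case: ltP => [_|h]; first by rewrite lerDr.
  by rewrite addr0 (le_trans h)// ler_nat.
rewrite (intD (igZ _ (ig_tind s t)) hFi) (intZ _ (ig_tind s t)) (int_tind st).
rewrite [leRHS](splitr e) lerD//.
by rewrite mulrC -ler_pdivlMr.
Unshelve. all: by end_near.
Qed.

(** Since $a$ is only integrable, time is cut into steps of length [del] on which $k\int a\le1/2$.
    Once $y$ vanishes up to $n$ steps, the inequality halves any bound on the next step, and
    iterating from $C$ gives 0. *)
Lemma gronwall0 (a y : R -> R) C T k : 0 <= k -> ig lam a -> (forall r, 0 <= a r) ->
  measurable_fun setT (y : measurableTypeR R -> R) -> (forall r, 0 <= y r <= C) ->
  (forall t, 0 <= t -> t <= T -> y t <= k * tint (fun r => a r * y r) 0 t) ->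
  forall t, 0 <= t -> t <= T -> y t = 0.
Proof.
move=> k0 ha a0 my yC yk.
(* Chosen so that $k/(2(k+1))\le1/2$, including the case $k=0$. *)
have e0 : 0 < (2 * (k + 1))^-1 by rewrite invr_gt0; lra.
have [del del0 hdel] := tint_small ha a0 e0.
have C0 : 0 <= C by have /andP[h1 h2] := yC 0; exact: le_trans h1 h2.
have y0 r : 0 <= y r by have /andP[] := yC r.
have yn r : `|y r| <= C by rewrite ger0_norm//; have /andP[] := yC r.
have hay : ig lam (fun r => a r * y r).
  by apply: eq_ig (ig_bdd my yn ha) => r; rewrite mulrC.
have claim (n : nat) : forall t, 0 <= t -> t <= T -> t <= n%:R * del -> y t = 0.
  elim: n => [|n IH] t t0 tT tn.
    have t00 : t = 0 by apply/eqP; rewrite eq_le t0 andbT; move: tn; rewrite mul0r.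
    apply/eqP; rewrite eq_le y0 andbT; apply: le_trans (yk t t0 tT) _.
    rewrite t00 /tint (_ : \int[lam]_r _ = 0) ?mulr0//.
    rewrite -[RHS](int0 lam); apply: eq_int => r; rewrite tindE.
    by have [h1|] := ltP 0 r; rewrite /= ?mul0r// leNgt h1 mul0r.
  (* each application of the inequality halves the bound *)
  have bd j : forall t, 0 <= t -> t <= T -> t <= n.+1%:R * del -> y t <= C / 2 ^+ j.
    elim: j => [|j IHj] u u0 uT un; first by rewrite divr1; have /andP[] := yC u.
    have Cj : 0 <= C / 2 ^+ j by rewrite divr_ge0.
    have [un'|nu] := leP u (n%:R * del).
      by rewrite (IH u u0 uT un') divr_ge0.
    apply: le_trans (yk u u0 uT) _.
    have h : tint (fun r => a r * y r) 0 u <= C / 2 ^+ j * tint a (n%:R * del) u.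
      rewrite -intZ; last exact: ig_tind_mul_ig.
      apply: (le_int (ig_tind_mul_ig 0 u hay) (igZ _ (ig_tind_mul_ig _ _ ha))) => r.
      rewrite !tindE; have [/andP[r0 ru]|_] := boolP (0 < r <= u); last first.
        by rewrite mul0r mulr_ge0// mulr_ge0.
      have [nr|rn] := ltP (n%:R * del) r; rewrite /= ?ru ?mul1r.
        by rewrite mulrC ler_wpM2r// IHj//; [exact: ltW|exact: le_trans uT|exact: le_trans un].
      by rewrite (IH r (ltW r0) (le_trans ru uT) rn) mulr0 mul0r mulr0.
    have h2 : tint a (n%:R * del) u <= (2 * (k + 1))^-1.
      by apply: hdel; [exact: ltW|move: un; rewrite -natr1 mulrDl mul1r; lra].
    have h3 := le_trans h (ler_wpM2l Cj h2).
    apply: le_trans (ler_wpM2l k0 h3) _.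
    have h4 : k / (2 * (k + 1)) <= 2^-1 by rewrite ler_pdivrMr; lra.
    have -> : C / 2 ^+ j.+1 = C / 2 ^+ j * 2^-1 by rewrite exprSr invfM mulrA.
    by rewrite mulrCA; exact: ler_wpM2l.
  apply/eqP; rewrite eq_le y0 andbT.
  by apply: (cvgr_to_ge (cvg_geo2 C)); apply: nearW => j; exact: bd.
move=> t t0 tT; apply: (claim (Num.bound (t / del))) => //.
rewrite -ler_pdivrMr//; apply/ltW; apply: archi_boundP.
by rewrite divr_ge0// ltW.
Qed.

End gronwall.

Section clamp.
Context {R : realType}.

Definition clamp (T t : R) : R := Num.max 0 (Num.min t T).

Lemma clamp_itv T t : 0 <= T -> clamp T t \in `[0, T].
Proof. by move=> T0; rewrite in_itv/= le_max lexx /= ge_max T0 ge_min lexx orbT. Qed.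

Lemma clamp_id T t : 0 <= t -> t <= T -> clamp T t = t.
Proof. by move=> t0 tT; rewrite /clamp min_l// max_r. Qed.

Lemma continuous_clamp T : continuous (clamp T).
Proof.
move=> t; apply: (@continuous_max R R (fun=> 0) (fun t => Num.min t T)).
  exact: cst_continuous.
by apply: continuous_min; [exact: cvg_id|exact: cst_continuous].
Qed.

Lemma within_clamp T (f : R -> R) : 0 <= T -> {within `[0, T], continuous f} ->
  continuous (fun t => f (clamp T t)).
Proof.
move=> T0 /subspace_continuousP cf t.
have h := cf (clamp T t) (clamp_itv t T0).
have hc : clamp T r @[r --> t] --> within `[0, T] (nbhs (clamp T t)).
  move=> A hA; have h2 := @continuous_clamp T t _ hA.
  by apply: (@filterS _ (nbhs t) _ _ _ _ h2) => s /(_ (clamp_itv s T0)).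
exact: (cvg_comp _ _ hc h).
Qed.

Lemma cont_seq (f : R -> R) (tau : nat -> R) t : continuous f ->
  tau @ \oo --> t -> (fun n => f (tau n)) @ \oo --> f t.
Proof. by move=> cf ct; exact: (continuous_cvg _ (cf t) ct). Qed.

Lemma seq_cont (f : R -> R) :
  (forall tau t, tau @ \oo --> t -> (fun n : nat => f (tau n)) @ \oo --> f t) -> continuous f.
Proof. by move=> H t; apply/(@cvg_nbhsP _ R^o) => tau; exact: H. Qed.

End clamp.

(** * Weakly continuous fields *)

Lemma cvg_sub0_trans {R : realType} (f g : nat -> R) (l : R) :
  (fun n => f n - g n) @ \oo --> 0 -> g @ \oo --> l -> f @ \oo --> l.
Proof.
move=> h1 h2; have h : (fun n => f n - g n + g n) @ \oo --> 0 + l by exact: (cvgD h1 h2).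
by rewrite add0r in h; apply: (cvg_eq h) => n; rewrite subrK.
Qed.

Section weakly_continuous_fields.
Context {R : realType} {d : nat}.
Local Notation E := 'rV[R]_d.
Local Notation mu := (lebesgue_rV R d).

Definition wcts (B : R) (a : R -> E -> R) :=
  [/\ forall t, sqi mu (a t), forall t, n2 mu (a t) <= B &
      forall w, sqi mu w -> continuous (fun t => \int[mu]_x (a t x * w x))].

Lemma wcts_conv_cont B a c k x : wcts B a -> kern c k -> continuous (fun t => conv k (a t) x).
Proof.
move=> [_ _ ca] hk; have h := ca _ (kern_shift_sqi hk x).
rewrite (_ : (fun t => conv k (a t) x) = fun t => \int[mu]_y (a t y * k (x - y))) //.
by apply/funext => t; apply: eq_int => y; rewrite mulrC.
Qed.

Lemma wcts_conv_bound B a c k t x : wcts B a -> kern c k ->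
  `|conv k (a t) x| <= Num.sqrt (n2 mu k) * Num.sqrt B.
Proof.
move=> [sa Ba _] hk; apply: le_trans (conv_bound hk x (sa t)) _.
apply: ler_wpM2l; first exact: sqrtr_ge0.
by rewrite ler_sqrt// (le_trans (n2_ge0 _ _) (Ba t)).
Qed.

Variables (c : nat -> R) (rho : nat -> E -> R) (drho : nat -> 'I_d -> E -> R).
Hypothesis hm : forall m, mollifier (c m) (rho m) (drho m).
Hypothesis c0 : c @ \oo --> 0.

(* Pointwise limit of the continuous functions obtained by mollifying [a], [b] in space and
   truncating to balls. *)
Lemma wcts_int_measurable B a b (g : R -> E -> R) C : wcts B a -> wcts B b ->
  (forall x, continuous (g^~ x)) -> (forall t, measurable_fun setT (g t)) ->
  (forall t x, `|g t x| <= C) ->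
  measurable_fun setT ((fun t => \int[mu]_x (g t x * (a t x * b t x))) : measurableTypeR R -> R).
Proof.
move=> ha hb cg mg gC.
have [sa _ _] := ha; have [sb _ _] := hb.
pose M n (f : E -> R) : E -> R := conv (rho n) f.
pose K n := Num.sqrt (n2 mu (rho n)) * Num.sqrt B.
have C0 : 0 <= C := le_trans (normr_ge0 _) (gC 0 0).
pose h n t x := ball_ind n%:R x * g t x.
have mh n t : measurable_fun setT (h n t).
  by apply: measurable_funM; [exact: measurable_ball_ind|exact: mg].
have hC n t x : `|h n t x| <= C.
  rewrite normrM (ger0_norm (ball_ind_ge0 _ _)) /ball_ind.
  by case: (`|x| <= _); rewrite ?mul1r ?mul0r.
pose F n t := \int[mu]_x (h n t x * (M n (a t) x * M n (b t) x)).
have sM n f : sqi mu f -> sqi mu (M n f) := moll_sqi (hm n) (f := f).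
have iF n t : ig mu (fun x => h n t x * (M n (a t) x * M n (b t) x)).
  exact: (ig_bdd (mh n t) (hC n t) (sqi_mul (sM n _ (sa t)) (sM n _ (sb t)))).
have cF n : continuous (F n).
  apply: seq_cont => tau t ct.
  apply: (@dct _ _ _ mu (fun k x => h n (tau k) x * (M n (a (tau k)) x * M n (b (tau k)) x))
     (fun x => h n t x * (M n (a t) x * M n (b t) x))
     (fun x => C * (K n * K n) * ball_ind n%:R x)).
  - by move=> k; exact: (igM (iF n (tau k))).
  - exact: (igM (iF n t)).
  - exact: (igZ (C * (K n * K n)) (ig_ball_ind n%:R)).
  - move=> x.
    have e1 := cont_seq (@wcts_conv_cont B _ _ _ x ha (moll_kern (hm n))) ct.
    have e2 := cont_seq (@wcts_conv_cont B _ _ _ x hb (moll_kern (hm n))) ct.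
    have e3 : (fun k => h n (tau k) x) @ \oo --> h n t x.
      by apply: cvgMl_tmp; exact: (cont_seq (cg x) ct).
    exact: (cvgM e3 (cvgM e1 e2)).
  - move=> k x; rewrite /h -mulrA normrM (ger0_norm (ball_ind_ge0 _ _)) mulrC.
    apply: ler_wpM2r; first exact: ball_ind_ge0.
    rewrite normrM; apply: ler_pM => //; rewrite normrM.
    by apply: ler_pM => //; [exact: (wcts_conv_bound (tau k) x ha (moll_kern (hm n)))|
      exact: (wcts_conv_bound (tau k) x hb (moll_kern (hm n)))].
apply: (@measurable_fun_cvg _ _ _ _ F); first by move=> n; exact: continuous_measurable_fun.
move=> t _.
have h1 : F n t - \int[mu]_x (h n t x * (a t x * b t x)) @[n --> \oo] --> 0.
  apply: (@l2_bil_cvg _ _ _ mu (fun n => M n (a t)) (fun n => M n (b t)) (fun n => h n t)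
    (a t) (b t) C).
  - by move=> n; exact: mh.
  - by move=> n x; exact: hC.
  - by move=> n; exact: sM.
  - by move=> n; exact: sM.
  - exact: sa.
  - exact: sb.
  - exact: (moll_cvg hm c0 (sa t)).
  - exact: (moll_cvg hm c0 (sb t)).
have h2 : \int[mu]_x (h n t x * (a t x * b t x)) @[n --> \oo] -->
    \int[mu]_x (g t x * (a t x * b t x)).
  have iab := sqi_mul (sa t) (sb t).
  apply: (@dct _ _ _ mu (fun n x => h n t x * (a t x * b t x))
    (fun x => g t x * (a t x * b t x)) (fun x => C * `|a t x * b t x|)).
  - by move=> n; exact: (igM (ig_bdd (mh n t) (hC n t) iab)).
  - exact: (igM (ig_bdd (mg t) (gC t) iab)).
  - exact: (igZ C (ig_norm iab)).
  - move=> x; apply: cvg_near_cst; near=> n.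
    rewrite /h /ball_ind (_ : `|x| <= n%:R) ?mul1r//.
    by near: n; exact: nbhs_infty_ger.
  - by move=> n x; rewrite normrM ler_wpM2r.
exact: (cvg_sub0_trans h1 h2).
Unshelve. all: by end_near.
Qed.

End weakly_continuous_fields.

(** * The pairing of vector fields and the flux form *)

Section pairing.
Context {R : realType} {d : nat}.
Local Notation E := 'rV[R]_d.
Local Notation mu := (lebesgue_rV R d).

Definition vsub (v w : E -> E) : E -> E := fun x => v x - w x.

Definition ip (v w : E -> E) : R := \sum_i \int[mu]_x (v x 0 i * w x 0 i).

Lemma vsubE v w i : (fun x => vsub v w x 0 i) = (fun x => v x 0 i - w x 0 i).
Proof. by apply/funext => x; rewrite !mxE. Qed.

Lemma sqv_sub v w : sqv v -> sqv w -> sqv (vsub v w).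
Proof. by move=> hv hw i; rewrite vsubE; exact: sqiB. Qed.

Lemma en_ge0 (v : E -> E) : 0 <= en v.
Proof. by apply: sumr_ge0 => i _; exact: n2_ge0. Qed.

Lemma n2_le_en (v : E -> E) i : n2 mu (fun x => v x 0 i) <= en v.
Proof.
rewrite /en (bigD1 i)//= lerDl; apply: sumr_ge0 => j _; exact: n2_ge0.
Qed.

Lemma ipC v w : ip v w = ip w v.
Proof. by apply: eq_bigr => i _; apply: eq_int => x; rewrite mulrC. Qed.

Lemma ip_self v : ip v v = en v.
Proof. by apply: eq_bigr => i _; apply: eq_int => x; rewrite expr2. Qed.

Lemma ipBl v v' w : sqv v -> sqv v' -> sqv w -> ip (vsub v v') w = ip v w - ip v' w.
Proof.
move=> hv hv' hw; rewrite /ip -sumrB; apply: eq_bigr => i _.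
rewrite -(intB (sqi_mul (hv i) (hw i)) (sqi_mul (hv' i) (hw i))).
by apply: eq_int => x; rewrite !mxE mulrBl.
Qed.

Lemma ipBr v v' w : sqv v -> sqv v' -> sqv w -> ip w (vsub v v') = ip w v - ip w v'.
Proof. by move=> hv hv' hw; rewrite !(ipC w); exact: ipBl. Qed.

Lemma sqrt_n2_le (v : E -> E) i : Num.sqrt (n2 mu (fun x => v x 0 i)) <= Num.sqrt (en v).
Proof. by rewrite ler_sqrt; [exact: n2_le_en|exact: en_ge0]. Qed.

Lemma ip_le v w : sqv v -> sqv w -> `|ip v w| <= d%:R * (Num.sqrt (en v) * Num.sqrt (en w)).
Proof.
move=> hv hw; apply: le_trans (ler_norm_sum _ _ _) _.
rewrite -[X in X%:R]card_ord mulr_natl -sumr_const; apply: ler_sum => i _.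
apply: le_trans (cs_sqrt (hv i) (hw i)) _.
by apply: ler_pM; rewrite ?sqrtr_ge0//; exact: sqrt_n2_le.
Qed.

Lemma en_sub v w : sqv v -> sqv w -> en (vsub v w) = en v + en w - 2 * ip v w.
Proof.
move=> hv hw; have hs := sqv_sub hv hw.
rewrite -!ip_self (ipBl hv hw hs) (ipBr hv hw hv) (ipBr hv hw hw) (ipC w v).
by ring.
Qed.

Lemma div_free_sub v w : sqv v -> sqv w -> div_free v -> div_free w -> div_free (vsub v w).
Proof.
move=> hv hw dv dw psi tpsi; have [_ s2] := good_sqi (test_function_good tpsi).
have ev := dv psi tpsi; have ew := dw psi tpsi.
rewrite (div_freeE _ tpsi) in ev; rewrite (div_freeE _ tpsi) in ew.
rewrite (div_freeE _ tpsi).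
have -> : \sum_j \int[mu]_x (vsub v w x 0 j * pderiv j psi x) =
    \sum_j \int[mu]_x (v x 0 j * pderiv j psi x) - \sum_j \int[mu]_x (w x 0 j * pderiv j psi x).
  rewrite -sumrB; apply: eq_bigr => j _.
  rewrite -(intB (sqi_mul (hv j) (s2 j)) (sqi_mul (hw j) (s2 j))).
  by apply: eq_int => x; rewrite !mxE mulrBl.
by rewrite opprB addrC -[X in _ + X = _]opprK -opprD addrC; lra.
Qed.

Section one_mollifier.
Variables (c : R) (rho : E -> R) (drho : 'I_d -> E -> R).
Hypothesis hm : mollifier c rho drho.

Lemma mollv_coord v i : (fun x => mollv rho v x 0 i) = conv rho (fun x => v x 0 i).
Proof. by apply/funext => x; rewrite mollvE. Qed.

Lemma sqv_mollv v : sqv v -> sqv (mollv rho v).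
Proof. by move=> hv i; rewrite mollv_coord; exact: (moll_sqi hm (hv i)). Qed.

Lemma mollv_sub v w : sqv v -> sqv w ->
  mollv rho (vsub v w) = vsub (mollv rho v) (mollv rho w).
Proof.
move=> hv hw; apply/funext => x; apply/rowP => i.
rewrite mollvE vsubE (convB x (moll_kern hm) (hv i) (hw i)).
by rewrite /vsub !mxE.
Qed.

Lemma ip_mollv v w : sqv v -> sqv w -> ip v (mollv rho w) = ip (mollv rho v) w.
Proof.
move=> hv hw; apply: eq_bigr => i _.
rewrite (_ : (fun x => mollv rho v x 0 i * w x 0 i) =
  fun x => conv rho (fun y => v y 0 i) x * w x 0 i); last by apply/funext => x; rewrite mollvE.
rewrite (moll_adjoint hm (hv i) (hw i)).
by apply: eq_int => x; rewrite mollvE.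
Qed.

(** This is $\int a\otimes a:\nabla(\rho*z)$, the rate of change of $\langle a,\rho*z\rangle$ along
    a solution $a$ of the Euler equations. *)
Definition flux (a z : E -> E) : R :=
  \sum_i \sum_j \int[mu]_x (conv (drho j) (fun x => z x 0 i) x * (a x 0 i * a x 0 j)).

(** For each $i,j$ the field $\partial_j\rho*z_i$ is bounded by $\|\partial_j\rho\|_2\|z\|_2$ and
    $\int|a_ia_j|$ by $B$; the sum over $i$ gives the factor $d$. *)
Definition flux_cst (B : R) : R := d%:R * (\sum_j Num.sqrt (n2 mu (drho j))) * B.

Lemma flux_term_ig a z i j : sqv a -> sqv z ->
  ig mu (fun x => conv (drho j) (fun x => z x 0 i) x * (a x 0 i * a x 0 j)).
Proof.
move=> ha hz; apply: (ig_bdd _ (fun x => conv_bound (moll_dkern hm j) x (hz i))).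
  exact: (conv_meas (moll_dkern hm j) (hz i).1).
exact: sqi_mul (ha i) (ha j).
Qed.

Lemma flux_le a z B : sqv a -> sqv z -> en a <= B ->
  `|flux a z| <= flux_cst B * Num.sqrt (en z).
Proof.
move=> ha hz aB; have B0 : 0 <= B := le_trans (en_ge0 a) aB.
apply: le_trans (ler_norm_sum _ _ _) _.
rewrite /flux_cst -[X in X%:R]card_ord -!mulrA mulr_natl -sumr_const; apply: ler_sum => i _.
apply: le_trans (ler_norm_sum _ _ _) _.
rewrite mulr_suml; apply: ler_sum => j _.
have mz := conv_meas (moll_dkern hm j) (hz i).1.
apply: le_trans (int_mul3_bound mz (fun x => conv_bound (moll_dkern hm j) x (hz i))
  (ha i) (ha j)) _.
rewrite -mulrA; apply: ler_wpM2l; first exact: sqrtr_ge0.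
rewrite [leRHS]mulrC; apply: ler_pM.
- exact: sqrtr_ge0.
- by rewrite mulr_ge0// sqrtr_ge0.
- exact: sqrt_n2_le.
apply: le_trans (sqrtM_le_half (n2_ge0 _ _) (n2_ge0 _ _)) _.
have h1 := n2_le_en a i; have h2 := n2_le_en a j; lra.
Qed.

Lemma fluxBr a z z' : sqv a -> sqv z -> sqv z' ->
  flux a (vsub z z') = flux a z - flux a z'.
Proof.
move=> ha hz hz'; rewrite /flux -sumrB; apply: eq_bigr => i _.
rewrite -sumrB; apply: eq_bigr => j _.
rewrite -(intB (flux_term_ig i j ha hz) (flux_term_ig i j ha hz')).
apply: eq_int => x; rewrite vsubE (convB x (moll_dkern hm j) (hz i) (hz' i)).
by rewrite mulrBl.
Qed.

End one_mollifier.
End pairing.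

(** * Solutions at every time *)

Section good_solutions.
Context {R : realType} {d : nat}.
Local Notation E := 'rV[R]_d.
Local Notation mu := (lebesgue_rV R d).
Local Notation lam := (@lebesgue_measure R).

Definition wctsv (B : R) (u : R -> E -> E) := forall i, wcts B (fun t x => u t x 0 i).

Lemma wctsv_sqv B u t : wctsv B u -> sqv (u t).
Proof. by move=> hu i; have [h _ _] := hu i. Qed.

Lemma wctsv_cst (v : E -> E) : sqv v -> wctsv (en v) (fun=> v).
Proof.
move=> hv i; split=> [_|_|w hw t]; [exact: hv|exact: n2_le_en|exact: cst_continuous].
Qed.

Lemma wctsv_mollv c rho drho B u : mollifier c rho drho -> wctsv B u ->
  wctsv B (fun t => mollv rho (u t)).
Proof.
move=> hm hu i; have [h1 h2 h3] := hu i; split=> [t|t|w hw].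
- by rewrite mollv_coord; exact: (moll_sqi hm (h1 t)).
- by rewrite mollv_coord; exact: le_trans (moll_n2 hm (h1 t)) (h2 t).
- rewrite (_ : (fun t => _) = fun t => \int[mu]_x (u t x 0 i * conv rho w x)).
    exact: h3 _ (moll_sqi hm hw).
  apply/funext => t; rewrite -(moll_adjoint hm (h1 t) hw); apply: eq_int => x.
  by rewrite mollvE.
Qed.

(** The properties of a solution used from here on. Those that the definitions give almost
    everywhere are stated at every time, and the momentum equation is kept only for mollified test
    fields constant in time. *)
Record good_sol (T : R) (u0 : E -> E) (u : R -> E -> E) : Prop := GoodSol {
  gs_wcts : wctsv (en u0) u;
  gs_en : forall t, en (u t) <= en u0;
  gs_div : forall t, div_free (u t);
  gs_mom : forall c rho drho z, mollifier c rho drho -> sqv z -> div_free z ->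
    forall t, 0 <= t -> t <= T ->
    ip (u t) (mollv rho z) - ip u0 (mollv rho z) = tint (fun r => flux drho (u r) z) 0 t
}.

Variables (cs : nat -> R) (rhos : nat -> E -> R) (drhos : nat -> 'I_d -> E -> R).
Hypothesis hms : forall m, mollifier (cs m) (rhos m) (drhos m).
Hypothesis cs0 : cs @ \oo --> 0.

Lemma flux_measurable c rho drho B B' a z : mollifier c rho drho -> wctsv B a -> wctsv B' z ->
  measurable_fun setT ((fun r => flux drho (a r) (z r)) : measurableTypeR R -> R).
Proof.
move=> hm ha hz; apply: measurable_sum => i; apply: measurable_sum => j.
have hk := moll_dkern hm j.
apply: (wcts_int_measurable hms cs0 (g := fun r => conv (drho j) (fun x => z r x 0 i))
  (C := Num.sqrt (n2 mu (drho j)) * Num.sqrt B') (ha i) (ha j)).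
- by move=> x; exact: (wcts_conv_cont (hz i) hk).
- by move=> t; have [h _ _] := hz i; exact: (conv_meas hk (h t).1).
- by move=> t x; exact: (wcts_conv_bound t x (hz i) hk).
Qed.

(** * The mollified energy identity between two solutions *)

Section energy_identity.
Variables (T : R) (u0 : E -> E) (u U : R -> E -> E).
Hypothesis hu0 : sqv u0.
Hypothesis du0 : div_free u0.
Hypothesis gu : good_sol T u0 u.
Hypothesis gU : good_sol T u0 U.

Section one_mollifier.
Variables (c : R) (rho : E -> R) (drho : 'I_d -> E -> R).
Hypothesis hm : mollifier c rho drho.

Let K := flux_cst drho (en u0).
Let M := mollv rho.

Let K0 : 0 <= K.
Proof. by rewrite /K /flux_cst mulr_ge0 ?en_ge0// mulr_ge0// sumr_ge0. Qed.

Let sqM v : sqv v -> sqv (M v).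
Proof. exact: (sqv_mollv hm). Qed.

Let flux_tint_ig v B z s t : good_sol T u0 v -> wctsv B z ->
  (forall r, en (z r) <= B) ->
  ig lam (fun r => tind s t r * flux drho (v r) (z r)).
Proof.
move=> gv hz zB.
apply: (@ig_tind_mul _ _ (K * Num.sqrt B)).
  exact: (flux_measurable hm (gs_wcts gv) hz).
move=> r; apply: le_trans (flux_le hm (wctsv_sqv r (gs_wcts gv)) (wctsv_sqv r hz) (gs_en gv r)) _.
apply: ler_wpM2l => //; rewrite ler_sqrt//; exact: le_trans (en_ge0 _) (zB r).
Qed.

Let flux_tint_ig_cst v z s t : good_sol T u0 v -> sqv z ->
  ig lam (fun r => tind s t r * flux drho (v r) z).
Proof. by move=> gv hz; exact: (flux_tint_ig s t gv (wctsv_cst hz) (fun=> lexx _)). Qed.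

Let mom_incr v z s t : good_sol T u0 v -> sqv z -> div_free z ->
  0 <= s -> s <= t -> t <= T ->
  ip (vsub (v t) (v s)) (M z) = tint (fun r => flux drho (v r) z) s t.
Proof.
move=> gv hz dz s0 st tT.
have hv r : sqv (v r) := wctsv_sqv r (gs_wcts gv).
rewrite (ipBl (hv t) (hv s) (sqM hz)).
have e1 := gs_mom gv hm hz dz (le_trans s0 st) tT.
have e2 := gs_mom gv hm hz dz s0 (le_trans st tT).
have e3 := tint_split s0 st (flux_tint_ig_cst 0 s gv hz) (flux_tint_ig_cst s t gv hz).
by rewrite -/M in e1 e2; lra.
Qed.

(* Test with [z = rho * (v t - v s)]: the pairing is [en z], bounded by [sqrt (en z)]. *)
Let moll_incr v s t : good_sol T u0 v -> 0 <= s -> s <= t -> t <= T ->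
  Num.sqrt (en (M (vsub (v t) (v s)))) <= K * (t - s).
Proof.
move=> gv s0 st tT.
have hv r : sqv (v r) := wctsv_sqv r (gs_wcts gv).
have hd := sqv_sub (hv t) (hv s).
have dd := div_free_sub (hv t) (hv s) (gs_div gv t) (gs_div gv s).
have hz := sqM hd; have dz := mollv_div_free hm hd dd.
have e1 := mom_incr gv hz dz s0 st tT.
rewrite (ip_mollv hm hd hz) ip_self in e1.
set z := mollv rho _ in e1 hz *.
have h : `|en z| <= K * Num.sqrt (en z) * (t - s).
  rewrite {1}e1; apply: (tint_bound st (flux_tint_ig_cst s t gv hz)) => r _ _.
  exact: (flux_le hm (hv r) hz (gs_en gv r)).
rewrite (ger0_norm (en_ge0 _)) -{1}(sqr_sqrtr (en_ge0 z)) in h.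
have := sqrtr_ge0 (en z); rewrite le_eqVlt => /orP[/eqP e|p].
  by rewrite -/M -/z -e mulr_ge0// subr_ge0.
by rewrite -(ler_pM2r p) -expr2; apply: le_trans h _; rewrite mulrAC.
Qed.

Let f r := flux drho (u r) (M (U r)) + flux drho (U r) (M (u r)).

(** Since $\rho$ is even this equals $\langle\rho*u,\rho*U\rangle$, symmetric in the two solutions;
    [f] is its expected time derivative. *)
Let Bt t := ip (u t) (M (M (U t))).

Let f_ig s t : ig lam (fun r => tind s t r * f r).
Proof.
have n2M v : sqv v -> en (M v) <= en v.
  move=> hv; apply: ler_sum => i _; rewrite mollv_coord; exact: (moll_n2 hm (hv i)).
have hu r := wctsv_sqv r (gs_wcts gu); have hU r := wctsv_sqv r (gs_wcts gU).
have h1 := flux_tint_ig s t gu (wctsv_mollv hm (gs_wcts gU))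
  (fun r => le_trans (n2M _ (hU r)) (gs_en gU r)).
have h2 := flux_tint_ig s t gU (wctsv_mollv hm (gs_wcts gu))
  (fun r => le_trans (n2M _ (hu r)) (gs_en gu r)).
by apply: eq_ig (igD h1 h2) => r; rewrite /f mulrDr.
Qed.

Let tintB_cst F G s t : ig lam (fun r => tind s t r * F r) -> ig lam (fun r => tind s t r * G r) ->
  tint (fun r => F r - G r) s t = tint F s t - tint G s t.
Proof.
move=> hF hG; rewrite /tint -(intB hF hG); apply: eq_int => r; exact: mulrBr.
Qed.

(** Freezing the mollified argument at time $s$ changes the flux at time $r$ by at most $K\cdot
    K(r-s)$, by [flux_le] and [moll_incr]; integration over the interval gives another factor
    $t-s$. *)
Let flux_drift v w s t : good_sol T u0 v -> good_sol T u0 w -> 0 <= s -> s <= t -> t <= T ->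
  `|tint (fun r => flux drho (v r) (M (w r))) s t - tint (fun r => flux drho (v r) (M (w s))) s t|
  <= K ^+ 2 * (t - s) ^+ 2.
Proof.
move=> gv gw s0 st tT.
have hv r : sqv (v r) := wctsv_sqv r (gs_wcts gv).
have hw r : sqv (w r) := wctsv_sqv r (gs_wcts gw).
have n2M v' : sqv v' -> en (M v') <= en v'.
  move=> hv'; apply: ler_sum => i _; rewrite mollv_coord; exact: (moll_n2 hm (hv' i)).
have h1 := flux_tint_ig s t gv (wctsv_mollv hm (gs_wcts gw))
  (fun r => le_trans (n2M _ (hw r)) (gs_en gw r)).
have h2 := flux_tint_ig_cst s t gv (sqM (hw s)).
have h3 : ig lam (fun r => tind s t r * (flux drho (v r) (M (w r)) - flux drho (v r) (M (w s)))).
  by apply: eq_ig (igB h1 h2) => r; rewrite mulrBr.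
have e : tint (fun r => flux drho (v r) (M (w r))) s t -
    tint (fun r => flux drho (v r) (M (w s))) s t =
    tint (fun r => flux drho (v r) (M (w r)) - flux drho (v r) (M (w s))) s t :=
  esym (tintB_cst h1 h2).
have -> : K ^+ 2 * (t - s) ^+ 2 = K * (K * (t - s)) * (t - s) by ring.
rewrite e; apply: (tint_bound st h3) => r sr rt.
rewrite -(fluxBr hm (hv r) (sqM (hw r)) (sqM (hw s))) -(mollv_sub hm (hw r) (hw s)).
have hd := sqv_sub (hw r) (hw s).
apply: le_trans (flux_le hm (hv r) (sqM hd) (gs_en gv r)) _.
apply: ler_wpM2l => //; apply: le_trans (moll_incr gw s0 sr (le_trans rt tT)) _.
by apply: ler_wpM2l => //; rewrite lerB.
Qed.

Let sub_subst (x a b y : R) : a = b -> `|x - b| <= y -> `|x - a| <= y.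
Proof. by move=> ->. Qed.

Let norm_subst (a b y : R) : a = b -> `|a| <= y -> `|b| <= y.
Proof. by move=> ->. Qed.

Let sub_eq_trans (b x b' y w : R) : b - x = b' - y -> y = 0 -> b' = w -> b = w + x.
Proof. by move=> e y0 <-; rewrite -[b](subrK x) e y0 subr0. Qed.

(** Here $x_1,x_2,x_3,x_4$ are $\langle u(p),\rho*\rho*U(q)\rangle$ for
    $(p,q)=(t,t),(s,t),(t,s),(s,s)$, and $a_1,a_2$ are the two time integrals that make up
    [tint f s t]. *)
Let increment_bound (a1 a2 x1 x2 x3 x4 h k : R) : `|a1 - (x3 - x4)| <= h ->
  `|a2 - (x2 - x4)| <= h -> `|x1 - x2 - (x3 - x4)| <= k * h ->
  `|x1 - x4 - (a1 + a2)| <= (k + 2) * h.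
Proof.
rewrite !ler_norml mulrDl => /andP[p1 p2] /andP[p3 p4] /andP[p5 p6].
by apply/andP; split; lra.
Qed.

(** A discrete product rule. The increments of $u$ and of $U$, each paired with the other field
    frozen at $s$, are given by the momentum equation up to two drift errors. The remaining mixed
    second difference is $\langle\rho*\Delta u,\rho*\Delta U\rangle$, a product of two terms of size
    $K(t-s)$. The constant $d+2$ counts the factor $d$ of [ip_le] and the two drifts. *)
Let Bt_incr s t : 0 <= s -> s <= t -> t <= T ->
  `|Bt t - Bt s - tint f s t| <= (d%:R + 2) * K ^+ 2 * (t - s) ^+ 2.
Proof.
move=> s0 st tT.
have hu r := wctsv_sqv r (gs_wcts gu); have hU r := wctsv_sqv r (gs_wcts gU).
have n2M v : sqv v -> en (M v) <= en v.
  move=> hv; apply: ler_sum => i _; rewrite mollv_coord; exact: (moll_n2 hm (hv i)).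
have mdiv v : sqv v -> div_free v -> div_free (M v) := mollv_div_free hm (v := v).
have hdu := sqv_sub (hu t) (hu s); have hdU := sqv_sub (hU t) (hU s).
have e1 := mom_incr gu (sqM (hU s)) (mdiv _ (hU s) (gs_div gU s)) s0 st tT.
have e2 := mom_incr gU (sqM (hu s)) (mdiv _ (hu s) (gs_div gu s)) s0 st tT.
have d1 := flux_drift gu gU s0 st tT; have d2 := flux_drift gU gu s0 st tT.
have i1 := flux_tint_ig s t gu (wctsv_mollv hm (gs_wcts gU))
  (fun r => le_trans (n2M _ (hU r)) (gs_en gU r)).
have i2 := flux_tint_ig s t gU (wctsv_mollv hm (gs_wcts gu))
  (fun r => le_trans (n2M _ (hu r)) (gs_en gu r)).
have ef : tint f s t = tint (fun r => flux drho (u r) (M (U r))) s t +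
    tint (fun r => flux drho (U r) (M (u r))) s t.
  rewrite /tint -(intD i1 i2); apply: eq_int => r; exact: mulrDr.
have e3 : `|ip (M (vsub (u t) (u s))) (M (vsub (U t) (U s)))| <= d%:R * (K ^+ 2 * (t - s) ^+ 2).
  apply: le_trans (ip_le (sqM hdu) (sqM hdU)) _; apply: ler_wpM2l => //.
  have -> : K ^+ 2 * (t - s) ^+ 2 = (K * (t - s)) * (K * (t - s)) by ring.
  by apply: ler_pM; rewrite ?sqrtr_ge0//; apply: moll_incr.
have q1 : ip (vsub (u t) (u s)) (M (M (U s))) = ip (u t) (M (M (U s))) - ip (u s) (M (M (U s))).
  exact: (ipBl (hu t) (hu s) (sqM (sqM (hU s)))).
have q2 : ip (vsub (U t) (U s)) (M (M (u s))) = ip (u s) (M (M (U t))) - ip (u s) (M (M (U s))).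
  have sw w : sqv w -> ip w (M (M (u s))) = ip (u s) (M (M w)).
    move=> hw; apply: (etrans (ip_mollv hm hw (sqM (hu s)))).
    exact: (etrans (ipC _ _) (esym (ip_mollv hm (hu s) (sqM hw)))).
  exact: (etrans (ipBl (hU t) (hU s) (sqM (sqM (hu s))))
    (congr2 (fun a b => a - b) (sw _ (hU t)) (sw _ (hU s)))).
have q3 : ip (M (vsub (u t) (u s))) (M (vsub (U t) (U s))) =
    ip (u t) (M (M (U t))) - ip (u s) (M (M (U t))) -
    (ip (u t) (M (M (U s))) - ip (u s) (M (M (U s)))).
  have eM : M (M (vsub (U t) (U s))) = vsub (M (M (U t))) (M (M (U s))) :=
    etrans (congr1 M (mollv_sub hm (hU t) (hU s))) (mollv_sub hm (sqM (hU t)) (sqM (hU s))).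
  apply: (etrans (esym (ip_mollv hm hdu (sqM hdU)))).
  apply: (etrans (congr1 (ip (vsub (u t) (u s))) eM)).
  apply: (etrans (ipBr (sqM (sqM (hU t))) (sqM (sqM (hU s))) hdu)).
  exact: (congr2 (fun a b => a - b) (ipBl (hu t) (hu s) (sqM (sqM (hU t))))
    (ipBl (hu t) (hu s) (sqM (sqM (hU s))))).
have b1 := sub_subst (etrans (esym q1) e1) d1.
have b2 := sub_subst (etrans (esym q2) e2) d2.
have b3 := norm_subst q3 e3.
rewrite -mulrA; exact: (sub_subst ef (increment_bound b1 b2 b3)).
Qed.

Lemma energy_identity t : 0 <= t -> t <= T ->
  ip (u t) (mollv rho (mollv rho (U t))) = ip u0 (mollv rho (mollv rho u0)) +
  tint (fun r => flux drho (u r) (mollv rho (U r)) + flux drho (U r) (mollv rho (u r))) 0 t.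
Proof.
move=> t0 tT.
have hu r := wctsv_sqv r (gs_wcts gu); have hU r := wctsv_sqv r (gs_wcts gU).
have mdiv v : sqv v -> div_free v -> div_free (M v) := mollv_div_free hm (v := v).
have T0 := le_trans t0 tT.
have tint0 (F : R -> R) : tint F 0 0 = 0.
  apply: (etrans _ (int0 lam)); apply: eq_int => r; rewrite tindE.
  by case: ltgtP => //=; rewrite mul0r.
pose G t := Bt t - tint f 0 t.
have split_sub (b b' x y z : R) : x = y + z -> b - x - (b' - y) = b - b' - z.
  by move=> ->; ring.
have incr s r : 0 <= s -> s <= r -> r <= T ->
    `|G r - G s| <= (d%:R + 2) * K ^+ 2 * (r - s) ^+ 2.
  move=> s0 sr rT; apply: norm_subst (Bt_incr s0 sr rT).
  exact: (esym (split_sub _ _ _ _ _ (tint_split s0 sr (f_ig 0 s) (f_ig s r)))).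
have cG : Bt t - tint f 0 t = Bt 0 - tint f 0 0 := quadratic_increments_cst incr t0 tT.
(* The initial datum enters only through the momentum equation at time 0, against mollified
   divergence-free fields: first $u(0)$ is replaced by $u_0$, then, after exchanging the arguments
   by evenness of the kernel, $U(0)$. *)
have e0 : Bt 0 = ip u0 (M (M u0)).
  have h1 : ip (u 0) (M (M (U 0))) - ip u0 (M (M (U 0))) = 0 :=
    etrans (gs_mom gu hm (sqM (hU 0)) (mdiv _ (hU 0) (gs_div gU 0)) (lexx 0) T0) (tint0 _).
  have h2 : ip (U 0) (M (M u0)) - ip u0 (M (M u0)) = 0 :=
    etrans (gs_mom gU hm (sqM hu0) (mdiv _ hu0 du0) (lexx 0) T0) (tint0 _).
  have sw : ip u0 (M (M (U 0))) = ip (U 0) (M (M u0)).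
    apply: (etrans (ip_mollv hm hu0 (sqM (hU 0)))).
    exact: (etrans (ipC _ _) (esym (ip_mollv hm (hU 0) (sqM hu0)))).
  exact: (etrans (subr0_eq h1) (etrans sw (subr0_eq h2))).
exact: (sub_eq_trans cG (tint0 f) e0).
Qed.

End one_mollifier.
End energy_identity.
End good_solutions.

(** * From almost every time to every time *)

Section density.
Context {R : realType}.
Local Notation lam := (@lebesgue_measure R).

Lemma ae_imp (P Q : R -> Prop) : (forall r, P r -> Q r) ->
  (\forall r \ae lam, P r) -> \forall r \ae lam, Q r.
Proof.
move=> PQ [N [mN N0 hN]]; exists N; split=> // r /= nQ; apply: hN => /= hP.
exact: nQ (PQ _ hP).
Qed.

Lemma ae_and (P Q : R -> Prop) : (\forall r \ae lam, P r) -> (\forall r \ae lam, Q r) ->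
  \forall r \ae lam, P r /\ Q r.
Proof.
move=> hP hQ; apply: (negligibleS _ (negligibleU hP hQ)) => r /= h.
by have [p|np] := pselect (P r); [right => q; exact: h|left].
Qed.

Lemma continuous_le_ae (h : R -> R) (K T : R) : 0 < T -> continuous h ->
  (\forall r \ae lam, r \in `]0, T[ -> h r <= K) ->
  forall s, 0 <= s -> s <= T -> h s <= K.
Proof.
move=> T0 ch hK s s0 sT; have [tau [_ tK ct]] := ae_dense T0 s0 sT hK.
by apply: (cvgr_to_le (cont_seq ch ct)); apply: nearW.
Qed.

Lemma continuous_eq_ae (h : R -> R) (K T : R) : 0 < T -> continuous h ->
  (\forall r \ae lam, r \in `]0, T[ -> h r = K) ->
  forall s, 0 <= s -> s <= T -> h s = K.
Proof.
move=> T0 ch hK s s0 sT; have [tau [_ tK ct]] := ae_dense T0 s0 sT hK.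
apply: (@cvg_cst_eq _ (h s) K).
have := cont_seq ch ct; rewrite (_ : (fun n => h (tau n)) = fun=> K); last exact/funext.
by move=> /cvg_cst_eq <-; exact: cvg_cst.
Qed.

Lemma lipschitz_continuous (h : R -> R) K : (forall s t, s <= t -> `|h t - h s| <= K * (t - s)) ->
  continuous h.
Proof.
move=> hK; have H s t : `|h t - h s| <= K * `|t - s|.
  have [st|ts] := leP s t; first by rewrite (@ger0_norm _ (t - s)) ?subr_ge0//; exact: hK.
  have -> : `|t - s| = s - t by rewrite ltr0_norm ?subr_lt0// opprB.
  by rewrite distrC; exact/hK/ltW.
apply: seq_cont => tau t ct; apply: (@cvg_sub0_trans _ _ (fun=> h t)); last exact: cvg_cst.
apply: norm_cvg0; apply: (cvg0_squeeze (v := fun n => K * `|tau n - t|)).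
  by move=> n; rewrite normr_ge0 H.
apply: cvg0Z; rewrite -(@normr0 _ R); apply: cvg_norm.
have h1 : (fun n => tau n - t) @ \oo --> t - t by apply: cvgB ct _; exact: cvg_cst.
by rewrite subrr in h1.
Qed.

Lemma continuous_tint (F : R -> R) K s0 : measurable_fun setT (F : measurableTypeR R -> R) ->
  (forall r, `|F r| <= K) -> continuous (tint F s0).
Proof.
move=> mF FK; apply: (@lipschitz_continuous _ K) => s t st.
have ht := ig_tind_mul s0 t mF FK; have hs := ig_tind_mul s0 s mF FK.
have K0 : 0 <= K := le_trans (normr_ge0 _) (FK 0).
rewrite /tint -(intB ht hs); apply: le_trans (norm_int (igB ht hs)) _.
rewrite -(int_tind st) -(intZ K (ig_tind s t)).
apply: (le_int (ig_norm (igB ht hs)) (igZ K (ig_tind s t))) => r.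
rewrite -mulrBl normrM mulrC; apply: ler_pM => //; rewrite !tindE.
have [sr|rs] := ltP s r; have [rt|tr] := leP r t; have [rs'|sr'] := leP r s;
  have [a|a] := ltP s0 r; rewrite /= ?subrr ?subr0 ?normr0 ?normr1 ?ler01//; lra.
Qed.

Lemma Rintegral_tint (F : R -> R) t :
  measurable_fun setT (F : measurableTypeR R -> R) ->
  \int[lam]_(r in `]0, t[) F r = tint F 0 t.
Proof.
move=> mF.
have -> : \int[lam]_(r in `]0, t[) F r = \int[lam]_(r in `]0, t]) F r.
  congr fine; apply: integral_itv_bndo_bndc.
  by apply/measurable_EFinP; exact: measurable_funTS.
rewrite Rintegral_mkcond; apply: eq_int => r.
rewrite patchE /tint /tind indicE; by case: (r \in _); rewrite ?mul1r ?mul0r.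
Qed.

End density.

(** * Admissible weak solutions satisfy their properties at every time *)

Section clamped_solution.
Context {R : realType} {d : nat}.
Local Notation E := 'rV[R]_d.
Local Notation mu := (lebesgue_rV R d).
Local Notation lam := (@lebesgue_measure R).

Lemma in_Lp2_sqv (v : E -> E) : in_Lp 2%:E v <-> sqv v.
Proof.
rewrite in_Lp2P; split=> [h i|h i j]; first exact: h.
by rewrite (ord1 i); exact: h.
Qed.

Lemma int_mxnorm2_en (v : E -> E) : sqv v ->
  (\int[mu]_x (mxnorm2 (v x) ^+ 2)%:E = (en v)%:E)%E.
Proof.
move=> hv; rewrite (@int_mxnorm2 _ _ _ _ v); first by rewrite big_ord1.
by move=> i j; rewrite (ord1 i); exact: hv.
Qed.

Variables (cs : nat -> R) (rhos : nat -> E -> R) (drhos : nat -> 'I_d -> E -> R).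
Hypothesis hms : forall m, mollifier (cs m) (rhos m) (drhos m).
Hypothesis cs0 : cs @ \oo --> 0.

Variables (T : R) (u0 : E -> E) (u : R -> E -> E).
Hypothesis T0 : 0 < T.
Hypothesis hu0 : sqv u0.
Hypothesis wu : weak_solution T u0 u.
Hypothesis au : admissible T u0 u.

(* The solution is extended to all real times, so that no time domain is carried along. *)
Let v t := u (clamp T t).

Let hu t : t \in `[0, T] -> sqv (u t).
Proof. by case: wu => _ _ [h _] tT; apply/in_Lp2_sqv; exact: h. Qed.

Let hv t : sqv (v t).
Proof. exact/hu/clamp_itv/ltW. Qed.

Let oo_cc t : t \in `]0, T[ -> t \in `[0, T].
Proof. exact: subset_itv_oo_cc. Qed.

Let v_id t : t \in `]0, T[ -> v t = u t.
Proof. by rewrite in_itv/= => /andP[/ltW a /ltW b]; rewrite /v clamp_id. Qed.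

Let ip_cont w : sqv w -> continuous (fun t => ip (v t) w).
Proof.
move=> hw; case: wu => _ _ [_ h].
have := within_clamp (ltW T0) (h w ((in_Lp2_sqv w).2 hw)).
rewrite (_ : (fun t => _) = fun t => ip (v t) w)//.
by apply/funext => t; exact: (int_mxdot (hv t) hw).
Qed.

(* [2 <v r, u s> - en (u s) <= en (u r) <= en u0] for a.e. [r], and the left-hand side is
   continuous in [r]. *)
Let en_le s : 0 <= s -> s <= T -> en (u s) <= en u0.
Proof.
move=> s0 sT; have hs : sqv (u s) by apply: hu; rewrite in_itv/= s0.
pose h r := 2 * ip (v r) (u s) - en (u s).
have ch : continuous h.
  move=> r; apply: cvgB; last exact: cst_continuous.
  by apply: cvgMl_tmp; exact: ip_cont.
have : h s <= en u0.
  apply: (continuous_le_ae T0 ch) => //.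
  apply: ae_imp au => r hr rT; have {}hr := hr rT.
  have hur := hu (oo_cc rT).
  rewrite (int_mxnorm2_en hur) (int_mxnorm2_en hu0) lee_fin in hr.
  apply: le_trans hr; rewrite /h (v_id rT).
  have := en_ge0 (vsub (u r) (u s)); rewrite (en_sub hur hs); lra.
by rewrite /h /v clamp_id// ip_self; lra.
Qed.

Let v_en t : en (v t) <= en u0.
Proof.
by have := clamp_itv t (ltW T0); rewrite in_itv/= => /andP[a b]; exact: en_le.
Qed.

Let v_wcts : wctsv (en u0) v.
Proof.
move=> i; split=> [t|t|w hw]; first exact: hv.
  exact: le_trans (n2_le_en _ _) (v_en t).
pose w' : E -> E := fun x => \row_k (if k == i then w x else 0).
have w'E k : (fun x => w' x 0 k) = if k == i then w else fun=> 0.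
  by apply/funext => x; rewrite mxE; case: ifP.
have hw' : sqv w' by move=> k; rewrite w'E; case: ifP => _; [exact: hw|exact: sqi0].
have e : (fun t => \int[mu]_x (v t x 0 i * w x)) = fun t => ip (v t) w'.
  apply/funext => t; rewrite /ip (bigD1 i)//= big1 ?addr0.
    by apply: eq_int => x; rewrite mxE eqxx.
  move=> k ki; rewrite -[RHS](int0 mu); apply: eq_int => x.
  by rewrite mxE (negbTE ki) mulr0.
by rewrite e; exact: ip_cont.
Qed.

Let v_div t : div_free (v t).
Proof.
move=> psi tpsi; rewrite (div_freeE _ tpsi).
pose g : E -> E := fun x => \row_j pderiv j psi x.
have [_ s2] := good_sqi (test_function_good tpsi).
have gE j : (fun x => g x 0 j) = pderiv j psi by apply/funext => x; rewrite mxE.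
have hg : sqv g by move=> j; rewrite gE; exact: s2.
have e : \sum_j \int[mu]_x (v t x 0 j * pderiv j psi x) = ip (v t) g.
  by apply: eq_bigr => j _; apply: eq_int => x; rewrite mxE.
rewrite e; have /andP[t0 tT] : 0 <= clamp T t <= T.
  by have := clamp_itv t (ltW T0); rewrite in_itv.
(* Clamping twice is clamping once, so the identity has to be extended by continuity only to times
   of $[0,T]$. *)
have -> : ip (v t) g = ip (v (clamp T t)) g.
  by rewrite /v (clamp_id t0 tT).
rewrite (continuous_eq_ae T0 (K := 0) (ip_cont hg)) ?oppr0//.
case: wu => _ h _; apply: ae_imp h => r hr rT.
have [_ hq] := hr rT; have := hq _ _ (test_function_W12 tpsi).
by rewrite (v_id rT) (int_mxdot (hu (oo_cc rT)) hg).
Qed.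

(** Both sides are continuous in $t$, so it suffices to check almost every $\tau$. There the weak
    formulation applies to the constant field $\rho*z$, whose time derivative is 0, leaving only the
    flux. *)
Let v_mom c rho drho z : mollifier c rho drho -> sqv z -> div_free z ->
  forall t, 0 <= t -> t <= T ->
  ip (v t) (mollv rho z) - ip u0 (mollv rho z) = tint (fun r => flux drho (v r) z) 0 t.
Proof.
move=> hm hz dz t t0 tT; apply/eqP; rewrite -subr_eq0; apply/eqP.
have hM := sqv_mollv hm hz.
pose F r := flux drho (v r) z.
have mF : measurable_fun setT (F : measurableTypeR R -> R).
  exact: (flux_measurable hms cs0 hm v_wcts (wctsv_cst hz)).
have FK r : `|F r| <= flux_cst drho (en u0) * Num.sqrt (en z) := flux_le hm (hv r) hz (v_en r).
pose h r := ip (v r) (mollv rho z) - ip u0 (mollv rho z) - tint F 0 r.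
have ch : continuous h.
  have c1 := @continuous_tint _ F _ 0 mF FK.
  move=> r; exact: (cvgB (cvgB (ip_cont hM (x := r)) (cvg_cst _)) (c1 r)).
apply: (continuous_eq_ae T0 ch) => //.
case: wu => _ hw _; apply: ae_imp hw => tau htau tauT.
have [hmom _] := htau tauT.
have := hmom _ _ (mollv_test_field hm T hz dz); rewrite /momentum_eq.
rewrite (int_mxdot (hu (oo_cc tauT)) hM) (int_mxdot hu0 hM).
rewrite /h (v_id tauT) /ip => <-.
rewrite -(Rintegral_tint tau mF); apply/eqP; rewrite subr_eq0; apply/eqP.
apply: eq_Rintegral => r; rewrite inE/= in_itv/= => /andP[r0 rtau].
have rT : r \in `]0, T[.
  by move: tauT; rewrite !in_itv/= r0 => /andP[_]; exact: lt_trans.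
rewrite /F /flux (v_id rT).
have hur := hu (oo_cc rT).
have ht i j := flux_term_ig hm i j hur hz.
rewrite (_ : (fun x => _) = fun x => \sum_i \sum_j
   (conv (drho j) (fun y => z y 0 i) x * (u r x 0 i * u r x 0 j))).
  rewrite int_sum; last by move=> i; apply: ig_sum => j; exact: ht.
  by apply: eq_bigr => i _; rewrite int_sum// => j; exact: ht.
apply/funext => x.
rewrite (_ : derive1 _ r = 0); last exact: derive1_cst.
rewrite (_ : mxdot (u r x) 0 = 0) ?add0r; last first.
  by rewrite /mxdot; apply: big1 => i _; apply: big1 => j _; rewrite mxE mulr0.
rewrite /mxdot; apply: eq_bigr => i _; apply: eq_bigr => j _.
by rewrite !mxE big_ord1 mxE mulrC.
Qed.

Lemma clamped_good_sol : good_sol T u0 v.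
Proof. exact: (GoodSol v_wcts v_en v_div v_mom). Qed.

End clamped_solution.

(** * Bounded representatives of the symmetric gradient *)

Section essential_bound.
Context {R : realType} {d : nat}.
Local Notation E := 'rV[R]_d.
Local Notation mu := (lebesgue_rV R d).
Local Notation lam := (@lebesgue_measure R).

Lemma measurable_fun_mxnorm2 d' (X : measurableType d') (D : set X) m n (f : X -> 'M[R]_(m, n)) :
  (forall i j, measurable_fun D (fun p => f p i j)) -> measurable_fun D (fun p => mxnorm2 (f p)).
Proof.
move=> mf; apply: (measurable_comp (F := setT)) => //.
  by apply: continuous_measurable_fun; exact: sqrt_continuous.
by apply: measurable_sum => i; apply: measurable_sum => j; apply: measurable_funM.
Qed.

(** Rewriting the norm through the measure of a level set prepares for Tonelli, which knows how such
    measures depend on a parameter. *)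
Lemma Lpnormy_leP m n (v : E -> 'M[R]_(m, n)) (a : R) :
  (forall i j, measurable_fun setT (fun x => v x i j)) ->
  (Lpnorm +oo v <= a%:E)%E <-> mu [set x | a < mxnorm2 (v x)] = 0%E.
Proof.
move=> mv.
have mA : measurable [set x : E | a < mxnorm2 (v x)].
  have := measurable_fun_mxnorm2 mv measurableT (measurable_itv `]a, +oo[).
  by rewrite setTI; congr measurable; apply/seteqP; split => x /=; rewrite in_itv/= andbT.
rewrite /Lpnorm unlock mu_setT_gt0; rewrite -(negligibleP mu mA); split.
  move=> /ess_supP; apply: negligibleS => x /= av; rewrite lee_fin ger0_norm ?mxnorm2_ge0//.
  by rewrite leNgt av.
move=> h; apply/ess_supP; apply: negligibleS h => x /=.
by rewrite lee_fin ger0_norm ?mxnorm2_ge0// => /negP; rewrite -ltNge.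
Qed.

Lemma Lpnorm_ge0 m n p (v : E -> 'M[R]_(m, n)) : (0 <= Lpnorm p v)%E.
Proof. exact: Lnorm_ge0. Qed.

Section time_dependent.
Variables (m n : nat) (T : R) (D : R -> E -> 'M[R]_(m, n)).
Hypothesis hD : in_L1Loo T D.
Let Dm : set (measurableTypeR R) := `]0, T[%classic.

Lemma measurable_fun_section r i j : r \in `]0, T[ -> measurable_fun setT (fun x => D r x i j).
Proof.
move=> rT; have [mD _] := hD.
apply: (@measurable_comp _ _ _ _ _ _ (`]0%R, T[ `*` setT)
  (fun p : measurableTypeR R * E => D p.1 p.2 i j) setT (fun x : E => (r : measurableTypeR R, x))).
- by apply: measurableX.
- by move=> _ [x _ <-]; split.
- exact: mD.
- exact: pair1_measurable.
Qed.

(** The times where the norm exceeds $a$ are those at which the section of the jointly measurable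
    set $\{|D|>a\}$ has nonzero measure. *)
Lemma measurable_fun_Lpnormy : measurable_fun Dm (fun r => Lpnorm +oo (D r)).
Proof.
have [mD _] := hD.
move=> mDm; apply: (measurability _ (ErealGenOInfty.measurableE R)) => //.
move=> _ [_ [a ->] <-].
pose A : set (measurableTypeR R * E) :=
  (`]0%R, T[ `*` setT) `&` [set p | a < mxnorm2 (D p.1 p.2)].
have mA : measurable A.
  have mDX : measurable ((`]0%R, T[ : set (measurableTypeR R)) `*` [set: E]).
    by apply: measurableX.
  have := measurable_fun_mxnorm2 mD mDX (measurable_itv `]a, +oo[).
  congr measurable; apply/seteqP; split => p /= [p1 p2]; split => //;
   by move: p2; rewrite in_itv/= andbT.
have := @measurable_fun_xsection _ _ _ _ _ mu A mA.
move=> /(_ measurableT [set~ 0%E]) H.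
have {}H := measurableI _ _ mDm (H (measurableC (emeasurable_set1 _))).
move: H; rewrite setTI; congr measurable; apply/seteqP; split => r /= [rT h]; split => //.
  rewrite in_itv/= andbT ltNge; apply/negP => /(Lpnormy_leP _ (fun i j => measurable_fun_section i j rT)).
  move=> e; apply: h; rewrite -e; congr (mu _); apply/seteqP; split => x /=.
    by move=> /xsectionP [].
  by move=> ax; apply/xsectionP.
move: h; rewrite in_itv/= andbT ltNge => /negP h e; apply: h.
apply/(Lpnormy_leP _ (fun i j => measurable_fun_section i j rT)); rewrite -e; congr (mu _).
apply/seteqP; split => x /=; last by move=> /xsectionP [].
by move=> ax; apply/xsectionP.
Qed.

(** Extension by 0 followed by [fine] produces a finite coefficient on the whole line, as Gronwall's
    lemma wants. It agrees with the norm wherever the latter is finite, hence almost everywhere on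
    $]0,T[$. *)
Lemma in_L1Loo_bound : exists a : R -> R, [/\ ig lam a, forall r, 0 <= a r &
  \forall r \ae lam, r \in `]0, T[ -> Lpnorm +oo (D r) = (a r)%:E].
Proof.
have [_ iD] := hD; have mN := measurable_fun_Lpnormy.
have iN : lam.-integrable Dm (fun r => Lpnorm +oo (D r)).
  apply/integrableP; split; first exact: mN.
  apply: le_lt_trans iD; rewrite le_eqVlt; apply/orP; left; apply/eqP.
  by apply: eq_integral => r _; rewrite gee0_abs// Lpnorm_ge0.
pose N := (fun r => Lpnorm +oo (D r)) \_ Dm.
have mDm : measurable Dm by exact: measurable_itv.
have iN' : lam.-integrable setT N by exact: (integrable_mkcond _ mDm).1 iN.
exists (fun r => fine (N r)); split.
- apply: (le_integrable _ _ _ iN') => //.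
    apply/measurable_EFinP; apply: measurableT_comp; first exact: measurable_fine.
    exact: (measurable_int _ iN').
  by move=> r _ /=; case: (N r) => [x| |] //=; rewrite leey.
- by move=> r; apply: fine_ge0; rewrite /N patchE; case: ifP => // _; exact: Lpnorm_ge0.
- apply: ae_imp (integrable_ae _ iN) => // r h rT.
  rewrite /N patchE mem_set//= fineK//; exact: h.
Qed.

End time_dependent.

Section representation.
Variables (V : E -> E) (D : E -> 'M[R]_d) (A : R).
Hypothesis mD : forall i j, measurable_fun setT (fun x => D x i j).
Hypothesis DA : Lpnorm +oo D = A%:E.
Hypothesis gradV : forall psi, test_function psi -> dist_symgrad V psi = dist_of D psi.

(** The limits at fixed time use a strain that is symmetric and bounded at every point. Symmetrising
    $D$ leaves the distribution unchanged because [dist_symgrad] is symmetric, and truncating to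
    $[-A,A]$ changes it only on a null set. *)
Lemma strain_representative : exists S : 'I_d -> 'I_d -> E -> R,
  [/\ forall i j, measurable_fun setT (S i j), forall i j x, `|S i j x| <= A,
      forall i j x, S i j x = S j i x &
      forall psi, test_function psi ->
        dist_symgrad V psi = \matrix_(i, j) \int[mu]_x (S i j x * psi x)].
Proof.
have A0 : 0 <= A by rewrite -lee_fin -DA; exact: Lpnorm_ge0.
have Dae : \forall x \ae mu, forall i j, `|D x i j| <= A by apply: Lpnormy_ae; rewrite DA.
pose B i j x := 2^-1 * (D x i j + D x j i).
pose S i j x := Num.max (- A) (Num.min A (B i j x)).
have mB i j : measurable_fun setT (B i j).
  by apply: measurable_funM => //; exact: measurable_funD (mD i j) (mD j i).
have mS i j : measurable_fun setT (S i j).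
  by apply: measurable_maxr => //; apply: measurable_minr.
have SA i j x : `|S i j x| <= A.
  rewrite ler_norml /S le_max lexx/= ge_max ge_min lexx/= andbT; lra.
exists S; split=> //; first by move=> i j x; rewrite /S /B addrC.
move=> psi tpsi; have gpsi := test_function_good tpsi.
have [r [h1 _]] := gt_supp gpsi.
have [_ ipsi] := ig_cont_supp (@gt_cont _ _ _ _ gpsi) h1.
have iD i j : ig mu (fun x => D x i j * psi x).
  apply: (ig_le_ae _ (igZ A (ig_norm ipsi))).
    exact: measurable_funM (mD i j) (igM ipsi).
  by apply: filterS Dae => x h; rewrite normrM ler_wpM2r.
have sym i j : dist_symgrad V psi i j = dist_symgrad V psi j i.
  by rewrite /dist_symgrad; move: (dist_grad V psi) => G; rewrite !mxE addrC.
apply/matrixP => i j; rewrite [RHS]mxE.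
have -> : dist_symgrad V psi i j = 2^-1 * (dist_of D psi i j + dist_of D psi j i).
  rewrite -(gradV tpsi) -(sym i j); lra.
rewrite !mxE -(intD (iD i j) (iD j i)) -(intZ _ (igD (iD i j) (iD j i))).
apply: eq_int_ae.
- exact: igM (igZ _ (igD (iD i j) (iD j i))).
- exact: measurable_funM (mS i j) (igM ipsi).
- apply: filterS Dae => x h; rewrite -mulrDl mulrA; congr (_ * _).
  have := h i j; have := h j i; rewrite !ler_norml => /andP[a1 a2] /andP[a3 a4].
  by rewrite /S /B min_r ?max_r//; lra.
Qed.

End representation.
End essential_bound.

(** * Uniqueness *)

Section uniqueness.
Context {R : realType} {d : nat}.
Local Notation E := 'rV[R]_d.
Local Notation mu := (lebesgue_rV R d).
Local Notation lam := (@lebesgue_measure R).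

Lemma en_eq0_ae (v : E -> E) : sqv v -> en v = 0 -> \forall x \ae mu, v x = 0.
Proof.
move=> hv v0; have vi0 i : n2 mu (fun x => v x 0 i) = 0.
  by apply/eqP; rewrite eq_le n2_ge0 andbT -v0 n2_le_en.
have vi i : \forall x \ae mu, v x 0 i = 0.
  have msq := igM (hv i).2.
  have : (\int[mu]_x `|(v x 0 i ^+ 2)%:E| = 0)%E.
    under eq_integral do rewrite gee0_abs ?lee_fin ?sqr_ge0//.
    by rewrite -(EFin_int (hv i).2); congr EFin; exact: vi0.
  move=> /(ae_eq_integral_abs _ measurableT ((measurable_EFinP _ _).2 msq)).
  apply: filterS => x /(_ Logic.I) [] /eqP.
  by rewrite sqrf_eq0 => /eqP.
have : \forall x \ae mu, forall i, v x 0 i = 0 by exact: filter_forall.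
by apply: filterS => x h; apply/rowP => i; rewrite mxE.
Qed.

Variables (cs : nat -> R) (rhos : nat -> E -> R) (drhos : nat -> 'I_d -> E -> R).
Hypothesis hms : forall m, mollifier (cs m) (rhos m) (drhos m).
Hypothesis cs0 : cs @ \oo --> 0.

Let MM m (w : E -> E) := mollv (rhos m) (mollv (rhos m) w).

Lemma ip_mollv2_cvg v w : sqv v -> sqv w -> ip v (MM m w) @[m --> \oo] --> ip v w.
Proof.
move=> hv hw; pose L i m := \int[mu]_x (1 * (v x 0 i * MM m w x 0 i)).
pose l i := \int[mu]_x (1 * (v x 0 i * w x 0 i)).
have hMM m i : sqi mu (fun x => MM m w x 0 i) := sqv_mollv (hms m) (sqv_mollv (hms m) hw) i.
have c i : L i m - l i @[m --> \oo] --> 0.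
  apply: (@l2_bil_cvg _ _ _ mu (fun=> fun x => v x 0 i) (fun m x => MM m w x 0 i)
    (fun=> fun=> 1) (fun x => v x 0 i) (fun x => w x 0 i) 1).
  - by move=> _; exact: measurable_cst.
  - by move=> _ x; rewrite normr1.
  - by move=> _; exact: hv.
  - by move=> m; exact: hMM.
  - exact: hv.
  - exact: hw.
  - rewrite (_ : (fun=> _) = fun=> 0); first exact: cvg_cst.
    apply/funext => n; rewrite /n2 -[RHS](int0 mu); apply: eq_int => x.
    by rewrite subrr expr0n.
  - apply: (cvg_eq (moll2_cvg hms cs0 (hw i))) => m.
    by rewrite /n2; apply: eq_int => x; rewrite /MM mollvE mollv_coord.
apply: (@cvg_sub0_trans _ _ (fun=> ip v w)); last exact: cvg_cst.
apply: (cvg_eq (cvg0_sum (index_enum 'I_d) c)) => m.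
rewrite /ip -sumrB; apply: eq_bigr => i _; congr (_ - _);
  by apply: eq_int => x; rewrite mul1r.
Qed.

Variables (T : R) (u0 : E -> E) (u U : R -> E -> E) (a : R -> R).
Hypothesis hu0 : sqv u0.
Hypothesis du0 : div_free u0.
Hypothesis gu : good_sol T u0 u.
Hypothesis gU : good_sol T u0 U.
Hypothesis ia : ig lam a.
Hypothesis a0 : forall r, 0 <= a r.
Hypothesis strainU : \forall r \ae lam, r \in `]0, T[ -> exists S : 'I_d -> 'I_d -> E -> R,
  [/\ forall i j, measurable_fun setT (S i j), forall i j x, `|S i j x| <= a r,
      forall i j x, S i j x = S j i x &
      forall psi, test_function psi ->
        dist_symgrad (U r) psi = \matrix_(i, j) \int[mu]_x (S i j x * psi x)].

Let hu r : sqv (u r) := wctsv_sqv r (gs_wcts gu).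
Let hU r : sqv (U r) := wctsv_sqv r (gs_wcts gU).

Let y r := en (vsub (u r) (U r)).

Let f m r := flux (drhos m) (u r) (mollv (rhos m) (U r)) +
  flux (drhos m) (U r) (mollv (rhos m) (u r)).

Let trilin_flux m v w : trilin rhos drhos m v w = flux (drhos m) v (mollv (rhos m) w).
Proof.
by apply: eq_bigr => i _; apply: eq_bigr => j _; rewrite mollv_coord.
Qed.

Let f_limit : \forall r \ae lam, r \in `]0, T[ ->
  (exists2 l, f m r @[m --> \oo] --> l & `|l| <= a r * d%:R * y r) /\
  forall m, `|f m r| <= a r * (3 * d%:R * en u0).
Proof.
apply: ae_imp strainU => r h rT; have [S [mS SA symS gradU]] := h rT.
have dU := gs_div gU r; have du := gs_div gu r.
have e m : trilin rhos drhos m (U r) (u r) + trilin rhos drhos m (u r) (U r) = f m r.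
  by rewrite !trilin_flux addrC.
split; last first.
  move=> m; rewrite -e.
  exact: (trilin_le hms cs0 mS SA (hU r) dU gradU (a0 r) m (hu r) du (gs_en gu r) (gs_en gU r)).
exists (sform S (fun x => u r x - U r x) (fun x => u r x - U r x)).
  exact: (cvg_eq (trilin_cvg hms cs0 mS SA symS (hU r) dU gradU (hu r) du) e).
exact: (sform_le mS SA (a0 r) (sqv_sub (hu r) (hU r))).
Qed.

(** Weak continuity does not make the norm of $u-U$ continuous in time, so measurability is obtained
    from [wcts_int_measurable] after expanding the square. *)
Let y_measurable : measurable_fun setT (y : measurableTypeR R -> R).
Proof.
have mp v w : good_sol T u0 v -> good_sol T u0 w ->
    measurable_fun setT ((fun r => ip (v r) (w r)) : measurableTypeR R -> R).
  move=> gv gw; apply: measurable_sum => i.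
  have h : measurable_fun setT ((fun r => \int[mu]_x (1 * (v r x 0 i * w r x 0 i)))
      : measurableTypeR R -> R).
    apply: (wcts_int_measurable hms cs0 (g := fun=> fun=> 1) (C := 1)
      (gs_wcts gv i) (gs_wcts gw i)).
    - by move=> x; exact: cst_continuous.
    - by move=> r; exact: measurable_cst.
    - by move=> r x; rewrite normr1.
  rewrite (_ : (fun r => _) = fun r => \int[mu]_x (1 * (v r x 0 i * w r x 0 i)))//.
  by apply/funext => r; apply: eq_int => x; rewrite mul1r.
rewrite (_ : y = fun r => ip (u r) (u r) + ip (U r) (U r) - 2 * ip (u r) (U r)).
  apply: measurable_funB; first by apply: measurable_funD; exact: mp.
  by apply: measurable_funM => //; exact: mp.
by apply/funext => r; rewrite /y (en_sub (hu r) (hU r)) !ip_self.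
Qed.

Let C := 2 * en u0 + 2 * (d%:R * (Num.sqrt (en u0) * Num.sqrt (en u0))).

Let y_bound r : 0 <= y r <= C.
Proof.
rewrite en_ge0/= /y (en_sub (hu r) (hU r)).
have h1 := gs_en gu r; have h2 := gs_en gU r.
have h3 : `|ip (u r) (U r)| <= d%:R * (Num.sqrt (en u0) * Num.sqrt (en u0)).
  apply: le_trans (ip_le (hu r) (hU r)) _; apply: ler_wpM2l => //.
  by apply: ler_pM; rewrite ?sqrtr_ge0// ler_sqrt// en_ge0.
by move: h3; rewrite ler_norml /C => /andP[h3 _]; lra.
Qed.

Let f_measurable m : measurable_fun setT (f m : measurableTypeR R -> R).
Proof.
apply: measurable_funD.
  exact: (flux_measurable hms cs0 (hms m) (gs_wcts gu) (wctsv_mollv (hms m) (gs_wcts gU))).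
exact: (flux_measurable hms cs0 (hms m) (gs_wcts gU) (wctsv_mollv (hms m) (gs_wcts gu))).
Qed.

Lemma energy_gap t : 0 <= t -> t <= T ->
  y t <= 2 * d%:R * tint (fun r => a r * y r) 0 t.
Proof.
move=> t0 tT; have ma := igM ia.
have y0 r : 0 <= y r by have /andP[] := y_bound r.
have yC r : `|y r| <= C by rewrite ger0_norm//; have /andP[] := y_bound r.
pose b r := a r * d%:R * y r.
have b0 r : 0 <= b r by rewrite !mulr_ge0.
have ib : ig lam b.
  by apply: eq_ig (ig_bdd y_measurable yC (igZ d%:R ia)) => r; rewrite /b; ring.
(* [F m] is the excess of $-f_m$ over the bound [b] of its limit. It tends to 0 at almost every time
   and is dominated by a multiple of $a$. Working with the excess avoids integrating the limit of
   $f_m$, which is built from a strain chosen separately at each time. *)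
pose F m r := tind 0 t r * Num.max 0 (- f m r - b r).
have mF m : measurable_fun setT (F m : measurableTypeR R -> R).
  apply: measurable_funM; first exact: measurable_tind.
  apply: measurable_maxr => //; apply: measurable_funB; last exact: igM ib.
  by apply: measurableT_comp => //; exact: f_measurable.
(* The strain is controlled on the open interval $]0,T[$ only, whereas [tind 0 t] includes the
   endpoint $t$, possibly equal to $T$. *)
have aeT : \forall r \ae lam, r != T.
  exists [set T]; split; [exact: measurable_set1|exact: lebesgue_measure_set1|].
  by move=> r /= /negP; rewrite negbK => /eqP.
have inT r : r != T -> 0 < r <= t -> r \in `]0, T[.
  move=> rT /andP[r0 rt]; rewrite in_itv/= r0 lt_neqAle rT/=; exact: le_trans rt tT.
have ae2 : \forall r \ae lam, 0 < r <= t ->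
  (exists2 l, f m r @[m --> \oo] --> l & `|l| <= b r) /\
  forall m, `|f m r| <= a r * (3 * d%:R * en u0).
  apply: ae_imp (ae_and aeT f_limit) => r [rT h] r0t.
  exact: h (inT r rT r0t).
have iK : ig lam (fun r => 3 * d%:R * en u0 * a r) := igZ _ ia.
have cF : \int[lam]_r F m r @[m --> \oo] --> \int[lam]_(r in setT) (0 : R).
  apply: (@dct_ae _ _ _ lam F (fun=> 0) _ mF _ iK) => //.
  - apply: ae_imp ae2 => r h.
    have [/h[[l fl lb] _]|h0] := boolP (0 < r <= t); last first.
      apply: (cvg_eq (f := fun=> 0)); first exact: cvg_cst.
      by move=> m; rewrite /F tindE (negbTE h0) mul0r.
    have c1 : Num.max 0 (- f m r - b r) @[m --> \oo] --> Num.max 0 (- l - b r).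
      apply: continuous_cvg; last first.
        by apply: cvgB; [exact: cvgN|exact: cvg_cst].
      by apply: continuous_max; [exact: cst_continuous|exact: cvg_id].
    have e : Num.max 0 (- l - b r) = 0.
      by rewrite max_l//; move: lb; rewrite ler_norml => /andP[lb _]; lra.
    by rewrite e in c1; rewrite -(mulr0 (tind 0 t r)); apply: cvgMl_tmp.
  - apply: ae_imp ae2 => r h m; rewrite /F tindE.
    have K0 : 0 <= 3 * d%:R * en u0 * a r by rewrite !mulr_ge0// en_ge0.
    have [/h[_ /(_ m) fm]|h0] := boolP (0 < r <= t); last by rewrite mul0r normr0.
    rewrite mul1r ger0_norm ?le_max ?lexx// ge_max K0/=.
    move: fm; rewrite ler_norml => /andP[fm _]; have := b0 r; lra.
rewrite int0 in cF.
have iF m : ig lam (F m).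
  apply: (ig_le_ae (mF m) iK); apply: ae_imp ae2 => r h; rewrite /F tindE.
  have K0 : 0 <= 3 * d%:R * en u0 * a r by rewrite !mulr_ge0// en_ge0.
  have [/h[_ /(_ m) fm]|h0] := boolP (0 < r <= t); last by rewrite mul0r normr0.
  rewrite mul1r ger0_norm ?le_max ?lexx// ge_max K0/=.
  move: fm; rewrite ler_norml => /andP[fm _]; have := b0 r; lra.
have itf m : ig lam (fun r => tind 0 t r * f m r).
  apply: (ig_le_ae _ iK).
    by apply: measurable_funM; [exact: measurable_tind|exact: f_measurable].
  apply: ae_imp ae2 => r h; rewrite tindE.
  have [/h[_ /(_ m) fm]|h0] := boolP (0 < r <= t); first by rewrite mul1r mulrC.
  by rewrite mul0r normr0 !mulr_ge0// en_ge0.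
have itb := ig_tind_mul_ig 0 t ib.
have lower m : - tint (f m) 0 t <= \int[lam]_r F m r + tint b 0 t.
  rewrite /tint -(intN (itf m)) -(intD (iF m) itb).
  apply: (le_int (igN (itf m)) (igD (iF m) itb)) => r.
  rewrite /F -mulrDr -mulrN; apply: ler_wpM2l; first exact: tind_ge0.
  by rewrite -lerBlDr le_max lexx orbT.
have ce : ip u0 (MM m u0) - ip (u t) (MM m (U t)) @[m --> \oo] --> en u0 - ip (u t) (U t).
  rewrite -(ip_self u0); exact: (cvgB (ip_mollv2_cvg hu0 hu0) (ip_mollv2_cvg (hu t) (hU t))).
have cu : \int[lam]_r F m r + tint b 0 t @[m --> \oo] --> tint b 0 t.
  by rewrite -[X in _ --> X]add0r; apply: cvgD; [exact: cF|exact: cvg_cst].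
have main : en u0 - ip (u t) (U t) <= tint b 0 t.
  apply: (ler_cvg_to ce cu); apply: nearW => m.
  apply: le_trans (lower m).
  have := energy_identity hms cs0 hu0 du0 gu gU (hms m) t0 tT.
  by rewrite -/(MM m (U t)) -/(MM m u0) => ->; rewrite opprD addrA subrr add0r.
have eb : tint b 0 t = d%:R * tint (fun r => a r * y r) 0 t.
  have iay : ig lam (fun r => a r * y r).
    by apply: eq_ig (ig_bdd y_measurable yC ia) => r; rewrite mulrC.
  rewrite /tint -(intZ d%:R (ig_tind_mul_ig 0 t iay)); apply: eq_int => r.
  by rewrite /b; ring.
rewrite /y (en_sub (hu t) (hU t)) -mulrA -eb.
have h1 := gs_en gu t; have h2 := gs_en gU t.
apply: (@le_trans _ _ (2 * (en u0 - ip (u t) (U t)))); last exact: ler_wpM2l.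
by rewrite mulrBr lerB// mulr_natl mulr2n lerD.
Qed.

Lemma good_sol_unique t : 0 <= t -> t <= T -> \forall x \ae mu, u t x = U t x.
Proof.
move=> t0 tT.
have d0 : 0 <= 2 * d%:R :> R by rewrite mulr_ge0.
have y0 := gronwall0 d0 ia a0 y_measurable y_bound energy_gap t0 tT.
have := en_eq0_ae (sqv_sub (hu t) (hU t)) y0.
by apply: filterS => x /eqP; rewrite /vsub subr_eq0 => /eqP.
Qed.

End uniqueness.

Theorem theorem1p6 (R : realType) (d : nat) (T : R)
    (u0 : 'rV[R]_d -> 'rV[R]_d) (u U : R -> 'rV[R]_d -> 'rV[R]_d) :
  0 < T ->
  in_Lp 2 u0 -> div_free u0 ->
  weak_solution T u0 u -> admissible T u0 u ->
  weak_solution T u0 U -> admissible T u0 U ->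
  symgrad_in_L1Loo T U ->
  forall t : R, t \in `[0, T] ->
    \forall x \ae (@lebesgue_rV R d), u t x = U t x.
Proof.
move=> T0 /in_Lp2_sqv hu0 du0 wu au wU aU [D hD gradD] t.
rewrite in_itv/= => /andP[t0 tT].
have /choice[rd hms] (m : nat) :
    exists rd, @mollifier R d m.+1%:R^-1 rd.1 rd.2.
  have [|rho [drho h]] := @mollifier_exists R d m.+1%:R^-1; first by rewrite invr_gt0.
  by exists (rho, drho).
have cs0 := @cvg_harmonic R.
have gu := clamped_good_sol hms cs0 T0 hu0 wu au.
have gU := clamped_good_sol hms cs0 T0 hu0 wU aU.
have [a [ia a0 aD]] := in_L1Loo_bound hD.
have strainU : \forall r \ae (@lebesgue_measure R), r \in `]0, T[ ->
    exists S : 'I_d -> 'I_d -> 'rV[R]_d -> R,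
    [/\ forall i j, measurable_fun setT (S i j), forall i j x, `|S i j x| <= a r,
      forall i j x, S i j x = S j i x &
      forall psi, test_function psi -> dist_symgrad (U (clamp T r)) psi =
        \matrix_(i, j) \int[lebesgue_rV R d]_x (S i j x * psi x)].
  apply: ae_imp (ae_and aD gradD) => r [h1 h2] rT.
  have -> : clamp T r = r.
    by move: rT; rewrite in_itv/= => /andP[/ltW r0 /ltW rT]; exact: clamp_id.
  exact: (strain_representative (fun i j => measurable_fun_section hD i j rT) (h1 rT) (h2 rT)).
have := good_sol_unique hms cs0 hu0 du0 gu gU ia a0 strainU t0 tT.
by rewrite (clamp_id t0 tT).
Qed.
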